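(* Let $F=\langle x_1,\dots,x_n\rangle$ be a free group of rank $n$, let $r\in F$ with $r\neq1$, let $G=F/\langle r\rangle$ be the corresponding one-relator group (the quotient of $F$ by the normal closure of $r$), and suppose $G$ is $1$-formal. Then \[ \operatorname{Hilb}(\operatorname{gr}(G/G''),t)=\begin{cases}1+nt-\dfrac{1-nt+t^2}{(1-t)^n}&\text{if }r\in[F,F],\\[8pt] 1+(n-1)t-\dfrac{1-(n-1)t}{(1-t)^{n-1}}&\text{otherwise}.\end{cases} \]
   Context: For a group $H$, $\Gamma_1H=H$, $\Gamma_{k+1}H=[\Gamma_kH,H]$, $\operatorname{gr}(H)=\bigoplus_{k\ge1}(\Gamma_kH/\Gamma_{k+1}H)\otimes\mathbb{Q}$, and $H''=[[H,H],[H,H]]$. For a graded vector space $V$, $\operatorname{Hilb}(V,t)=\sum_k\dim_{\mathbb{Q}}(V_k)t^k$. $1$-formality: let $I$ be the augmentation ideal of $\mathbb{Q}G$. The completion $\widehat{\mathbb{Q}G}=\varprojlim_k\mathbb{Q}G/I^k$ is a complete Hopf algebra, with comultiplication induced by $g\mapsto g\otimes g$. The Malcev Lie algebra $\mathfrak{m}(G)$ is the complete filtered Lie algebra of primitive elements of $\widehat{\mathbb{Q}G}$. $G$ is $1$-formal if $\mathfrak{m}(G)$ admits a quadratic presentation, i.e. is isomorphic as a filtered Lie algebra to the degree completion of a graded Lie algebra with finitely many generators in degree $1$ and relations in degree $2$. *)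

(* Defs.v *)
From HB Require Import structures.
From mathcomp Require Import all_boot all_order all_algebra.
From mathcomp Require Import generic_quotient.
From mathcomp Require Import boolp classical_sets functions.
From mathcomp Require Import freeg.

Set Implicit Arguments.
Unset Strict Implicit.
Unset Printing Implicit Defensive.

Import GRing.Theory.

Local Open Scope quotient_scope.
Local Open Scope classical_set_scope.
Local Open Scope ring_scope.

Section Subgroups.
Local Open Scope group_scope.
Variable H : groupType.
Implicit Types (S A B : set H).

Inductive gen S : set H :=
| gen_mem x of S x : gen S x
| gen_one : gen S 1
| gen_div x y of gen S x & gen S y : gen S (x * y^-1).

Definition normal_closure S : set H := gen [set s ^ g | s in S & g in [set: H]].

Definition comm_sub A B : set H := gen [set [~ a, b] | a in A & b in B].

(* [lcs k] is $\Gamma_k H$ for k >= 1; the value at 0 is chosen so that the *)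
(* degree-0 component of the associated graded space vanishes *)
Fixpoint lcs (k : nat) : set H :=
  if k is k'.+1 then
    (if k' is 0%N then [set: H] else comm_sub (lcs k') [set: H])
  else [set: H].

Definition der1 : set H := comm_sub [set: H] [set: H].
Definition der2 : set H := comm_sub der1 der1.

Lemma genV S x : gen S x -> gen S x^-1.
Proof. by move=> Sx; rewrite -[x^-1]mul1g; apply: gen_div => //; apply: gen_one. Qed.

Lemma genM S x y : gen S x -> gen S y -> gen S (x * y).
Proof. by move=> Sx Sy; rewrite -[y]invgK; apply: gen_div => //; apply: genV. Qed.

Lemma normal_closureJ S x g : normal_closure S x -> normal_closure S (x ^ g).
Proof.
elim=> [y [s Ss [h _ <-]]||y z _ IHy _ IHz].
- by apply: gen_mem; exists s => //; exists (h * g) => //; rewrite conjgM.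
- by rewrite conj1g; apply: gen_one.
- by rewrite conjMg conjVg; apply: gen_div.
Qed.

Lemma gen_group_closed S : group_closed (fun x => `[< gen S x >]).
Proof.
split; first by apply/asboolP; exact: gen_one.
by move=> x y /asboolP Sx /asboolP Sy; apply/asboolP/gen_div.
Qed.

End Subgroups.

Arguments lcs H k : clear implicits.
Arguments der1 H : clear implicits.
Arguments der2 H : clear implicits.

Section SubgroupType.
Variables (H : groupType) (S : set H).

Record subgrp := SubGrp { subgrp_val :> H; _ : `[< gen S subgrp_val >] }.

HB.instance Definition _ := [isSub for subgrp_val].
HB.instance Definition _ := [Choice of subgrp by <:].
HB.instance Definition _ :=
  SubChoice_isSubGroup.Build H _ subgrp (@gen_group_closed H S).

End SubgroupType.

Section QuotientGroup.
Local Open Scope group_scope.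
Variables (H : groupType) (S : set H).

Definition quo_rel (x y : H) : bool := `[< normal_closure S (x^-1 * y) >].

Lemma quo_rel_equiv : equiv_class_of quo_rel.
Proof.
split=> [x|x y|y x z].
- by apply/asboolP; rewrite mulVg; apply: gen_one.
- by apply/asboolP/asboolP => /genV; rewrite invgM invgK.
- move=> /asboolP xy /asboolP yz; apply/asboolP.
  by have := genM xy yz; rewrite mulgA mulgK.
Qed.

Canonical quo_equiv := EquivRelPack quo_rel_equiv.
Canonical quo_encModRel := defaultEncModRel quo_rel.

Definition quo : Type := {eq_quot quo_rel}.
HB.instance Definition _ := Choice.on quo.
HB.instance Definition _ := EqQuotient.on quo.

Lemma quoP x y : reflect (normal_closure S (x^-1 * y)) (\pi_quo x == \pi_quo y).
Proof. by rewrite eqmodE; apply: asboolP. Qed.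

Definition quo_one : quo := \pi_quo 1.
Definition quo_mul (u v : quo) : quo := \pi_quo (repr u * repr v).
Definition quo_inv (u : quo) : quo := \pi_quo (repr u)^-1.

Lemma quo_mulE x y : quo_mul (\pi_quo x) (\pi_quo y) = \pi_quo (x * y).
Proof.
apply/eqP/quoP; set a := repr _; set b := repr _.
have /eqP/quoP ax : \pi_quo a = \pi_quo x by rewrite reprK.
have /eqP/quoP yb : \pi_quo b = \pi_quo y by rewrite reprK.
have -> : (a * b)^-1 * (x * y) = (a^-1 * x) ^ b * (b^-1 * y).
  by rewrite conjgE invgM !mulgA mulgK.
by apply: genM => //; apply: normal_closureJ.
Qed.

Lemma quo_invE x : quo_inv (\pi_quo x) = \pi_quo x^-1.
Proof.
apply/eqP/quoP; set a := repr _.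
have /eqP/quoP ax : \pi_quo a = \pi_quo x by rewrite reprK.
have -> : (a^-1)^-1 * x^-1 = ((a^-1 * x) ^ x^-1)^-1 ^ 1.
  by rewrite conjg1 conjgE mulgK invgM !invgK.
by apply: normal_closureJ; apply: genV; apply: normal_closureJ.
Qed.

Fact quo_mulA : associative quo_mul.
Proof.
elim/quotW=> x; elim/quotW=> y; elim/quotW=> z.
by rewrite (quo_mulE y z) (quo_mulE x y) (quo_mulE x) (quo_mulE (x * y)) mulgA.
Qed.
Fact quo_mul1 : left_id quo_one quo_mul.
Proof. by elim/quotW=> x; rewrite quo_mulE mul1g. Qed.
Fact quo_mulr1 : right_id quo_one quo_mul.
Proof. by elim/quotW=> x; rewrite quo_mulE mulg1. Qed.
Fact quo_mulV : left_inverse quo_one quo_inv quo_mul.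
Proof. by elim/quotW=> x; rewrite quo_invE quo_mulE mulVg. Qed.
Fact quo_mulrV : right_inverse quo_one quo_inv quo_mul.
Proof. by elim/quotW=> x; rewrite quo_invE quo_mulE mulgV. Qed.

HB.instance Definition _ :=
  isGroup.Build quo quo_mulA quo_mul1 quo_mulr1 quo_mulV quo_mulrV.

End QuotientGroup.

Section FreeGroup.
Local Open Scope group_scope.

Definition free_on (n : nat) (F : groupType) (x : 'I_n -> F) : Prop :=
  forall (H : groupType) (y : 'I_n -> H),
    exists! f : F -> H,
      {morph f : a b / a * b} /\ (forall i, f (x i) = y i).

Definition one_relator (F : groupType) (r : F) : groupType := quo [set r].

End FreeGroup.

Section Span.
Variable V : lmodType rat.

Inductive lspan (S : set V) : set V :=
| lspan0 : lspan S 0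
| lspan_cons c u v of S u & lspan S v : lspan S (c *: u + v).

Variable S : set V.

Lemma lspan_mem u : S u -> lspan S u.
Proof. by move=> Su; rewrite -[u]scale1r -[_ *: _]addr0; do 2?constructor. Qed.

Lemma lspanD u v : lspan S u -> lspan S v -> lspan S (u + v).
Proof.
move=> + Sv; elim=> [|c a b Sa _ IHb]; first by rewrite add0r.
by rewrite -addrA; constructor.
Qed.

Lemma lspanZ c u : lspan S u -> lspan S (c *: u).
Proof.
elim=> [|d a b Sa _ IHb]; first by rewrite scaler0; constructor.
by rewrite scalerDr scalerA; constructor.
Qed.

Lemma lspanN u : lspan S u -> lspan S (- u).
Proof. by rewrite -scaleN1r; apply: lspanZ. Qed.

Lemma lspan_min (P : set V) :
  P 0 -> (forall c u v, P u -> P v -> P (c *: u + v)) -> S `<=` P ->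
  lspan S `<=` P.
Proof. by move=> P0 PD SP x; elim=> // c u v /SP Pu _ Pv; apply: PD. Qed.

End Span.

Section QuotientSpace.
Variables (V : lmodType rat) (S : set V).

Definition lquo_rel (u v : V) : bool := `[< lspan S (u - v) >].

Lemma lquo_rel_equiv : equiv_class_of lquo_rel.
Proof.
split=> [x|x y|y x z].
- by apply/asboolP; rewrite subrr; apply: lspan0.
- by apply/asboolP/asboolP => /lspanN; rewrite opprB.
- move=> /asboolP xy /asboolP yz; apply/asboolP.
  by have := lspanD xy yz; rewrite addrA subrK.
Qed.

Canonical lquo_equiv := EquivRelPack lquo_rel_equiv.
Canonical lquo_encModRel := defaultEncModRel lquo_rel.

Definition lquo : Type := {eq_quot lquo_rel}.
HB.instance Definition _ := Choice.on lquo.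
HB.instance Definition _ := EqQuotient.on lquo.

Lemma lquoP u v : reflect (lspan S (u - v)) (\pi_lquo u == \pi_lquo v).
Proof. by rewrite eqmodE; apply: asboolP. Qed.

Lemma lquo_repr u : lspan S (repr (\pi_lquo u) - u).
Proof. by apply/lquoP; rewrite reprK. Qed.

Definition lquo_add (a b : lquo) : lquo := \pi_lquo (repr a + repr b).
Definition lquo_opp (a : lquo) : lquo := \pi_lquo (- repr a).
Definition lquo_scale c (a : lquo) : lquo := \pi_lquo (c *: repr a).

Lemma lquo_addE u v : lquo_add (\pi_lquo u) (\pi_lquo v) = \pi_lquo (u + v).
Proof.
by apply/eqP/lquoP; rewrite opprD addrACA; apply: lspanD; apply: lquo_repr.
Qed.

Lemma lquo_oppE u : lquo_opp (\pi_lquo u) = \pi_lquo (- u).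
Proof. by apply/eqP/lquoP; rewrite -opprD; apply/lspanN/lquo_repr. Qed.

Lemma lquo_scaleE c u : lquo_scale c (\pi_lquo u) = \pi_lquo (c *: u).
Proof. by apply/eqP/lquoP; rewrite -scalerBr; apply/lspanZ/lquo_repr. Qed.

Fact lquo_addA : associative lquo_add.
Proof.
elim/quotW=> x; elim/quotW=> y; elim/quotW=> z.
by rewrite (lquo_addE y z) (lquo_addE x y) (lquo_addE x) (lquo_addE (x + y)) addrA.
Qed.
Fact lquo_addC : commutative lquo_add.
Proof. by elim/quotW=> x; elim/quotW=> y; rewrite !lquo_addE addrC. Qed.
Fact lquo_add0 : left_id (\pi_lquo 0) lquo_add.
Proof. by elim/quotW=> x; rewrite lquo_addE add0r. Qed.
Fact lquo_addN : left_inverse (\pi_lquo 0) lquo_opp lquo_add.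
Proof. by elim/quotW=> x; rewrite lquo_oppE lquo_addE addNr. Qed.

HB.instance Definition _ :=
  GRing.isZmodule.Build lquo lquo_addA lquo_addC lquo_add0 lquo_addN.

Fact lquo_scaleA a b v : lquo_scale a (lquo_scale b v) = lquo_scale (a * b) v.
Proof.
elim/quotW: v => v.
by rewrite (lquo_scaleE b) (lquo_scaleE a) (lquo_scaleE (a * b)) scalerA.
Qed.
Fact lquo_scale1 : left_id 1 lquo_scale.
Proof. by elim/quotW=> v; rewrite lquo_scaleE scale1r. Qed.
Fact lquo_scaleDr : right_distributive lquo_scale +%R.
Proof.
move=> c; elim/quotW=> u; elim/quotW=> v.
rewrite [_ + _](lquo_addE u v) (lquo_scaleE c (u + v)) scalerDr.
by rewrite (lquo_scaleE c u) (lquo_scaleE c v) -lquo_addE.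
Qed.
Fact lquo_scaleDl v : {morph lquo_scale^~ v : a b / a + b}.
Proof.
move=> a b; elim/quotW: v => v.
rewrite (lquo_scaleE (a + b)) scalerDl.
by rewrite (lquo_scaleE a) (lquo_scaleE b) -lquo_addE.
Qed.

HB.instance Definition _ := GRing.Zmodule_isLmodule.Build rat lquo
  lquo_scaleA lquo_scale1 lquo_scaleDr lquo_scaleDl.

Lemma lquo_piD u v : \pi_lquo (u + v) = \pi_lquo u + \pi_lquo v.
Proof. by rewrite [RHS]lquo_addE. Qed.
Lemma lquo_piZ c u : \pi_lquo (c *: u) = c *: \pi_lquo u.
Proof. by rewrite [RHS]lquo_scaleE. Qed.
End QuotientSpace.

Section FreeModule.
Variable K : choiceType.
Implicit Types (M : lmodType rat) (D : {freeg K / rat}).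

Lemma fgliftD M (f : K -> M) : {morph fglift f : x y / x + y}.
Proof.
move=> x y; have fB := lift_is_additive f.
have f0 : fglift f 0 = 0 by rewrite -(subr0 0) fB subrr.
have fN u : fglift f (- u) = - fglift f u by rewrite -sub0r fB f0 sub0r.
by rewrite -{1}[y]opprK fB fN opprK.
Qed.

Lemma fglift0 M (f : K -> M) : fglift f 0 = 0.
Proof. by apply: (addIr (fglift f 0)); rewrite -fgliftD !add0r. Qed.

Lemma fgliftE M (f : K -> M) D :
  fglift f D = \sum_(z <- dom D) coeff z D *: f z.
Proof.
rewrite -{1}[D]freeg_sumE (big_morph _ (fgliftD f) (fglift0 f)).
by apply: eq_bigr => z _; rewrite liftU.
Qed.

Lemma fgU_scale c z : << c *g z >> = c *: << z >> :> {freeg K / rat}.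
Proof.
by apply/eqP/freeg_eqP => y; rewrite coeffZ !coeffU mul1r.
Qed.

Lemma fg_ind (P : {freeg K / rat} -> Prop) :
  P 0 -> (forall c z D, P D -> P (c *: << z >> + D)) -> forall D, P D.
Proof.
move=> P0 PD D; rewrite -[D]freeg_sumE; elim: (dom D) => [|z s IHs].
  by rewrite big_nil.
by rewrite big_cons fgU_scale; apply: PD.
Qed.

Lemma fgliftZ M (f : K -> M) c D : fglift f (c *: D) = c *: fglift f D.
Proof.
elim/fg_ind: D => [|d z D IHD]; first by rewrite !(scaler0, fglift0).
by rewrite scalerDr !fgliftD IHD scalerDr scalerA -!fgU_scale !liftU scalerA.
Qed.

Lemma fglift1 M (f : K -> M) z : fglift f << z >> = f z.
Proof. by rewrite liftU scale1r. Qed.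

Lemma fglift_linear M (f : K -> M) : linear (fglift f).
Proof. by move=> c u v; rewrite fgliftD fgliftZ. Qed.

End FreeModule.

Section Tensor.
Local Open Scope group_scope.

(* $A \otimes_{\mathbb Z} \mathbb Q$ for an abelian group A, written *)
(* multiplicatively: <<a>> stands for $a \otimes 1$, and the scalar *)
(* multiplication accounts for the second tensor factor *)
Definition tensQ (A : groupType) : lmodType rat :=
  lquo [set D : {freeg A / rat} |
        exists a b : A, D = (<< (a * b)%g >> - << a >> - << b >>)%R].

(* $(\Gamma_k H / \Gamma_{k+1} H) \otimes \mathbb Q$ *)
Definition gr (H : groupType) (k : nat) : lmodType rat :=
  tensQ (quo [set x : subgrp (lcs H k) | lcs H k.+1 (val x)]).

End Tensor.

Definition galg (G : groupType) : Type := {freeg G / rat}.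
HB.instance Definition _ (G : groupType) := GRing.Lmodule.on (galg G).

Section GroupAlgebra.
Variable G : groupType.
Implicit Types a b c : galg G.

Definition ginj (g : G) : galg G := << g >>.

Definition gamul a b : galg G :=
  fglift (fun g => fglift (fun h => ginj (g * h)%g) b : galg G) a.

Lemma gamulU g h : gamul (ginj g) (ginj h) = ginj (g * h)%g.
Proof. by rewrite /gamul !fglift1. Qed.

Lemma gamul_linearl b : linear (gamul^~ b).
Proof. exact: fglift_linear. Qed.

Lemma gamul_linearr a : linear (gamul a).
Proof.
move=> c u v; rewrite /gamul !fgliftE scaler_sumr -big_split /=.
by apply: eq_bigr => g _; rewrite fglift_linear scalerDr !scalerA mulrC.
Qed.

Lemma galg_ind (P : galg G -> Prop) :
  P 0 -> (forall (k : rat) g a, P a -> P (k *: ginj g + a)) -> forall a, P a.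
Proof. exact: fg_ind. Qed.

Let gamulDl a b c : gamul (a + b) c = gamul a c + gamul b c.
Proof. by have := gamul_linearl c 1 a b; rewrite !scale1r. Qed.
Let gamulDr a b c : gamul a (b + c) = gamul a b + gamul a c.
Proof. by have := gamul_linearr a 1 b c; rewrite !scale1r. Qed.
Let gamul0l a : gamul 0 a = 0.
Proof. by apply: (addIr (gamul 0 a)); rewrite -gamulDl !add0r. Qed.
Let gamul0r a : gamul a 0 = 0.
Proof. by apply: (addIr (gamul a 0)); rewrite -gamulDr !add0r. Qed.
Let gamulZl k a b : gamul (k *: a) b = k *: gamul a b.
Proof. by have := gamul_linearl b k a 0; rewrite !addr0 gamul0l addr0. Qed.
Let gamulZr k a b : gamul a (k *: b) = k *: gamul a b.
Proof. by have := gamul_linearr a k b 0; rewrite !addr0 gamul0r addr0. Qed.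

Fact gamulA : associative gamul.
Proof.
elim/galg_ind=> [|k g a IHa] b c; first by rewrite !gamul0l.
rewrite !(gamulDl, gamulZl) IHa; congr (_ *: _ + _); clear IHa.
elim/galg_ind: b c => [|l h b IHb] c; first by rewrite !(gamul0l, gamul0r).
rewrite !(gamulDl, gamulDr, gamulZl, gamulZr) IHb; congr (_ *: _ + _); clear IHb.
elim/galg_ind: c => [|m i c IHc]; first by rewrite !gamul0r.
by rewrite !(gamulDr, gamulZr) IHc !gamulU mulgA.
Qed.

Fact gamul1l : left_id (ginj 1%g) gamul.
Proof.
elim/galg_ind=> [|k g a IHa]; first by rewrite gamul0r.
by rewrite gamulDr gamulZr IHa gamulU mul1g.
Qed.

Fact gamul1r : right_id (ginj 1%g) gamul.
Proof.
elim/galg_ind=> [|k g a IHa]; first by rewrite gamul0l.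
by rewrite gamulDl gamulZl IHa gamulU mulg1.
Qed.

Fact galg_oner_neq0 : ginj 1%g != 0.
Proof. by rewrite freegU_eq0 oner_eq0. Qed.

HB.instance Definition _ := GRing.Zmodule_isNzRing.Build (galg G)
  gamulA gamul1l gamul1r gamulDl gamulDr galg_oner_neq0.

HB.instance Definition _ := GRing.Lmodule_isLalgebra.Build rat (galg G)
  (fun k a b => esym (gamulZl k a b)).
HB.instance Definition _ := GRing.Lalgebra_isAlgebra.Build rat (galg G)
  (fun k a b => esym (gamulZr k a b)).

Lemma ginjM g h : ginj (g * h)%g = ginj g * ginj h.
Proof. by rewrite -gamulU. Qed.

Definition aug (a : galg G) : rat := fglift (fun _ => 1 : rat^o) a.

Lemma augU g : aug (ginj g) = 1.
Proof. exact: (@fglift1 _ rat^o). Qed.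

Lemma augD a b : aug (a + b) = aug a + aug b.
Proof. exact: (@fgliftD _ rat^o). Qed.
Lemma aug0 : aug 0 = 0.
Proof. exact: (@fglift0 _ rat^o). Qed.
Lemma augZ k a : aug (k *: a) = k * aug a.
Proof. exact: (@fgliftZ _ rat^o). Qed.

Lemma augM a b : aug (a * b) = aug a * aug b.
Proof.
elim/galg_ind: a => [|k g a IHa]; first by rewrite mul0r aug0 mul0r.
rewrite mulrDl -scalerAl !augD !augZ IHa mulrDl augU mulr1; congr (_ + _).
congr (_ * _).
elim/galg_ind: b {IHa} => [|l h b IHb]; first by rewrite mulr0.
by rewrite mulrDr -scalerAr -ginjM !augD !augZ IHb !augU.
Qed.

(* [augI k] is the k-th power of the augmentation ideal *)
Fixpoint augI (k : nat) : set (galg G) :=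
  if k is k'.+1 then
    lspan [set a : galg G |
      exists b c, [/\ augI k' b, aug c = 0 & a = b * c]]
  else [set: galg G].

Lemma augI_submod k :
  augI k 0 /\ (forall x a b, augI k a -> augI k b -> augI k (x *: a + b)).
Proof.
case: k => [|k] //; split=> [|x a b Ia Ib]; first exact: lspan0.
by apply: lspanD => //; apply: lspanZ.
Qed.

Lemma augI_mull k a b : augI k b -> augI k (a * b).
Proof.
elim: k a b => [|k IHk] a b //=; elim=> [|x u v [b' [c [Ib' c0 ->]]] _ IHv].
  by rewrite mulr0; apply: lspan0.
rewrite mulrDr -scalerAr; apply: lspan_cons => //.
by exists (a * b'), c; rewrite mulrA; split=> //; apply: IHk.
Qed.

Lemma augI_mulr k a b : augI k a -> augI k (a * b).
Proof.
case: k => [|k] //=; elim=> [|x u v [b' [c [Ib' c0 ->]]] _ IHv].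
  by rewrite mul0r; apply: lspan0.
rewrite mulrDl -scalerAl; apply: lspan_cons => //.
by exists b', (c * b); rewrite mulrA augM c0 mul0r.
Qed.

Lemma augI_desc k a : augI k.+1 a -> augI k a.
Proof.
case: (augI_submod k) => I0 ID; apply: lspan_min => // _ [b [c [Ib _ ->]]].
exact: augI_mulr.
Qed.

Lemma augI1_aug a : augI 1 a -> aug a = 0.
Proof.
apply: (lspan_min (P := fun a => aug a = 0)) => [|c u v u0 v0|].
- exact: aug0.
- by rewrite augD augZ u0 v0 mulr0 addr0.
- by move=> _ [b [c [_ c0 ->]]] /=; rewrite augM c0 mulr0.
Qed.

End GroupAlgebra.

Section GroupAlgebraMap.
Variables (G H : groupType) (f : G -> H).

Definition galgmap (a : galg G) : galg H := fglift (fun g => ginj (f g)) a.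

Lemma galgmap_linear : linear galgmap.
Proof. exact: fglift_linear. Qed.

Lemma galgmap0 : galgmap 0 = 0.
Proof. exact: fglift0. Qed.
Lemma galgmapB a b : galgmap (a - b) = galgmap a - galgmap b.
Proof. exact: lift_is_additive. Qed.

Lemma galgmapU g : galgmap (ginj g) = ginj (f g).
Proof. exact: fglift1. Qed.

Hypothesis fM : {morph f : x y / (x * y)%g}.

Lemma galgmapM : {morph galgmap : a b / a * b}.
Proof.
elim/galg_ind=> [|k g a IHa] b; first by rewrite !(mul0r, galgmap0).
rewrite mulrDl -scalerAl !galgmap_linear IHa /= mulrDl -scalerAl galgmapU.
congr (_ *: _ + _).
elim/galg_ind: b => [|l h b IHb]; first by rewrite !(mulr0, galgmap0).
rewrite mulrDr -scalerAr -ginjM !galgmap_linear IHb /= !galgmapU fM ginjM.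
by rewrite mulrDr -scalerAr.
Qed.

Lemma galgmap1 : galgmap 1 = 1.
Proof.
rewrite galgmapU; congr ginj; apply: (mulIg (f 1%g)).
by rewrite -fM mul1g mul1g.
Qed.

Lemma aug_galgmap a : aug (galgmap a) = aug a.
Proof.
elim/galg_ind: a => [|k g a IHa]; first by rewrite galgmap0 !aug0.
by rewrite galgmap_linear /= !augD !augZ IHa galgmapU !augU.
Qed.

End GroupAlgebraMap.

(* decreasing filtrations by two-sided ideals *)
Record filtration (A : algType rat) := Filtration {
  fil :> nat -> set A;
  fil0 : forall k, fil k 0;
  fil_linear : forall k c a b, fil k a -> fil k b -> fil k (c *: a + b);
  fil_mull : forall k a b, fil k b -> fil k (a * b);
  fil_mulr : forall k a b, fil k a -> fil k (a * b);
  fil_desc : forall k a, fil k.+1 a -> fil k a;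
  fil_proper : ~ fil 1 1
}.

Section Completion.
Variables (A : algType rat) (F : filtration A).

Lemma fil_spanE k : lspan (F k) `<=` F k.
Proof. apply: lspan_min => //; [exact: fil0 | exact: fil_linear]. Qed.

Lemma filP k a b : F k (a - b) <-> \pi_(lquo (F k)) a = \pi_(lquo (F k)) b.
Proof.
split=> [Fab|/eqP/lquoP/fil_spanE //].
by apply/eqP/lquoP/lspan_mem.
Qed.

Definition ctrans k (u : lquo (F k.+1)) : lquo (F k) := \pi_(lquo (F k)) (repr u).

Lemma ctransE k a : ctrans (\pi_(lquo (F k.+1)) a) = \pi_(lquo (F k)) a.
Proof. by apply/filP/fil_desc/filP; rewrite reprK. Qed.

(* $\varprojlim_k A / F_k$ *)
Record compl := Compl {
  cpt :> forall k, lquo (F k);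
  _ : `[< forall k, ctrans (cpt k.+1) = cpt k >] }.

HB.instance Definition _ := [isSub for cpt].
HB.instance Definition _ := [Choice of compl by <:].

Lemma cptP (x : compl) k : ctrans (x k.+1) = x k.
Proof. by case: x => x /= /asboolP. Qed.

Lemma compl_eq (x y : compl) : (forall k, x k = y k) -> x = y.
Proof. by move=> xy; apply/val_inj/functional_extensionality_dep. Qed.

Definition compl_of (x : forall k, lquo (F k))
    (xP : forall k, ctrans (x k.+1) = x k) : compl :=
  Compl (introT (asboolP _) xP).

Lemma cpt_rep (x : compl) k :
  exists a, x k = \pi_(lquo (F k)) a /\ x k.+1 = \pi_(lquo (F k.+1)) a.
Proof.
exists (repr (x k.+1)); split; last by rewrite reprK.
by rewrite -(cptP x k).
Qed.

Lemma lquo_mulE k a b :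
  \pi_(lquo (F k)) (repr (\pi_(lquo (F k)) a) * repr (\pi_(lquo (F k)) b)) =
  \pi_(lquo (F k)) (a * b).
Proof.
apply/filP; set a' := repr _; set b' := repr _.
have Fa : F k (a' - a) by apply/filP; rewrite reprK.
have Fb : F k (b' - b) by apply/filP; rewrite reprK.
have -> : a' * b' - a * b = 1 *: ((a' - a) * b') + a * (b' - b).
  by rewrite scale1r mulrBl mulrBr addrA subrK.
by apply: fil_linear; [apply: fil_mulr | apply: fil_mull].
Qed.

Fact compl_zeroP k : ctrans (0 : lquo (F k.+1)) = 0.
Proof. exact: ctransE. Qed.
Definition compl_zero : compl := compl_of compl_zeroP.

Fact compl_oneP k : ctrans (\pi_(lquo (F k.+1)) 1) = \pi_(lquo (F k)) 1.
Proof. exact: ctransE. Qed.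
Definition compl_one : compl := compl_of compl_oneP.

Fact compl_addP (x y : compl) k : ctrans (x k.+1 + y k.+1) = x k + y k.
Proof.
have [a [-> ->]] := cpt_rep x k; have [b [-> ->]] := cpt_rep y k.
by rewrite -!lquo_piD ctransE.
Qed.
Definition compl_add (x y : compl) : compl := compl_of (compl_addP x y).

Fact compl_scaleP c (x : compl) k : ctrans (c *: x k.+1) = c *: x k.
Proof. by have [a [-> ->]] := cpt_rep x k; rewrite -!lquo_piZ ctransE. Qed.
Definition compl_scale c (x : compl) : compl := compl_of (compl_scaleP c x).

Fact compl_mulP (x y : compl) k :
  ctrans (\pi_(lquo (F k.+1)) (repr (x k.+1) * repr (y k.+1))) =
  \pi_(lquo (F k)) (repr (x k) * repr (y k)).
Proof.
have [a [-> ->]] := cpt_rep x k; have [b [-> ->]] := cpt_rep y k.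
by rewrite !lquo_mulE ctransE.
Qed.
Definition compl_mul (x y : compl) : compl := compl_of (compl_mulP x y).

Fact compl_addA : associative compl_add.
Proof. by move=> x y z; apply: compl_eq => k; apply: addrA. Qed.
Fact compl_addC : commutative compl_add.
Proof. by move=> x y; apply: compl_eq => k; apply: addrC. Qed.
Fact compl_add0 : left_id compl_zero compl_add.
Proof. by move=> x; apply: compl_eq => k; apply: add0r. Qed.
Fact compl_addN : left_inverse compl_zero (compl_scale (-1)) compl_add.
Proof. by move=> x; apply: compl_eq => k /=; rewrite scaleN1r addNr. Qed.

HB.instance Definition _ :=
  GRing.isZmodule.Build compl compl_addA compl_addC compl_add0 compl_addN.

Fact compl_scaleA a b v : compl_scale a (compl_scale b v) = compl_scale (a * b) v.
Proof. by apply: compl_eq => k; apply: scalerA. Qed.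
Fact compl_scale1 : left_id 1 compl_scale.
Proof. by move=> v; apply: compl_eq => k; apply: scale1r. Qed.
Fact compl_scaleDr : right_distributive compl_scale +%R.
Proof. by move=> c u v; apply: compl_eq => k; apply: scalerDr. Qed.
Fact compl_scaleDl v : {morph compl_scale^~ v : a b / a + b}.
Proof. by move=> a b; apply: compl_eq => k; apply: scalerDl. Qed.

HB.instance Definition _ := GRing.Zmodule_isLmodule.Build rat compl
  compl_scaleA compl_scale1 compl_scaleDr compl_scaleDl.

Lemma cptD (x y : compl) k : (x + y) k = x k + y k. Proof. by []. Qed.
Lemma cptZ c (x : compl) k : (c *: x) k = c *: x k. Proof. by []. Qed.

Lemma compl_mulE (x y : compl) k a b :
  x k = \pi_(lquo (F k)) a -> y k = \pi_(lquo (F k)) b ->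
  compl_mul x y k = \pi_(lquo (F k)) (a * b).
Proof. by move=> xa yb; rewrite /compl_mul /= xa yb lquo_mulE. Qed.

Fact compl_mulA : associative compl_mul.
Proof.
move=> x y z; apply: compl_eq => k.
have [[a [xa _]] [b [yb _]] [c [zc _]]] :=
  And3 (cpt_rep x k) (cpt_rep y k) (cpt_rep z k).
rewrite (compl_mulE xa (compl_mulE yb zc)).
by rewrite (compl_mulE (compl_mulE xa yb) zc) mulrA.
Qed.
Fact compl_mul1 : left_id compl_one compl_mul.
Proof.
move=> x; apply: compl_eq => k; have [a [xa _]] := cpt_rep x k.
by rewrite (compl_mulE (erefl : compl_one k = _) xa) mul1r.
Qed.
Fact compl_mulr1 : right_id compl_one compl_mul.
Proof.
move=> x; apply: compl_eq => k; have [a [xa _]] := cpt_rep x k.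
by rewrite (compl_mulE xa (erefl : compl_one k = _)) mulr1.
Qed.
Fact compl_mulDl : left_distributive compl_mul +%R.
Proof.
move=> x y z; apply: compl_eq => k.
have [[a [xa _]] [b [yb _]] [c [zc _]]] :=
  And3 (cpt_rep x k) (cpt_rep y k) (cpt_rep z k).
have xyab : (x + y) k = \pi_(lquo (F k)) (a + b) by rewrite lquo_piD -xa -yb.
rewrite (compl_mulE xyab zc) cptD (compl_mulE xa zc) (compl_mulE yb zc).
by rewrite -lquo_piD mulrDl.
Qed.
Fact compl_mulDr : right_distributive compl_mul +%R.
Proof.
move=> x y z; apply: compl_eq => k.
have [[a [xa _]] [b [yb _]] [c [zc _]]] :=
  And3 (cpt_rep x k) (cpt_rep y k) (cpt_rep z k).
have yzbc : (y + z) k = \pi_(lquo (F k)) (b + c) by rewrite lquo_piD -yb -zc.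
rewrite (compl_mulE xa yzbc) cptD (compl_mulE xa yb) (compl_mulE xa zc).
by rewrite -lquo_piD mulrDr.
Qed.
Fact compl_oner_neq0 : compl_one != 0.
Proof.
apply/eqP => /(congr1 (fun x : compl => x 1%N)) /(@filP 1 1 0).
by rewrite subr0; apply: fil_proper.
Qed.

HB.instance Definition _ := GRing.Zmodule_isNzRing.Build compl
  compl_mulA compl_mul1 compl_mulr1 compl_mulDl compl_mulDr compl_oner_neq0.

Fact compl_scalerAl c (x y : compl) : c *: (x * y) = (c *: x) * y.
Proof.
apply: compl_eq => k.
have [[a [xa _]] [b [yb _]]] := conj (cpt_rep x k) (cpt_rep y k).
have cxa : (c *: x) k = \pi_(lquo (F k)) (c *: a) by rewrite lquo_piZ -xa.
by rewrite cptZ (compl_mulE xa yb) (compl_mulE cxa yb) -lquo_piZ scalerAl.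
Qed.
Fact compl_scalerAr c (x y : compl) : c *: (x * y) = x * (c *: y).
Proof.
apply: compl_eq => k.
have [[a [xa _]] [b [yb _]]] := conj (cpt_rep x k) (cpt_rep y k).
have cyb : (c *: y) k = \pi_(lquo (F k)) (c *: b) by rewrite lquo_piZ -yb.
by rewrite cptZ (compl_mulE xa yb) (compl_mulE xa cyb) -lquo_piZ scalerAr.
Qed.

HB.instance Definition _ := GRing.Lmodule_isLalgebra.Build rat compl
  compl_scalerAl.
HB.instance Definition _ := GRing.Lalgebra_isAlgebra.Build rat compl
  compl_scalerAr.

Lemma cptM (x y : compl) k a b :
  x k = \pi_(lquo (F k)) a -> y k = \pi_(lquo (F k)) b ->
  (x * y) k = \pi_(lquo (F k)) (a * b).
Proof. exact: compl_mulE. Qed.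

End Completion.

Section CompletionMap.
Variables (A B : algType rat) (F : filtration A) (E : filtration B) (f : A -> B).
Hypothesis fB : forall a b, f (a - b) = f a - f b.
Hypothesis f_fil : forall k a, F k a -> E k (f a).

Lemma complmap_rep k a :
  \pi_(lquo (E k)) (f (repr (\pi_(lquo (F k)) a))) = \pi_(lquo (E k)) (f a).
Proof. by apply/filP; rewrite -fB; apply/f_fil/filP; rewrite reprK. Qed.

Fact complmapP (x : compl F) k :
  ctrans (\pi_(lquo (E k.+1)) (f (repr (x k.+1)))) =
  \pi_(lquo (E k)) (f (repr (x k))).
Proof. by have [a [-> ->]] := cpt_rep x k; rewrite !complmap_rep ctransE. Qed.

Definition complmap (x : compl F) : compl E := compl_of (complmapP x).

Lemma complmapE (x : compl F) k a :
  x k = \pi_(lquo (F k)) a -> complmap x k = \pi_(lquo (E k)) (f a).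
Proof. by move=> xa; rewrite /complmap /= xa complmap_rep. Qed.

Lemma complmap_linear : linear f -> linear complmap.
Proof.
move=> fL c x y; apply: compl_eq => k.
have [[a [xa _]] [b [yb _]]] := conj (cpt_rep x k) (cpt_rep y k).
have xyab : (c *: x + y) k = \pi_(lquo (F k)) (c *: a + b).
  by rewrite lquo_piD lquo_piZ -xa -yb.
rewrite (complmapE xyab) cptD cptZ (complmapE xa) (complmapE yb).
by rewrite fL lquo_piD lquo_piZ.
Qed.

Lemma complmapM : {morph f : a b / a * b} -> {morph complmap : x y / x * y}.
Proof.
move=> fM x y; apply: compl_eq => k.
have [[a [xa _]] [b [yb _]]] := conj (cpt_rep x k) (cpt_rep y k).
by rewrite (complmapE (cptM xa yb)) fM (cptM (complmapE xa) (complmapE yb)).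
Qed.

End CompletionMap.

Section Coproduct.
Variable G : groupType.
Implicit Types (a b c : galg G) (t u : galg (G * G)%type).

Fact augI_linear k (x : rat) a b :
  augI k a -> augI k b -> augI k (x *: a + b).
Proof. by case: (@augI_submod G k) => _; apply. Qed.

Fact augI_proper : ~ augI 1 (1 : galg G).
Proof. by move=> /augI1_aug; rewrite augU => /eqP; rewrite oner_eq0. Qed.

Definition augF : filtration (galg G) :=
  Filtration (fun k => (@augI_submod G k).1) augI_linear (@augI_mull G)
    (@augI_mulr G) (@augI_desc G) augI_proper.

Lemma augI_mul i j a b : augI i a -> augI j b -> augI (i + j) (a * b).
Proof.
move=> Ia; elim: j b => [|j IHj] b; first by rewrite addn0 => _; apply: augI_mulr.
rewrite addnS => Ib; move: Ib => /=.
elim=> [|x u v [b' [c [Ib' c0 ->]]] _ IHv]; first by rewrite mulr0; apply: lspan0.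
rewrite mulrDr -scalerAr; apply: lspan_cons => //.
by exists (a * b'), c; split; rewrite ?mulrA //; apply: IHj.
Qed.

Lemma augI1P a : aug a = 0 -> augI 1 a.
Proof. by move=> a0; apply: lspan_mem; exists 1, a; rewrite mul1r. Qed.

(* $\mathbb Q G \otimes \mathbb Q G$ is realized as the group algebra of G * G, *)
(* with $g \otimes h$ the basis element (g, h) *)
Fact pairl_morph : {morph (fun g : G => (g, 1%g : G)) : x y / (x * y)%g}.
Proof. by move=> x y; congr pair; rewrite mul1g. Qed.
Fact pairr_morph : {morph (fun g : G => (1%g : G, g)) : x y / (x * y)%g}.
Proof. by move=> x y; congr pair; rewrite mul1g. Qed.
Fact diag_morph : {morph (fun g : G => (g, g)) : x y / (x * y)%g}.
Proof. by []. Qed.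

Definition tensl : galg G -> galg (G * G)%type := galgmap (fun g => (g, 1%g : G)).
Definition tensr : galg G -> galg (G * G)%type := galgmap (fun g => (1%g : G, g)).
Definition coprod : galg G -> galg (G * G)%type := galgmap (fun g => (g, g)).

Definition tens a b : galg (G * G)%type := tensl a * tensr b.

Lemma tenslM : {morph tensl : a b / a * b}.
Proof. exact/galgmapM/pairl_morph. Qed.
Lemma tensrM : {morph tensr : a b / a * b}.
Proof. exact/galgmapM/pairr_morph. Qed.

Lemma tensU g h : tens (ginj g) (ginj h) = ginj (g, h).
Proof.
rewrite /tens /tensl /tensr !galgmapU -ginjM; congr (ginj (_, _)).
  exact: mulg1.
exact: mul1g.
Qed.

Lemma tensC a b : tensl a * tensr b = tensr b * tensl a.
Proof.
elim/galg_ind: a => [|k g a IHa]; first by rewrite /tensl galgmap0 mul0r mulr0.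
rewrite /tensl galgmap_linear mulrDl mulrDr IHa; congr (_ + _).
rewrite -scalerAl -scalerAr; congr (_ *: _); clear IHa a.
elim/galg_ind: b => [|l h b IHb]; first by rewrite /tensr galgmap0 mul0r mulr0.
rewrite /tensr galgmap_linear mulrDl mulrDr IHb; congr (_ + _).
rewrite -scalerAl -scalerAr; congr (_ *: _); rewrite !galgmapU -!ginjM.
by congr (ginj (_, _)); rewrite mul1g mulg1.
Qed.

Lemma tensM a b c d : tens a b * tens c d = tens (a * c) (b * d).
Proof.
rewrite /tens tenslM tensrM.
by rewrite -!mulrA; congr (_ * _); rewrite !mulrA -tensC.
Qed.

(* the tensor product filtration $\sum_{i+j=k} I^i \otimes I^j$ *)
Definition tensI (k : nat) : set (galg (G * G)%type) :=
  lspan [set t | exists i j a b,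
    [/\ (i + j)%N = k, augI i a, augI j b & t = tens a b]].

Fact tensI0 k : tensI k 0. Proof. exact: lspan0. Qed.

Fact tensI_linear k (x : rat) t u :
  tensI k t -> tensI k u -> tensI k (x *: t + u).
Proof. by move=> It Iu; apply: lspanD => //; apply: lspanZ. Qed.

Lemma tensI_mul i j t u : tensI i t -> tensI j u -> tensI (i + j) (t * u).
Proof.
move=> + Iu; elim=> [|x t1 t2 [i1 [i2 [a [b [ii Ia Ib ->]]]]] _ IHt].
  by rewrite mul0r; apply: lspan0.
rewrite mulrDl -scalerAl; apply: tensI_linear => // {t2 IHt}.
elim: Iu => [|y u1 u2 [j1 [j2 [c [d [jj Ic Id ->]]]]] _ IHu].
  by rewrite mulr0; apply: lspan0.
rewrite mulrDr -scalerAr; apply: tensI_linear => //; apply: lspan_mem.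
exists (i1 + j1)%N, (i2 + j2)%N, (a * c), (b * d).
by rewrite addnACA ii jj tensM; split=> //; apply: augI_mul.
Qed.

Lemma tensI_full t : tensI 0 t.
Proof.
elim/galg_ind: t => [|k [g h] t IHt]; first exact: lspan0.
apply: lspan_cons => //; exists 0%N, 0%N, (ginj g), (ginj h).
by rewrite tensU.
Qed.

Fact tensI_mull k t u : tensI k u -> tensI k (t * u).
Proof. by move=> Iu; rewrite -[k]add0n; apply: tensI_mul => //; apply: tensI_full. Qed.

Fact tensI_mulr k t u : tensI k t -> tensI k (t * u).
Proof. by move=> It; rewrite -[k]addn0; apply: tensI_mul => //; apply: tensI_full. Qed.

Fact tensI_desc k t : tensI k.+1 t -> tensI k t.
Proof.
apply: lspan_min => [||_ [[|i] [j [a [b [ij Ia Ib ->]]]]]].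
- exact: tensI0.
- exact: tensI_linear.
- apply: lspan_mem; exists 0%N, k, a, b; split=> //.
  by apply: augI_desc; rewrite -ij add0n in Ib *.
- apply: lspan_mem; exists i, j, a, b; split=> //; last exact: augI_desc.
  by case: ij.
Qed.

Fact tensI_proper : ~ tensI 1 (1 : galg (G * G)%type).
Proof.
have: tensI 1 `<=` [set t | aug t = 0].
  apply: lspan_min => [|c u v u0 v0|_ [i [j [a [b [ij Ia Ib ->]]]]]] /=.
  - exact: aug0.
  - by rewrite augD augZ u0 v0 mulr0 addr0.
  - rewrite /tens augM /tensl /tensr !aug_galgmap.
    case: i j ij Ia Ib => [|[|i]] [|[|j]] // _.
      by move=> _ /augI1_aug ->; rewrite mulr0.
    by move=> /augI1_aug -> _; rewrite mul0r.
by move=> H /H /=; rewrite augU => /eqP; rewrite oner_eq0.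
Qed.

Definition tensF : filtration (galg (G * G)%type) :=
  Filtration tensI0 tensI_linear tensI_mull tensI_mulr tensI_desc tensI_proper.

Fact tensl_fil k a : augF k a -> tensF k (tensl a).
Proof.
move=> Ia; apply: lspan_mem; exists k, 0%N, a, 1; split=> //.
  by rewrite addn0.
by rewrite /tens /tensr (galgmap1 pairr_morph) mulr1.
Qed.

Fact tensr_fil k a : augF k a -> tensF k (tensr a).
Proof.
move=> Ia; apply: lspan_mem; exists 0%N, k, 1, a; split=> //.
by rewrite /tens /tensl (galgmap1 pairl_morph) mul1r.
Qed.

Lemma coprod_aug a : tensI 1 (coprod a - aug a *: 1).
Proof.
elim/galg_ind: a => [|k g a IHa].
  by rewrite /coprod galgmap0 aug0 scale0r subr0; apply: tensI0.
rewrite /coprod galgmap_linear augD augZ augU mulr1 scalerDl opprD addrACA.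
rewrite -scalerBr; apply: tensI_linear => //; rewrite galgmapU.
have aug1 (h : G) : augI 1 (ginj h - 1 : galg G).
  by apply: augI1P; rewrite addrC -scaleN1r augD augZ !augU mulr1 addNr.
have -> : ginj (g, g) - 1 = tens (ginj g - 1) (ginj g) + tens 1 (ginj g - 1).
  rewrite /tens /tensl /tensr !galgmapB mulrBl mulrBr.
  rewrite -!/(tensl _) -!/(tensr _) -/(tens (ginj g) (ginj g)) tensU.
  rewrite addrA subrK; congr (_ - _).
  by rewrite /tensl /tensr (galgmap1 pairl_morph) (galgmap1 pairr_morph) mul1r.
apply: lspanD; apply: lspan_mem.
  by exists 1%N, 0%N, (ginj g - 1), (ginj g).
by exists 0%N, 1%N, 1, (ginj g - 1).
Qed.

Fact coprod_fil k a : augF k a -> tensF k (coprod a).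
Proof.
elim: k a => [|k IHk] a; first by move=> _; apply: tensI_full.
move=> /=; elim=> [|x u v [b [c [Ib c0 ->]]] _ IHv].
  by rewrite /coprod galgmap0; apply: tensI0.
rewrite /coprod galgmap_linear; apply: tensI_linear => //.
rewrite (galgmapM diag_morph) -addn1; apply: tensI_mul; first exact: IHk.
by have := coprod_aug c; rewrite c0 scale0r subr0.
Qed.

(* $\widehat{\mathbb Q G}$ and $\widehat{\mathbb Q G \otimes \mathbb Q G}$ *)
Definition cgalg : algType rat := compl augF.
Definition cgalg2 : algType rat := compl tensF.

(* $x \mapsto x \otimes 1$, $x \mapsto 1 \otimes x$ and the comultiplication *)
Definition ctensl : cgalg -> cgalg2 :=
  complmap (@galgmapB _ _ (fun g : G => (g, 1%g : G))) tensl_fil.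
Definition ctensr : cgalg -> cgalg2 :=
  complmap (@galgmapB _ _ (fun g : G => (1%g : G, g))) tensr_fil.
Definition ccoprod : cgalg -> cgalg2 :=
  complmap (@galgmapB _ _ (fun g : G => (g, g))) coprod_fil.

Definition primitive (x : cgalg) : Prop := ccoprod x = ctensl x + ctensr x.

Lemma ctensl_linear : linear ctensl.
Proof. exact/complmap_linear/galgmap_linear. Qed.
Lemma ctensr_linear : linear ctensr.
Proof. exact/complmap_linear/galgmap_linear. Qed.
Lemma ccoprod_linear : linear ccoprod.
Proof. exact/complmap_linear/galgmap_linear. Qed.

Lemma ctenslM : {morph ctensl : x y / x * y}.
Proof. exact/complmapM/galgmapM/pairl_morph. Qed.
Lemma ctensrM : {morph ctensr : x y / x * y}.
Proof. exact/complmapM/galgmapM/pairr_morph. Qed.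
Lemma ccoprodM : {morph ccoprod : x y / x * y}.
Proof. exact/complmapM/galgmapM/diag_morph. Qed.

Lemma ctensC x y : ctensl x * ctensr y = ctensr y * ctensl x.
Proof.
apply: compl_eq => k.
have [[a [xa _]] [b [yb _]]] := conj (cpt_rep x k) (cpt_rep y k).
have xa' := complmapE (@galgmapB _ _ (fun g : G => (g, 1%g : G))) tensl_fil xa.
have yb' := complmapE (@galgmapB _ _ (fun g : G => (1%g : G, g))) tensr_fil yb.
rewrite (cptM xa' yb') (cptM yb' xa').
by have := tensC a b; rewrite /tensl /tensr => ->.
Qed.

Lemma comm_split (R : pzRingType) (p q s u : R) :
  p * u = u * p -> s * q = q * s ->
  (p + q) * (s + u) - (s + u) * (p + q) = (p * s - s * p) + (q * u - u * q).
Proof.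
move=> pu sq; rewrite !mulrDl !mulrDr pu sq.
rewrite [q * s + _]addrC addrACA [u * p + u * q]addrC.
rewrite [s * p + _ + _]addrACA opprD [LHS]addrACA [q * s + u * p]addrC subrr addr0.
by rewrite opprD addrACA.
Qed.

Lemma primitive_linear (c : rat) x y :
  primitive x -> primitive y -> primitive (c *: x + y).
Proof.
rewrite /primitive ctensl_linear ctensr_linear ccoprod_linear => -> ->.
by rewrite scalerDr addrACA.
Qed.

Lemma primitive0 : primitive 0.
Proof.
have lin0 (f : cgalg -> cgalg2) : linear f -> f 0 = 0.
  by move=> fL; have := fL (-1) 0 0; rewrite scaler0 add0r scaleN1r addNr.
rewrite /primitive !lin0 ?addr0 //.
- exact: ctensr_linear.
- exact: ctensl_linear.
- exact: ccoprod_linear.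
Qed.

Lemma primitive_comm x y :
  primitive x -> primitive y -> primitive (x * y - y * x).
Proof.
rewrite /primitive => Px Py.
have sub (f : cgalg -> cgalg2) : linear f -> {morph f : u v / u - v}.
  by move=> fL u v; rewrite addrC -scaleN1r fL scaleN1r addrC.
rewrite (sub _ ccoprod_linear) (sub _ ctensl_linear) (sub _ ctensr_linear).
rewrite !ccoprodM !ctenslM !ctensrM Px Py comm_split //; exact: ctensC.
Qed.

End Coproduct.

HB.mixin Record Lmodule_isLieAlgebra L of GRing.Lmodule rat L := {
  lie : L -> L -> L;
  lie_linearl : forall y, linear (lie^~ y);
  lie_linearr : forall x, linear (lie x);
  liexx : forall x, lie x x = 0;
  lie_jacobi : forall x y z,
    lie x (lie y z) + lie y (lie z x) + lie z (lie x y) = 0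
}.

#[short(type="lieAlgType")]
HB.structure Definition LieAlgebra :=
  {L of GRing.Lmodule rat L & Lmodule_isLieAlgebra L}.

Definition lie_morph (L M : lieAlgType) (f : L -> M) : Prop :=
  linear f /\ {morph f : x y / lie x y}.

Definition filtered_iso (L M : lieAlgType)
    (FL : nat -> set L) (FM : nat -> set M) : Prop :=
  exists f : L -> M,
    [/\ lie_morph f, bijective f & forall k x, FL k x <-> FM k (f x)].

Section LieTheory.
Variable L : lieAlgType.
Implicit Types x y z : L.

Lemma lieDl x y z : lie (x + y) z = lie x z + lie y z.
Proof. by have := lie_linearl z 1 x y; rewrite !scale1r. Qed.
Lemma lieDr x y z : lie x (y + z) = lie x y + lie x z.
Proof. by have := lie_linearr x 1 y z; rewrite !scale1r. Qed.
Lemma lie0l x : lie 0 x = 0.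
Proof. by apply: (addIr (lie 0 x)); rewrite -lieDl !add0r. Qed.
Lemma lie0r x : lie x 0 = 0.
Proof. by apply: (addIr (lie x 0)); rewrite -lieDr !add0r. Qed.
Lemma lieC x y : lie x y = - lie y x.
Proof.
apply/eqP; rewrite -addr_eq0; apply/eqP.
by have := liexx (x + y); rewrite lieDl !lieDr !liexx add0r addr0.
Qed.

Lemma lie_sumr I (r : seq I) (P : pred I) (f : I -> L) y :
  lie y (\sum_(i <- r | P i) f i) = \sum_(i <- r | P i) lie y (f i).
Proof. by apply: (big_morph (lie y)) => [u v|]; [exact: lieDr | exact: lie0r]. Qed.

End LieTheory.

Lemma comm_jacobi (R : pzRingType) (x y z : R) :
  (x * (y * z - z * y) - (y * z - z * y) * x) +
  (y * (z * x - x * z) - (z * x - x * z) * y) +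
  (z * (x * y - y * x) - (x * y - y * x) * z) = 0.
Proof.
rewrite !mulrBr !mulrBl !mulrA !opprB.
rewrite (AC ((2*2)*(2*2)*(2*2)) ((1*12)*(2*7)*(3*10)*(4*5)*(6*11)*(8*9))) /=.
by rewrite !subrr !addNr !addr0.
Qed.

Section Malcev.
Variable G : groupType.

Record malcev := Malcev { malcev_val :> cgalg G; _ : `[< primitive malcev_val >] }.

HB.instance Definition _ := [isSub for malcev_val].
HB.instance Definition _ := [Choice of malcev by <:].

Fact primitive_submod_closed : submod_closed (fun x : cgalg G => `[< primitive x >]).
Proof.
split; first by apply/asboolP; exact: primitive0.
by move=> c x y /asboolP Px /asboolP Py; apply/asboolP/primitive_linear.
Qed.

HB.instance Definition _ :=
  GRing.SubChoice_isSubLmodule.Build rat (cgalg G) _ malcev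
    (GRing.submod_closed_semi primitive_submod_closed).

Lemma malcevP (x : malcev) : primitive (val x).
Proof. by case: x => x /= /asboolP. Qed.

Definition malcev_lie (x y : malcev) : malcev :=
  Malcev (introT (asboolP _) (primitive_comm (malcevP x) (malcevP y))).

Fact malcev_linearl y : linear (malcev_lie^~ y).
Proof.
move=> c u v; apply: val_inj.
change ((c *: val u + val v) * val y - val y * (c *: val u + val v) =
  c *: (val u * val y - val y * val u) + (val v * val y - val y * val v)).
by rewrite mulrDl mulrDr -scalerAl -scalerAr opprD addrACA -scalerBr.
Qed.
Fact malcev_linearr x : linear (malcev_lie x).
Proof.
move=> c u v; apply: val_inj.
change (val x * (c *: val u + val v) - (c *: val u + val v) * val x =
  c *: (val x * val u - val u * val x) + (val x * val v - val v * val x)).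
by rewrite mulrDl mulrDr -scalerAl -scalerAr opprD addrACA -scalerBr.
Qed.
Fact malcev_liexx x : malcev_lie x x = 0.
Proof. by apply: val_inj; rewrite /= subrr. Qed.
Fact malcev_jacobi x y z :
  malcev_lie x (malcev_lie y z) + malcev_lie y (malcev_lie z x) +
  malcev_lie z (malcev_lie x y) = 0.
Proof.
apply: val_inj; have D (u v : malcev) : val (u + v) = val u + val v by [].
rewrite !D; exact: comm_jacobi.
Qed.

HB.instance Definition _ := Lmodule_isLieAlgebra.Build malcev
  malcev_linearl malcev_linearr malcev_liexx malcev_jacobi.

Definition malcev_fil (k : nat) : set malcev := [set x : malcev | cpt (malcev_val x) k = 0].

End Malcev.

Section QuadraticPresentation.
Variable m : nat.

(* A relation of degree 2 between m generators is given by the matrix c of *)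
(* coefficients of $\sum_{i,j} c_{ij} [x_i, x_j] = 0$ *)
Definition lie_satisfies (R : set 'M[rat]_m) (L : lieAlgType) (x : 'I_m -> L) :=
  forall c, R c -> \sum_i \sum_j c i j *: lie (x i) (x j) = 0.

Definition quad_presented (R : set 'M[rat]_m) (L : lieAlgType) (x : 'I_m -> L) :=
  lie_satisfies R x /\
  forall (M : lieAlgType) (y : 'I_m -> M), lie_satisfies R y ->
    exists! f : L -> M, lie_morph f /\ (forall i, f (x i) = y i).

(* the grading of L for which the generators x have degree 1 *)
Inductive lie_deg (L : lieAlgType) (x : 'I_m -> L) : nat -> set L :=
| lie_deg_gen i : lie_deg x 1 (x i)
| lie_deg0 k : lie_deg x k 0
| lie_deg_linear k c u v of
    lie_deg x k u & lie_deg x k v : lie_deg x k (c *: u + v)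
| lie_deg_lie i j u v of
    lie_deg x i u & lie_deg x j v : lie_deg x (i + j) (lie u v).

End QuadraticPresentation.

(* $\prod_k L_k$, where $L_k$ is the degree-k part of L *)
Section DegreeCompletion.
Variables (m : nat) (L : lieAlgType) (x : 'I_m -> L).

Record degcompl := DegCompl {
  degcompl_val :> nat -> L;
  _ : `[< forall k, lie_deg x k (degcompl_val k) >] }.

HB.instance Definition _ := [isSub for degcompl_val].
HB.instance Definition _ := [Choice of degcompl by <:].

Fact degcompl_submod_closed :
  submod_closed (fun u : nat -> L => `[< forall k, lie_deg x k (u k) >]).
Proof.
split; first by apply/asboolP => k; exact: lie_deg0.
move=> c u v /asboolP Pu /asboolP Pv; apply/asboolP => k.
exact: lie_deg_linear.
Qed.

HB.instance Definition _ :=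
  GRing.SubChoice_isSubLmodule.Build rat (nat -> L) _ degcompl
    (GRing.submod_closed_semi degcompl_submod_closed).

Lemma degcomplP (u : degcompl) k : lie_deg x k (u k).
Proof. by case: u => u /= /asboolP. Qed.

Lemma lie_deg_sum k n (f : 'I_n -> L) :
  (forall i, lie_deg x k (f i)) -> lie_deg x k (\sum_i f i).
Proof.
move=> fP; elim/big_ind: _ => // [|u v Pu Pv]; first exact: lie_deg0.
by rewrite -[u]scale1r; apply: lie_deg_linear.
Qed.

Fact degcompl_lieP (u v : degcompl) k :
  lie_deg x k (\sum_(i < k.+1) lie (u i) (v (k - i)%N)).
Proof.
apply: lie_deg_sum => i; rewrite -{1}(subnKC (leq_ord i)).
by apply: lie_deg_lie; apply: degcomplP.
Qed.

Definition degcompl_lie (u v : degcompl) : degcompl :=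
  DegCompl (introT (asboolP _) (degcompl_lieP u v)).

Lemma degcompl_eq (u v : degcompl) : (forall k, u k = v k) -> u = v.
Proof. by move=> uv; apply/val_inj/functional_extensionality_dep. Qed.

Fact degcompl_linearl v : linear (degcompl_lie^~ v).
Proof.
move=> c u w; apply: degcompl_eq => k.
change (\sum_(i < k.+1) lie (c *: u i + w i) (v (k - i)%N) =
  c *: (\sum_(i < k.+1) lie (u i) (v (k - i)%N)) +
  \sum_(i < k.+1) lie (w i) (v (k - i)%N)).
rewrite scaler_sumr -big_split /=; apply: eq_bigr => i _.
exact: lie_linearl.
Qed.
Fact degcompl_linearr v : linear (degcompl_lie v).
Proof.
move=> c u w; apply: degcompl_eq => k.
change (\sum_(i < k.+1) lie (v i) (c *: u (k - i)%N + w (k - i)%N) =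
  c *: (\sum_(i < k.+1) lie (v i) (u (k - i)%N)) +
  \sum_(i < k.+1) lie (v i) (w (k - i)%N)).
rewrite scaler_sumr -big_split /=; apply: eq_bigr => i _.
exact: lie_linearr.
Qed.

Lemma rat_add_self (V : lmodType rat) (v : V) : v = - v -> v = 0.
Proof.
move=> vN; have : (2%:R : rat) *: v = 0.
  by rewrite scaler_nat mulr2n {1}vN addNr.
by move=> /(congr1 (fun w => 2%:R^-1 *: w)); rewrite scalerA scaler0 mulVf // scale1r.
Qed.

Fact degcompl_liexx u : degcompl_lie u u = 0.
Proof.
apply: degcompl_eq => k /=; apply: rat_add_self.
rewrite -sumrN (reindex_inj rev_ord_inj) /=; apply: eq_bigr => i _.
by rewrite lieC subSS subKn // leq_ord.
Qed.

Lemma conv_square (V : zmodType) (g : nat -> nat -> V) n k : (n <= k)%N ->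
  \sum_(j < n.+1) g j (n - j)%N =
  \sum_(j < k.+1) \sum_(l < k.+1 | (j + l)%N == n) g j l.
Proof.
move=> nk; rewrite (big_ord_widen k.+1 (fun j => g j (n - j)%N)) //.
rewrite big_mkcond; apply: eq_bigr => j _; rewrite ltnS; case: leqP => jn.
  have nj : (n - j < k.+1)%N by rewrite ltnS (leq_trans (leq_subr _ _)).
  rewrite (big_pred1 (Ordinal nj)) // => l.
  by rewrite /= -val_eqE /= -(eqn_add2l j l) subnKC.
rewrite big_pred0 // => l; apply/negbTE; rewrite neq_ltn.
by rewrite (leq_trans jn (leq_addr _ _)) orbT.
Qed.

Lemma degcompl_lie_triple u v w k :
  degcompl_lie u (degcompl_lie v w) k =
  \sum_(i < k.+1) \sum_(j < k.+1) \sum_(l < k.+1)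
     if (i + j + l)%N == k then lie (u i) (lie (v j) (w l)) else 0.
Proof.
apply: eq_bigr => i _; rewrite /= lie_sumr.
rewrite (conv_square (fun a b => lie (u i) (lie (v a) (w b))) (leq_subr i k)).
apply: eq_bigr => j _; rewrite -big_mkcond; apply: eq_bigl => l.
by rewrite -(eqn_add2l i) subnKC ?leq_ord // addnA.
Qed.

Lemma sum_rot (V : zmodType) k (g : 'I_k -> 'I_k -> 'I_k -> V) :
  \sum_i \sum_j \sum_l g i j l = \sum_l \sum_i \sum_j g i j l.
Proof. by rewrite [RHS]exchange_big; apply: eq_bigr => i _; apply: exchange_big. Qed.

Fact degcompl_jacobi u v w :
  degcompl_lie u (degcompl_lie v w) + degcompl_lie v (degcompl_lie w u) +
  degcompl_lie w (degcompl_lie u v) = 0.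
Proof.
apply: degcompl_eq => k.
have D (a b : degcompl) : (a + b) k = a k + b k by [].
rewrite !D !degcompl_lie_triple [X in _ + X + _]sum_rot [X in _ + _ + X]sum_rot.
rewrite [X in _ + _ + X]sum_rot -!big_split big1 // => i _ /=.
rewrite -!big_split big1 // => j _ /=; rewrite -!big_split big1 // => l _ /=.
rewrite [(j + l + i)%N]addnC addnA [(l + i + j)%N]addnC addnA [(j + l + i)%N]addnC.
rewrite addnA; case: eqP => _; last by rewrite !addr0.
exact: lie_jacobi.
Qed.

HB.instance Definition _ := Lmodule_isLieAlgebra.Build degcompl
  degcompl_linearl degcompl_linearr degcompl_liexx degcompl_jacobi.

Definition degcompl_fil (k : nat) : set degcompl :=
  [set u : degcompl | forall i, (i < k)%N -> u i = 0].

End DegreeCompletion.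

Definition one_formal (G : groupType) : Prop :=
  exists (m : nat) (R : set 'M[rat]_m) (L : lieAlgType) (x : 'I_m -> L),
    quad_presented R x /\
    filtered_iso (@malcev_fil G) (@degcompl_fil m L x).

(* A formal power series is identified with its sequence of coefficients. For
   q with constant coefficient 1, [series_div p q] is p / q (see [series_divP]),
   computed as the geometric series $p \sum_j (1 - q)^j$; only the terms j <= k
   contribute to the coefficient at k. *)
Definition series_div (p q : {poly rat}) (k : nat) : rat :=
  (p * \sum_(j < k.+1) (1 - q) ^+ j)`_k.

Lemma series_div_trunc (p q : {poly rat}) k N : q`_0 = 1 -> (k < N)%N ->
  series_div p q k = (p * \sum_(j < N) (1 - q) ^+ j)`_k.
Proof.
move=> q0; have /factor_theorem [r r1] : root (1 - q) 0.
  by rewrite /root horner_coef0 coefB coef1 q0 subrr.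
rewrite subr0 in r1.
have small j i : (i < j)%N -> (p * (1 - q) ^+ j)`_i = 0.
  by move=> ij; rewrite r1 exprMn mulrA coefMXn ij.
elim: N => // N IHN; rewrite ltnS leq_eqVlt => /predU1P[->//|kN].
by rewrite big_ord_recr /= mulrDr coefD small // addr0 IHN.
Qed.

Lemma series_divP (p q : {poly rat}) : q`_0 = 1 ->
  forall k, \sum_(i < k.+1) q`_i * series_div p q (k - i) = p`_k.
Proof.
move=> q0 k; transitivity ((q * (p * \sum_(j < k.+1) (1 - q) ^+ j))`_k).
  rewrite coefM; apply: eq_bigr => i _; congr (_ * _).
  by apply: series_div_trunc => //; rewrite ltnS leq_subr.
have /factor_theorem [r r1] : root (1 - q) 0.
  by rewrite /root horner_coef0 coefB coef1 q0 subrr.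
rewrite subr0 in r1.
have qS : q * \sum_(j < k.+1) (1 - q) ^+ j = 1 - (1 - q) ^+ k.+1.
  by rewrite -[RHS]opprB subrX1 addrAC subrr add0r mulNr opprK.
rewrite mulrCA qS mulrBr mulr1 coefB r1 exprMn mulrA coefMXn ltnSn subr0.
by [].
Qed.

(* [Vector.axiom d U] states that U is linearly isomorphic to 'rV_d, so the
   V k are in particular required to be finite dimensional *)
Definition is_hilbert (V : nat -> lmodType rat) (h : nat -> rat) : Prop :=
  forall k, exists d : nat, inhabited (Vector.axiom d (V k)) /\ h k = d%:R.

(* Main.v *)
(* Let H = G/G''. As H is metabelian, gr_(k+2) H is spanned by the left-normed
   commutators [y_i, y_j, y_w], where the y_i span gr_1 H, and these depend only
   on the monomial of w. Over S = Q[X_1, .., X_m] they are thus indexed by the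
   elements q (X_i e_j - X_j e_i) of the second module of Koszul cycles, and the
   homotopy theta, built from Euler's formula, gives a surjection from the
   cycles of degree k + 1 in S^m (kernel of (w_j) |-> sum_j X_j w_j) onto
   gr_(k+2) H. A map back is obtained from Fox derivatives: the representation
   x_i |-> exp(lambda_i) of F in commutative power series and its crossed
   homomorphism d send [y_i, y_j, y_w] to a nonzero multiple of the cycle, modulo
   the multiples of the leading form omega of d r. Hence gr_(k+2) H is the space
   of cycles modulo S_k omega, which is counted by binomial coefficients.

   If r is not in [F,F], d can be chosen with d r = 0, and m = n - 1. If r is in
   [F,F], then m = n, omega is the class of r in gr_2 F, and one needs omega <> 0:
   this is where 1-formality enters. Suppose omega = 0 and let rho <> 0 be the
   leading form of the Magnus expansion of r, of degree k + 1 >= 3. It is a Lie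
   polynomial. As the expansion of r is trivial in degrees below 3, the degree 1
   parts of the generators of m(G) satisfy, in the free Lie algebra, the relations
   of a quadratic presentation; so the presented Lie algebra L maps to it, the
   degree 1 part of log x_i going to the letter X_i. Evaluating the Magnus
   expansion of r = 1 at the x_i - 1 in QG shows that rho(log x_i) has filtration
   k + 2 in m(G), so rho vanishes in L and hence in the free Lie algebra. *)
From HB Require Import structures.
Require Import Defs.
From mathcomp Require Import all_boot all_order all_algebra.
From mathcomp Require Import generic_quotient boolp classical_sets functions.
From mathcomp Require Import freeg mpoly ring.

Set Implicit Arguments.
Unset Strict Implicit.
Unset Printing Implicit Defensive.

Import GRing.Theory.

Local Open Scope quotient_scope.
Local Open Scope classical_set_scope.
Local Open Scope ring_scope.

(** * Lower central series and its graded quotients *)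

(** The kernel of theta on cycles is found without choosing a basis of gr_(k+2) H: the map back
    composed with theta is a nonzero multiple of the quotient map. The map back is well defined
    because on the kernel of F -> H the crossed homomorphism takes values p (d r). The multiplier p
    must have the right order for the leading form to be a multiple of omega. When omega <> 0 this
    holds because polynomials form a domain; if omega = 0 but d r <> 0, the leading forms of p (d r)
    would escape control. Hence the alternative on which the common part of the proof rests: omega
    <> 0 or d r = 0. Two expansions of F coexist because each shows one property: x_i |-> 1 + X_i is
    visibly faithful on reduced words, while x_i |-> exp X_i has Lie leading forms, by its
    logarithmic derivative. Log x_i is shown primitive through additivity of the logarithm on
    commuting arguments, where log (1 + a) is read off as the coefficient of m in (1 + a)^m. *)

Section LowerCentralSeries.
Local Open Scope group_scope.
Variable H : groupType.
Implicit Types (S : set H) (g h : H) (k : nat).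

Lemma gen_min S (P : set H) :
  P 1 -> (forall g h, P g -> P h -> P (g * h^-1)) -> S `<=` P -> gen S `<=` P.
Proof. by move=> P1 PD SP g; elim=> [h /SP||h1 h2 _ Ph1 _ Ph2] //; exact: PD. Qed.

Lemma lcsSS k : lcs H k.+2 = comm_sub (lcs H k.+1) [set: H].
Proof. by []. Qed.

Lemma lcs_one k : lcs H k 1.
Proof. by case: k => [|[|k]] //; apply: gen_one. Qed.

Lemma lcs_div k g h : lcs H k g -> lcs H k h -> lcs H k (g * h^-1).
Proof. by case: k => [|[|k]] //; apply: gen_div. Qed.

Lemma lcsV k g : lcs H k g -> lcs H k g^-1.
Proof. by move=> kg; rewrite -[g^-1]mul1g; apply: lcs_div => //; exact: lcs_one. Qed.

Lemma lcsM k g h : lcs H k g -> lcs H k h -> lcs H k (g * h).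
Proof. by move=> kg kh; rewrite -[h]invgK; apply/lcs_div/lcsV. Qed.

Lemma lcsJ k g h : lcs H k g -> lcs H k (g ^ h).
Proof.
elim: k g h => [|[|k] IHk] g h //; rewrite lcsSS.
elim=> [_ [a ka [b _ <-]]||u v _ Pu _ Pv].
- apply: gen_mem; exists (a ^ h); first exact: IHk.
  by exists (b ^ h) => //; rewrite -conjRg.
- by rewrite conj1g; exact: gen_one.
- by rewrite conjMg conjVg; apply: gen_div.
Qed.

Lemma lcs_comm k g h : lcs H k g -> lcs H k.+1 [~ g, h].
Proof. by case: k => [|k] // kg; apply: gen_mem; exists g => //; exists h. Qed.

Lemma lcs_desc k g : lcs H k.+1 g -> lcs H k g.
Proof.
case: k => [|k] //; rewrite lcsSS.
elim=> [_ [a ka [b _ <-]]||u v _ Pu _ Pv]; last 2 first.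
- exact: lcs_one.
- exact: lcs_div.
by rewrite commgEl; apply: lcsM; [apply: lcsV | apply: lcsJ].
Qed.

Lemma lcs_le i j g : (i <= j)%N -> lcs H j g -> lcs H i g.
Proof.
by move/subnK <-; elim: (j - i)%N => // d IHd; rewrite addSn => /lcs_desc.
Qed.

Lemma der1_comm g h : der1 H [~ g, h].
Proof. exact: (@lcs_comm 1). Qed.

End LowerCentralSeries.

Section Morphisms.
Local Open Scope group_scope.
Variables (H K : groupType) (f : H -> K).
Hypothesis fM : {morph f : g h / g * h}.

Lemma morph1g : f 1 = 1.
Proof. by apply: (mulgI (f 1)); rewrite -fM !mulg1. Qed.

Lemma morphVg g : f g^-1 = (f g)^-1.
Proof. by apply: (mulgI (f g)); rewrite -fM !mulgV morph1g. Qed.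

Lemma morphRg g h : f [~ g, h] = [~ f g, f h].
Proof. by rewrite /commg /conjg !fM !morphVg. Qed.

Lemma gen_morph (S : set H) (T : set K) :
  (forall g, S g -> T (f g)) -> forall g, gen S g -> gen T (f g).
Proof.
move=> ST g; elim=> [h /ST|| a b _ Ta _ Tb]; first exact: gen_mem.
  by rewrite morph1g; apply: gen_one.
by rewrite fM morphVg; apply: gen_div.
Qed.

Lemma lcs_morph k g : lcs H k g -> lcs K k (f g).
Proof.
elim: k g => [|[|k] IHk] g //; rewrite !lcsSS.
apply: gen_morph => _ [a ka [b _ <-]].
by exists (f a); [exact: IHk | exists (f b) => //; rewrite morphRg].
Qed.

Hypothesis f_surj : forall u, exists g, f g = u.

Lemma gen_surj (S : set H) (T : set K) :
  (forall u, T u -> exists g, S g /\ f g = u) ->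
  forall u, gen T u -> exists g, gen S g /\ f g = u.
Proof.
move=> ST u; elim=> [v /ST[g [Sg <-]]||a b _ [g [Sg <-]] _ [h [Sh <-]]].
- by exists g; split=> //; exact: gen_mem.
- by exists 1; split; [exact: gen_one | exact: morph1g].
- by exists (g * h^-1); split; [exact: gen_div | rewrite fM morphVg].
Qed.

Lemma lcs_surj k u : lcs K k u -> exists g, lcs H k g /\ f g = u.
Proof.
elim: k u => [|[|k] IHk] u.
- by have [g <-] := f_surj u; exists g.
- by have [g <-] := f_surj u; exists g.
rewrite !lcsSS; apply: gen_surj => _ [a /IHk[g [kg <-]] [b _ <-]].
have [h <-] := f_surj b; exists [~ g, h]; split; last exact: morphRg.
by exists g => //; exists h.
Qed.

Lemma der2_surj u : der2 K u -> exists g, der2 H g /\ f g = u.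
Proof.
apply: gen_surj => _ [a /(@lcs_surj 2)[g [kg <-]] [b /(@lcs_surj 2)[h [kh <-]] <-]].
by exists [~ g, h]; split; [exists g => //; exists h | exact: morphRg].
Qed.

End Morphisms.

Section QuotientMorphism.
Local Open Scope group_scope.
Variables (H : groupType) (S : set H).

Lemma quo_morph : {morph (fun g => \pi_(quo S) g) : g h / g * h}.
Proof. by move=> g h; rewrite [RHS]quo_mulE. Qed.

Lemma quo_surj (u : quo S) : exists g, \pi_(quo S) g = u.
Proof. by exists (repr u); rewrite reprK. Qed.

Lemma quo_ker g : \pi_(quo S) g = 1 <-> normal_closure S g.
Proof.
split=> [/esym /eqP/quoP|Sg]; first by rewrite invg1 mul1g.
by apply/esym/eqP/quoP; rewrite invg1 mul1g.
Qed.

Lemma normal_closure_min (P : set H) :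
  P 1 -> (forall g h, P g -> P h -> P (g * h^-1)) ->
  (forall g h, P g -> P (g ^ h)) -> S `<=` P -> normal_closure S `<=` P.
Proof.
by move=> P1 PD PJ SP; apply: gen_min => // _ [s /SP Ps [g _ <-]]; exact: PJ.
Qed.

Lemma normal_closure_mem g : S g -> normal_closure S g.
Proof. by move=> Sg; apply: gen_mem; exists g => //; exists 1; rewrite ?conjg1. Qed.

End QuotientMorphism.

Lemma linear_pack (U V : lmodType rat) (f : U -> V) :
  linear f -> exists g : {linear U -> V}, g =1 f.
Proof.
move=> fL.
pose g : {linear U -> V} := HB.pack f (GRing.isLinear.Build rat U V *:%R f fL).
by exists g.
Qed.

Lemma lquo_lift (V M : lmodType rat) (S : set V) (f : {linear V -> M}) :
  (forall v, S v -> f v = 0) ->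
  exists g : {linear lquo S -> M}, forall v, g (\pi_(lquo S) v) = f v.
Proof.
move=> fS; have fS' v : lspan S v -> f v = 0.
  move: v; apply: lspan_min => [|c u v fu fv|//]; first exact: linear0.
  by rewrite linearP fu fv scaler0 addr0.
have fE v : f (repr (\pi_(lquo S) v)) = f v.
  by apply/eqP; rewrite -subr_eq0 -linearB fS' //; exact: lquo_repr.
have [g gE] : exists g : {linear lquo S -> M}, g =1 fun u => f (repr u).
  apply: linear_pack => c; elim/quotW=> u; elim/quotW=> v.
  by rewrite -lquo_piZ -lquo_piD !fE linearP.
by exists g => v; rewrite gE fE.
Qed.

Lemma lquo_pi0 (V : lmodType rat) (S : set V) v :
  \pi_(lquo S) v = 0 <-> lspan S v.
Proof.
split=> [/eqP/lquoP|Sv]; first by rewrite subr0.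
by apply/eqP/lquoP; rewrite subr0.
Qed.

Section TensorClass.
Variable A : groupType.

Definition tcl (a : A) : tensQ A := \pi << a >>.

Lemma tclM a b : tcl (a * b)%g = tcl a + tcl b.
Proof.
rewrite /tcl -lquo_piD; apply/eqP/lquoP/lspan_mem; exists a, b.
by rewrite opprD addrA.
Qed.

Lemma tens_ind (P : tensQ A -> Prop) :
  P 0 -> (forall c a v, P v -> P (c *: tcl a + v)) -> forall v, P v.
Proof.
move=> P0 PD; elim/quotW; elim/fg_ind => [//|c a D PDD].
by rewrite lquo_piD lquo_piZ; exact: PD.
Qed.

Lemma tens_lift (M : lmodType rat) (f : A -> M) :
  (forall a b, f (a * b)%g = f a + f b) ->
  exists g : {linear tensQ A -> M}, forall a, g (tcl a) = f a.
Proof.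
move=> fD; have [h hE] := linear_pack (fglift_linear f).
have [|g gE] := @lquo_lift _ _
  [set D : {freeg A / rat} |
        exists a b : A, D = (<< (a * b)%g >> - << a >> - << b >>)%R] h.
  by move=> _ [a [b ->]]; rewrite !linearB /= !hE !fglift1 fD addrAC addrK subrr.
by exists g => a; rewrite gE hE fglift1.
Qed.

End TensorClass.

Section GradedClass.
Variables (H : groupType) (k : nat).
Local Notation Hk := (lcs H k).
Local Notation N := [set x : subgrp Hk | lcs H k.+1 (val x)].

Lemma gen_lcs g : gen Hk g -> Hk g.
Proof. by apply: gen_min => //; [exact: lcs_one | exact: lcs_div]. Qed.

(* The class of g in gr_k H; junk value 0 outside the k-th term of the series. *)
Definition gcl (g : H) : gr H k :=
  if pselect (Hk g) is left kg
  then tcl (\pi_(quo N) (SubGrp (introT (asboolP _) (gen_mem kg)))) else 0.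

Lemma normal_closure_lcs x : normal_closure N x -> lcs H k.+1 (val x).
Proof.
move: x; apply: (@normal_closure_min _ N (fun x => lcs H k.+1 (val x))) => //.
- exact: lcs_one.
- by move=> g h kg kh; exact: lcs_div.
- by move=> g h kg; exact: lcsJ.
Qed.

Lemma gclE (x : subgrp Hk) : gcl (val x) = tcl (\pi_(quo N) x).
Proof.
rewrite /gcl; case: pselect => [kx|[]]; last first.
  by apply/gen_lcs; case: x => x /= /asboolP.
by congr tcl; congr (\pi_(quo N) _); exact: val_inj.
Qed.

Lemma gcl_sub g : Hk g -> exists x : subgrp Hk, val x = g.
Proof. by move=> kg; exists (SubGrp (introT (asboolP _) (gen_mem kg))). Qed.

Lemma gclM g h : Hk g -> Hk h -> gcl (g * h)%g = gcl g + gcl h.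
Proof.
move=> /gcl_sub[x <-] /gcl_sub[y <-].
by rewrite -[(_ * _)%g]/(val (x * y)%g) !gclE quo_morph tclM.
Qed.

Lemma gcl_ind (P : gr H k -> Prop) :
  P 0 -> (forall c g v, Hk g -> P v -> P (c *: gcl g + v)) -> forall v, P v.
Proof.
move=> P0 PD; elim/tens_ind => // c a v; elim/quotW: a => x Pv.
by rewrite -gclE; apply: PD => //; apply: gen_lcs; case: x => x /= /asboolP.
Qed.

(** Universal property of gr_k H. Taking f on all of H keeps the types [subgrp] and [quo] out of the
    later constructions. *)
Lemma gcl_lift (M : lmodType rat) (f : H -> M) :
  (forall g h, Hk g -> Hk h -> f (g * h)%g = f g + f h) ->
  (forall g, lcs H k.+1 g -> f g = 0) ->
  exists F : {linear gr H k -> M}, forall g, Hk g -> F (gcl g) = f g.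
Proof.
move=> fD f0; have kP (x : subgrp Hk) : Hk (val x).
  by apply: gen_lcs; case: x => x /= /asboolP.
have fE (x : subgrp Hk) : f (val (repr (\pi_(quo N) x))) = f (val x).
  set y := repr _; have /eqP/quoP/normal_closure_lcs Nxy :
    \pi_(quo N) y = \pi_(quo N) x by rewrite reprK.
  have -> : val x = (val y * val (y^-1 * x))%g by rewrite -{1}(mulVKg y x).
  rewrite fD ?(f0 _ Nxy) ?addr0 //.
have [|F FE] := @tens_lift (quo N) M (fun u => f (val (repr u))).
  elim/quotW=> x; elim/quotW=> y.
  by rewrite -quo_morph !fE -fD.
by exists F => g /gcl_sub[x <-]; rewrite gclE FE fE.
Qed.

Lemma gcl0 g : lcs H k.+1 g -> gcl g = 0.
Proof.
move=> kg; have [x xg] := gcl_sub (lcs_desc kg).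
rewrite -xg gclE; have -> : \pi_(quo N) x = 1%g.
  by apply/quo_ker/normal_closure_mem; rewrite /= xg.
by apply: (addrI (tcl 1%g)); rewrite -tclM mulg1 addr0.
Qed.

Lemma gcl_one : gcl 1 = 0.
Proof. by apply: gcl0; exact: lcs_one. Qed.

Lemma gclV g : Hk g -> gcl g^-1 = - gcl g.
Proof.
move=> kg; apply/eqP; rewrite -addr_eq0 -gclM ?mulVg ?gcl_one //.
exact: lcsV.
Qed.

End GradedClass.

Lemma lspan_map (U V : lmodType rat) (f : {linear U -> V}) (S : set U) (T : set V) :
  (forall u, S u -> lspan T (f u)) -> forall u, lspan S u -> lspan T (f u).
Proof.
move=> ST; apply: (@lspan_min U S (fun u => lspan T (f u))) => //.
  by rewrite linear0; apply: lspan0.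
by move=> c u v Tu Tv; rewrite linearP; apply/lspanD/Tv/lspanZ.
Qed.

Lemma lspan_mono (U : lmodType rat) (S T : set U) :
  S `<=` lspan T -> lspan S `<=` lspan T.
Proof. by move=> ST u; apply: (@lspan_map _ _ idfun). Qed.

Section GradedCommutator.
Variable H : groupType.
Implicit Types (g h a b : H) (k : nat).

Lemma gclJ k g h : lcs H k g -> gcl k (g ^ h)%g = gcl k g.
Proof.
move=> kg; have -> : (g ^ h = g * [~ g, h])%g by rewrite commgEl mulVKg.
rewrite gclM //; last exact/lcs_desc/lcs_comm.
by rewrite [X in _ + X]gcl0 ?addr0 //; exact: lcs_comm.
Qed.

Lemma gcl_commMl k g h b : lcs H k g -> lcs H k h ->
  gcl k.+1 [~ g * h, b] = gcl k.+1 [~ g, b] + gcl k.+1 [~ h, b].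
Proof.
move=> kg kh; have -> : ([~ g * h, b] = [~ g, b] ^ h * [~ h, b])%g.
  by rewrite /commg /conjg !gnorm.
rewrite gclM ?gclJ //; [exact: lcs_comm | exact/lcsJ/lcs_comm | exact: lcs_comm].
Qed.

Lemma gcl_commMr k g a b : lcs H k g ->
  gcl k.+1 [~ g, a * b] = gcl k.+1 [~ g, a] + gcl k.+1 [~ g, b].
Proof.
move=> kg; have -> : ([~ g, a * b] = [~ g, b] * [~ g, a] ^ b)%g.
  by rewrite /commg /conjg !gnorm.
rewrite gclM ?gclJ 1?addrC //; [exact: lcs_comm | exact: lcs_comm |].
exact/lcsJ/lcs_comm.
Qed.

Lemma ad_left k b : exists F : {linear gr H k -> gr H k.+1},
  forall g, lcs H k g -> F (gcl k g) = gcl k.+1 [~ g, b].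
Proof.
apply: gcl_lift => [g h kg kh|g kg]; first exact: gcl_commMl.
exact/gcl0/lcs_comm.
Qed.

Lemma hom_gen_comm (M : lmodType rat) (f : H -> M) :
  (forall g h, f (g * h)%g = f g + f h) -> forall g, lcs H 2 g -> f g = 0.
Proof.
move=> fD; have f1 : f 1%g = 0 by apply: (addrI (f 1%g)); rewrite -fD mulg1 addr0.
have fV g : f g^-1%g = - f g by apply/eqP; rewrite -addr_eq0 -fD mulVg f1.
apply: gen_min => // [g h fg fh|_ [a _ [b _ <-]]].
  by rewrite fD fV fg fh subrr.
by rewrite /commg /conjg !fD !fV [f a + f b]addrC addKr addNr.
Qed.

Lemma ad_right k g : lcs H k g -> exists F : {linear gr H 1 -> gr H k.+1},
  forall b, F (gcl 1 b) = gcl k.+1 [~ g, b].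
Proof.
move=> kg; have gD a b := gcl_commMr a b kg.
have [F FE] := @gcl_lift H 1 _ (fun b => gcl k.+1 [~ g, b]%g) (fun a b _ _ => gD a b)
  (hom_gen_comm gD).
by exists F => b; apply: FE.
Qed.

(** Iterated brackets with a fixed word are linear, so relations in low degree propagate. The target
    degree is a variable tied by an equation, which avoids transports in the type [gr H k]. *)
Lemma ad_word (m : nat) (y : 'I_m -> H) (w : seq 'I_m) k0 k : k = (k0 + size w)%N ->
  exists F : {linear gr H k0 -> gr H k}, forall g, lcs H k0 g ->
    F (gcl k0 g) = gcl k (foldl (fun g l => [~ g, y l]%g) g w).
Proof.
elim: w k0 => [|a w IHw] k0 /=; first by rewrite addn0 => ->; exists idfun.
rewrite addnS -addSn => /IHw[F FE]; have [A AE] := ad_left k0 (y a).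
exists (F \o A) => g kg /=; rewrite AE // FE //; exact: lcs_comm.
Qed.

Lemma Hall_Witt x y z :
  ([~ [~ x, y^-1], z] ^ y * [~ [~ y, z^-1], x] ^ z * [~ [~ z, x^-1], y] ^ x = 1 :> H)%g.
Proof. by rewrite /commg /conjg !gnorm. Qed.

(** The Hall-Witt identity read in gr_3, where conjugations become invisible. *)
Lemma gcl_jacobi x y z :
  gcl 3 [~ [~ x, y], z]%g + gcl 3 [~ [~ y, z], x]%g + gcl 3 [~ [~ z, x], y]%g
    = 0 :> gr H 3.
Proof.
have l2 a b : lcs H 2 [~ a, b]%g by exact: (@lcs_comm _ 1).
have l3 a b c : lcs H 3 [~ [~ a, b], c]%g by exact: lcs_comm.
(* Inverting b changes the sign of the class, since [a, b^-1 b] = 1 and the bracket is additive in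
   b. *)
have sgn a b c : gcl 3 ([~ [~ a, b^-1], c] ^ b)%g = - gcl 3 [~ [~ a, b], c]%g.
  rewrite gclJ //; have [F FE] := ad_left 2 c.
  rewrite -!FE // -linearN; congr (F _); apply/eqP; rewrite -addr_eq0.
  have <- := @gcl_commMr 1 a b^-1%g b I.
  by rewrite mulVg commg1 gcl_one.
have /(congr1 (@gcl H 3)) := Hall_Witt x y z.
rewrite gcl_one gclM; [|by apply: lcsM; exact/lcsJ/l3|exact/lcsJ/l3].
rewrite gclM; [|exact/lcsJ/l3|exact/lcsJ/l3].
by rewrite !sgn -!opprD => /eqP; rewrite oppr_eq0 => /eqP.
Qed.

Lemma gcl_comm_alt k (a b : H) : k = 2 -> gcl k [~ a, b] = - gcl k [~ b, a].
Proof. by move=> ->; rewrite -invgR gclV //; exact: (@lcs_comm _ 1). Qed.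

End GradedCommutator.

(** * Left-normed commutators span the graded quotients *)

Section Spanning.
Variables (H : groupType) (m : nat) (y : 'I_m -> H).

Definition lcom (i j : 'I_m) (w : seq 'I_m) : H :=
  foldl (fun g l => [~ g, y l]%g) [~ y i, y j]%g w.

Lemma lcs_foldl k g w : lcs H k g ->
  lcs H (k + size w) (foldl (fun g l => [~ g, y l]%g) g w).
Proof.
elim: w k g => [|a w IHw] k g kg /=; first by rewrite addn0.
by rewrite addnS -addSn; apply/IHw/lcs_comm.
Qed.

Lemma lcom_lcs i j w : lcs H (size w).+2 (lcom i j w).
Proof. by apply: (@lcs_foldl 2); exact: (@lcs_comm _ 1). Qed.

Lemma gcl_gen k (S : set H) (P : gr H k -> Prop) :
  lcs H k = gen S -> P 0 -> (forall c u v, P u -> P v -> P (c *: u + v)) ->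
  (forall s, S s -> P (gcl k s)) -> forall v, P v.
Proof.
move=> kS P0 PD PS; elim/gcl_ind => // c g v kg Pv; apply: (PD) => //.
suff : lcs H k g /\ P (gcl k g) by case.
move: kg; rewrite {1}kS; elim=> [s Ss||a b _ [ka Pa] _ [kb Pb]].
- by split; [rewrite kS; exact: gen_mem | exact: PS].
- by rewrite gcl_one; split => //; exact: lcs_one.
- split; first exact: lcs_div.
  rewrite gclM ?gclV //; last exact: lcsV.
  by rewrite addrC -scaleN1r; exact: PD.
Qed.

Hypothesis y_span : forall v : gr H 1, lspan [set gcl 1 (y i) | i in [set: 'I_m]] v.

(** The class of [a, b] is linear in the class of a and in that of b, so each can be replaced in
    turn by members of a spanning family. *)
Lemma span_step k (S : set H) : S `<=` lcs H k.+1 ->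
  (forall v : gr H k.+1, lspan [set gcl k.+1 s | s in S] v) ->
  forall v : gr H k.+2, lspan [set gcl k.+2 [~ s, y l]%g | s in S & l in [set: 'I_m]] v.
Proof.
move=> Sk Sspan; apply: (gcl_gen (lcsSS H k)).
- exact: lspan0.
- by move=> c u v Pu Pv; apply/lspanD/Pv/lspanZ.
move=> _ [a ka [b _ <-]].
have [A AE] := ad_left k.+1 b; rewrite -AE //.
apply: lspan_map (Sspan (gcl _ a)) => _ [s Ss <-]; rewrite AE; last exact: Sk.
have [B BE] := ad_right (Sk _ Ss); rewrite -BE.
apply: lspan_map (y_span (gcl _ b)) => _ [l _ <-]; rewrite BE.
by apply: lspan_mem; exists s => //; exists l.
Qed.

Lemma gr_span k (v : gr H k.+2) :
  lspan [set gcl k.+2 (lcom ij.1 ij.2 w) | ij in [set: 'I_m * 'I_m] &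
                                          w in [set w | size w = k]] v.
Proof.
elim: k v => [|k IHk] v.
  apply: lspan_mono (@span_step 0 [set y i | i in [set: 'I_m]] _ _ v) => //.
    move=> _ [_ [i _ <-] [l _ <-]]; apply: lspan_mem.
    by exists (i, l) => //; exists [::].
  move=> u; apply: lspan_mono (y_span u) => _ [i _ <-]; apply: lspan_mem.
  by exists (y i) => //; exists i.
apply: lspan_mono (@span_step k.+1 [set lcom ij.1 ij.2 w |
  ij in [set: 'I_m * 'I_m] & w in [set w | size w = k]] _ _ v).
- move=> _ [_ [ij _ [w /= wk <-]] [l _ <-]]; apply: lspan_mem.
  exists ij => //; exists (rcons w l); first by rewrite /= size_rcons wk.
  by rewrite /lcom foldl_rcons.
- by move=> _ [ij _ [w /= <- <-]]; exact: lcom_lcs.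
- move=> u; apply: lspan_mono (IHk u) => _ [ij _ [w wk <-]]; apply: lspan_mem.
  by exists (lcom ij.1 ij.2 w) => //; exists ij => //; exists w.
Qed.

End Spanning.

(** * Commutator identities in metabelian groups *)

Section Metabelian.
Variables (H : groupType) (m : nat) (y : 'I_m -> H).
Hypothesis H_metab : forall a b : H, der1 H a -> der1 H b -> commute a b.

(** H' is abelian, so conjugation makes it a module over the abelian group H/H'; c |-> [c, a] and c
    |-> [c, b] are the commuting operators a - 1 and b - 1. *)
Lemma metab_comm (c a b : H) : der1 H c -> [~ [~ c, a], b]%g = [~ [~ c, b], a]%g.
Proof.
move=> c1; have cJ h : der1 H (c ^ h)%g by exact: (@lcsJ _ 2).
have cV h : der1 H (c ^ h)^-1%g by apply: (@lcsV _ 2); exact: cJ.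
have cab : (c ^ (a * b) = c ^ (b * a))%g.
  rewrite (commgC a b) conjgM; set d := (c ^ _)%g.
  by rewrite conjgE (H_metab (cJ _) (der1_comm a b)) mulKg.
have cB : der1 H (c * (c ^ b)^-1)%g by apply: (@lcsM _ 2) => //; exact: cV.
rewrite !commgEl (invgM c^-1%g (c ^ a)%g) (invgM c^-1%g (c ^ b)%g) invgK.
rewrite (conjMg c^-1%g (c ^ a)%g b) (conjMg c^-1%g (c ^ b)%g a) !conjVg -!conjgM.
rewrite cab; move: (c ^ _)%g (c ^ a)%g (c ^ b)%g (H_metab (cV a) cB) (H_metab (cV b) c1).
move=> D A B AcB Bc; rewrite !mulgA; congr (_ * _)%g.
by rewrite -!mulgA AcB mulgA -Bc.
Qed.

Lemma foldl_comm_swap (c : H) w1 l w2 : der1 H c ->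
  foldl (fun g l => [~ g, y l]%g) c (w1 ++ l :: w2) =
  foldl (fun g l => [~ g, y l]%g) c (l :: w1 ++ w2).
Proof.
elim: w1 c => [|a w1 IHw] c c1 //=.
rewrite IHw; last exact/(@lcs_desc _ 2)/lcs_comm.
by rewrite /= (metab_comm (y l) (y a) c1).
Qed.

Lemma lcom_perm i j w w' : perm_eq w w' -> lcom y i j w = lcom y i j w'.
Proof.
rewrite /lcom; have : der1 H [~ y i, y j]%g by exact: der1_comm.
elim: w w' [~ _, _]%g => [|l w IHw] w' c c1; first by rewrite perm_sym => /perm_nilP ->.
move=> pw; have lw' : l \in w' by rewrite -(perm_mem pw) mem_head.
case/splitPr: lw' pw => w1 w2 pw; rewrite foldl_comm_swap //=.
apply: IHw; first exact/(@lcs_desc _ 2)/lcs_comm.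
by move: pw; rewrite perm_sym -[l :: w2]cat1s perm_catCA /= perm_cons perm_sym.
Qed.

Lemma lcom_jacobi i j l w k : k = (size w).+3 ->
  gcl k (lcom y i j (l :: w)) + gcl k (lcom y j l (i :: w)) +
  gcl k (lcom y l i (j :: w)) = 0.
Proof.
move=> kw; have [F FE] := @ad_word H m y w 3 k kw.
have l3 a b c : lcs H 3 [~ [~ a, b], c]%g by apply/lcs_comm/(@lcs_comm _ 1).
by rewrite /lcom /= -!FE // -!linearD gcl_jacobi linear0.
Qed.

Lemma lcom_alt i j w k : k = (size w).+2 ->
  gcl k (lcom y i j w) = - gcl k (lcom y j i w).
Proof.
move=> kw; have [F FE] := @ad_word H m y w 2 k kw.
have l2 a b : lcs H 2 [~ a, b]%g by exact: (@lcs_comm _ 1).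
by rewrite /lcom -!FE // -!linearN gcl_comm_alt.
Qed.

Lemma lcom_rel (c : 'I_m -> 'I_m -> rat) w k : k = (size w).+2 ->
  \sum_i \sum_j c i j *: gcl 2 [~ y i, y j]%g = 0 :> gr H 2 ->
  \sum_i \sum_j c i j *: gcl k (lcom y i j w) = 0.
Proof.
move=> kw rel; have [F FE] := @ad_word H m y w 2 k kw.
rewrite -[RHS](linear0 F) -rel linear_sum; apply: eq_bigr => i _.
rewrite linear_sum; apply: eq_bigr => j _; rewrite linearZ FE //.
exact: (@lcs_comm _ 1).
Qed.

End Metabelian.

(** * Noncommutative power series, Lie elements and the Magnus expansion *)

(* Words index the monomials; T = unit gives power series in one variable, in
   which the word of length k stands for its k-th power. *)
Definition wser (T : choiceType) (R : nzRingType) : Type := seq T -> R.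

HB.instance Definition _ T R := GRing.Zmodule.on (wser T R).

Section WordSeries.
Variables (T : choiceType) (R : nzRingType).
Implicit Types (p q r : wser T R) (w : seq T) (a : T).

(* Left division by the letter a, dropping the monomials that do not start with a. *)
Definition dl a p : wser T R := fun w => p (a :: w).

(** The Cauchy product, a sum over the splittings of w, by recursion on w: the left factor of a
    splitting either starts with the first letter, which [dl] removes, or is empty. *)
Fixpoint wmul_rec (p q : seq T -> R) w : R :=
  if w is a :: v then wmul_rec (fun w => p (a :: w)) q v + p [::] * q w
  else p [::] * q [::].
Definition wmul p q : wser T R := wmul_rec p q.
Definition wone : wser T R := fun w => (w == [::])%:R.

Lemma wser_eq p q : (forall w, p w = q w) -> p = q.
Proof. exact: functional_extensionality_dep. Qed.

Lemma wmul_nil p q : wmul p q [::] = p [::] * q [::].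
Proof. by []. Qed.
Lemma wmul_cons p q a w : wmul p q (a :: w) = wmul (dl a p) q w + p [::] * q (a :: w).
Proof. by []. Qed.

Lemma wserDE p q w : (p + q) w = p w + q w. Proof. by []. Qed.
Lemma wserNE p w : (- p) w = - p w. Proof. by []. Qed.
Lemma wser0E w : (0 : wser T R) w = 0. Proof. by []. Qed.

Let mulDl : left_distributive wmul +%R.
Proof.
move=> p q r; apply: wser_eq => w; rewrite wserDE.
elim: w p q => [|a w IHw] p q; first by rewrite !wmul_nil mulrDl.
by rewrite !wmul_cons [dl a _]/(dl a p + dl a q) IHw wserDE mulrDl addrACA.
Qed.
Let mulDr : right_distributive wmul +%R.
Proof.
move=> p q r; apply: wser_eq => w; rewrite wserDE.
elim: w p => [|a w IHw] p; first by rewrite !wmul_nil mulrDr.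
by rewrite !wmul_cons IHw mulrDr addrACA.
Qed.
Let mulcl (c : R) p q w : wmul (fun w => c * p w) q w = c * wmul p q w.
Proof.
elim: w p => [|a w IHw] p; first by rewrite !wmul_nil mulrA.
rewrite !wmul_cons mulrDr mulrA; congr (_ + _); exact: (IHw (dl a p)).
Qed.
Let mulA : associative wmul.
Proof.
move=> p q r; apply: wser_eq => w.
elim: w p q => [|a w IHw] p q; first by rewrite !wmul_nil mulrA.
rewrite !wmul_cons.
have -> : dl a (wmul p q) =
  wmul (dl a p) q + (fun w => p [::] * dl a q w : R) by [].
by rewrite mulDl wserDE mulcl -IHw mulrDr addrA wmul_nil mulrA.
Qed.
Let mul1 : left_id wone wmul.
Proof.
move=> p; apply: wser_eq => -[|a w]; first by rewrite wmul_nil mul1r.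
rewrite wmul_cons mul1r -[RHS]add0r; congr (_ + _).
have -> : dl a wone = 0 by [].
by elim: w => [|b w IHw]; rewrite ?wmul_nil ?wmul_cons mul0r // addr0.
Qed.
Let mulr1 : right_id wone wmul.
Proof.
move=> p; apply: wser_eq => w; elim: w p => [|a w IHw] p.
  by rewrite wmul_nil mulr1.
by rewrite wmul_cons IHw mulr0 addr0.
Qed.
Let one_neq0 : wone != 0.
Proof. by apply/eqP => /(congr1 (fun p => p [::])) /eqP; rewrite oner_eq0. Qed.

HB.instance Definition _ := GRing.Zmodule_isNzRing.Build (wser T R)
  mulA mul1 mulr1 mulDl mulDr one_neq0.

Lemma wmulE_nil p q : (p * q) [::] = p [::] * q [::].
Proof. by []. Qed.
Lemma wmulE_cons p q a w : (p * q) (a :: w) = (dl a p * q) w + p [::] * q (a :: w).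
Proof. by []. Qed.
Lemma woneE w : (1 : wser T R) w = (w == [::])%:R. Proof. by []. Qed.

Lemma dl1 a : dl a 1 = 0. Proof. by []. Qed.

Definition word_ord k p := forall w, (size w < k)%N -> p w = 0.

Lemma word_ordT p : word_ord 0 p. Proof. by move=> w; rewrite ltn0. Qed.
Hint Resolve word_ordT : core.

Lemma word_ordM i j p q : word_ord i p -> word_ord j q -> word_ord (i + j)%N (p * q).
Proof.
move=> + jq w; elim: w i p => [|a w IHw] [|i] p ip ijw; rewrite ?wmulE_nil ?wmulE_cons.
- by rewrite (jq [::]) ?mulr0.
- by rewrite (ip [::]) ?mul0r.
- rewrite (jq (a :: w)) // mulr0 addr0.
  by apply: (IHw 0%N) => //; exact: ltn_trans (ltnSn _) ijw.
- rewrite (ip [::]) // mul0r addr0.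
  by apply: (IHw i) => // v vi; apply: ip.
Qed.

Lemma word_ordD k p q : word_ord k p -> word_ord k q -> word_ord k (p + q).
Proof. by move=> kp kq w wk; rewrite wserDE kp ?kq ?addr0. Qed.

Lemma word_ordN k p : word_ord k p -> word_ord k (- p).
Proof. by move=> kp w wk; rewrite wserNE kp ?oppr0. Qed.

Lemma word_ord0 k : word_ord k 0. Proof. by []. Qed.

Lemma word_ord_le i j p : (i <= j)%N -> word_ord j p -> word_ord i p.
Proof. by move=> ij jp w wi; apply/jp/(leq_trans wi). Qed.

Definition wcomp k p : wser T R := fun w => if size w == k then p w else 0.

Lemma wcompD k p q : wcomp k (p + q) = wcomp k p + wcomp k q.
Proof. by apply: wser_eq => w; rewrite wserDE /wcomp; case: eqP; rewrite ?addr0. Qed.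

Lemma wcompN k p : wcomp k (- p) = - wcomp k p.
Proof. by apply: wser_eq => w; rewrite wserNE /wcomp; case: eqP; rewrite ?oppr0. Qed.

Lemma wcomp_ord k p : word_ord k.+1 p -> wcomp k p = 0.
Proof. by move=> kp; apply: wser_eq => w; rewrite /wcomp; case: eqP => // wk; rewrite kp ?wk. Qed.

Lemma wcomp_word_ord k p : word_ord k (wcomp k p).
Proof. by move=> w wk; rewrite /wcomp ltn_eqF. Qed.

Lemma wcomp_sub_ord k p : word_ord k p -> word_ord k.+1 (p - wcomp k p).
Proof.
move=> kp w; rewrite ltnS wserDE wserNE /wcomp leq_eqVlt => /predU1P[->|wk].
  by rewrite eqxx subrr.
by rewrite ltn_eqF // subr0 kp.
Qed.

Lemma wcompM_lead i j p q : word_ord i p -> word_ord j q ->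
  wcomp (i + j)%N (p * q) = wcomp i p * wcomp j q.
Proof.
move=> ip jq.
have ip' := wcomp_sub_ord ip; have jq' := wcomp_sub_ord jq.
have -> : p * q = wcomp i p * wcomp j q +
    (wcomp i p * (q - wcomp j q) + (p - wcomp i p) * q).
  by rewrite addrA -mulrDr (addrC (wcomp j q)) subrK -mulrDl (addrC (wcomp i p)) subrK.
rewrite wcompD [X in _ + X]wcomp_ord ?addr0; last first.
  apply: word_ordD; last by rewrite -addSn; exact: word_ordM.
  by rewrite -addnS; apply: word_ordM => //; exact: wcomp_word_ord.
apply: wser_eq => w; rewrite {1}/wcomp; case: eqP => // /eqP.
elim: w i p ip {ip'} => [|a w IHw] i p ip.
  rewrite wmulE_nil /wcomp /=; case: i j {ip jq jq'} => [|i] [|j] //; by rewrite ?mul0r ?mulr0.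
rewrite wmulE_cons; case: i ip => [|i] ip.
  have -> : dl a (wcomp 0 p) = 0 by [].
  rewrite mul0r wser0E add0r add0n => wj.
  by rewrite {2}/wcomp (negPf wj) mulr0.
have -> : dl a (wcomp i.+1 p) = wcomp i (dl a p) by [].
by rewrite {2}/wcomp mul0r addr0 addSn eqSS => /IHw; apply => v vi; apply: ip.
Qed.

End WordSeries.

Section Letters.
Variables (T : choiceType) (R : nzRingType).
Implicit Types (p q : wser T R) (w : seq T) (a b : T) (c : R).

Definition letter a c : wser T R := fun w => if w == [:: a] then c else 0.

Lemma mul_wconst a p q w : dl a p = 0 -> (p * q) (a :: w) = p [::] * q (a :: w).
Proof. by move=> p0; rewrite wmulE_cons p0 mul0r add0r. Qed.

Definition wcst c : wser T R := fun v => if v == [::] then c else 0.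

Lemma wcst_mul c p w : (wcst c * p) w = c * p w.
Proof. by case: w => [|a v]; [rewrite wmulE_nil | rewrite mul_wconst]. Qed.

Lemma letter_mul_nil a c p : (letter a c * p) [::] = 0.
Proof. by rewrite wmulE_nil mul0r. Qed.

Lemma letter_mul_cons a c p b w :
  (letter a c * p) (b :: w) = if b == a then c * p w else 0.
Proof.
rewrite wmulE_cons mul0r addr0; have [->|ba] := eqVneq b a; last first.
  rewrite (_ : dl b _ = 0) ?mul0r //; apply: wser_eq => v.
  by rewrite /dl /letter eqseq_cons (negPf ba).
have -> : dl a (letter a c) = wcst c.
  by apply: wser_eq => v; rewrite /dl /letter eqseq_cons eqxx.
by rewrite wcst_mul.
Qed.

(* The Euler derivation. *)
Definition wdeg p : wser T R := fun w => p w *+ size w.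

Lemma wdegD p q : wdeg (p + q) = wdeg p + wdeg q.
Proof. by apply: wser_eq => w; rewrite /wdeg wserDE mulrnDl. Qed.

Lemma wdegM p q : wdeg (p * q) = wdeg p * q + p * wdeg q.
Proof.
apply: wser_eq => w; rewrite wserDE; elim: w p => [|a w IHw] p.
  by rewrite /wdeg !wmulE_nil !mulr0n mul0r mulr0 addr0.
rewrite [LHS]/wdeg /= !wmulE_cons.
have -> : dl a (wdeg p) = wdeg (dl a p) + dl a p.
  by apply: wser_eq => v; rewrite wserDE /wdeg /dl /= mulrSr.
have -> : wdeg p [::] = 0 by rewrite /wdeg mulr0n.
rewrite mul0r addr0 mulrDl wserDE addrACA -IHw addrA.
have -> : wdeg (dl a p * q) w + (dl a p * q) w = (dl a p * q) w *+ (size w).+1.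
  by rewrite mulrSr.
by rewrite mulrnDl /wdeg /= mulrnAr.
Qed.

Lemma wdeg_ord k p : word_ord k p -> word_ord k (wdeg p).
Proof. by move=> kp w wk; rewrite /wdeg kp // mul0rn. Qed.

Lemma wdeg1 : wdeg 1 = 0.
Proof. by apply: wser_eq => -[|a w]; rewrite /wdeg ?mulr0n ?mul0rn. Qed.

End Letters.

(** * Power series in one variable and the exponential *)

Section PowerSeries.
Variable R : comNzRingType.
Implicit Types f g : wser unit R.

Lemma fps_mulC f g : f * g = g * f.
Proof.
apply: wser_eq => w.
(* The recursion peels letters off the left factor only. Unfolding twice, with an exchange in
   between, restores the symmetry, so two consecutive lengths are carried through the induction. *)
suff : (forall f g, (f * g) w = (g * f) w) /\
       (forall f g, (f * g) (tt :: w) = (g * f) (tt :: w)) by case=> + _; apply.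
elim: w {f g} => [|[] w [IHw IHtw]]; split=> f g.
- by rewrite !wmulE_nil mulrC.
- by rewrite !wmulE_cons !wmulE_nil addrC ![f _ * _]mulrC.
- exact: IHtw.
rewrite wmulE_cons [RHS]wmulE_cons IHtw [in RHS]IHtw !wmulE_cons IHw.
by rewrite -!addrA; congr (_ + _); rewrite addrC.
Qed.

End PowerSeries.

HB.instance Definition _ (R : comNzRingType) :=
  GRing.PzRing_hasCommutativeMul.Build (wser unit R) (@fps_mulC R).

Section Exponential.
Variables (R : comNzRingType) (phi : {rmorphism rat -> R}).
Implicit Types (a b : R) (f g : wser unit R).

(* exp(a z), the unique solution of E f = (a z) f with constant term 1, where E is
   the Euler derivation. *)
Definition expser a : wser unit R := fun w => phi ((size w)`!%:R)^-1 * a ^+ size w.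

Lemma expser0E a : expser a [::] = 1.
Proof. by rewrite /expser fact0 invr1 rmorph1 mulr1. Qed.

Lemma natf_phi k : phi (k.+1)%:R^-1 *+ k.+1 = 1.
Proof. by rewrite -rmorphMn -mulr_natr mulVf ?rmorph1 // Num.Theory.pnatr_eq0. Qed.

Lemma wdeg_expser a : wdeg (expser a) = letter tt a * expser a.
Proof.
apply: wser_eq => -[|[] w]; first by rewrite letter_mul_nil /wdeg mulr0n.
rewrite letter_mul_cons eqxx /wdeg /expser /= factS natrM invfM rmorphM exprS.
by rewrite !mulrA -!mulrnAl natf_phi mul1r [a * _]mulrC.
Qed.

(** The equation reads k f_k = a f_(k-1), and k is invertible through phi. *)
Lemma expser_unique a f : f [::] = 1 -> wdeg f = letter tt a * f -> f = expser a.
Proof.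
move=> f0 fE; apply: wser_eq; elim=> [|[] w IHw]; first by rewrite expser0E.
have E g : wdeg g = letter tt a * g -> g (tt :: w) = phi (size w).+1%:R^-1 * (a * g w).
  move=> /(congr1 (fun h => h (tt :: w))); rewrite letter_mul_cons eqxx => <-.
  by rewrite /wdeg /= mulrnAr -mulrnAl natf_phi mul1r.
by rewrite (E _ fE) (E _ (wdeg_expser a)) IHw.
Qed.

Lemma letterD a b : letter tt (a + b) = letter tt a + letter tt b :> wser unit R.
Proof. by apply: wser_eq => w; rewrite wserDE /letter; case: eqP; rewrite ?addr0. Qed.

(** By Leibniz the product solves the equation that characterises exp((a + b) z). *)
Lemma expserD a b : expser (a + b) = expser a * expser b.
Proof.
apply/esym/expser_unique; first by rewrite wmulE_nil !expser0E mulr1.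
by rewrite wdegM !wdeg_expser letterD mulrDl -mulrA (mulrCA (expser a)).
Qed.

Lemma expser0 : expser 0 = 1.
Proof.
apply/esym/expser_unique; first by [].
rewrite wdeg1 mulr1; apply: wser_eq => w; rewrite /letter; by case: eqP.
Qed.

End Exponential.

Section LetterSeries.
Variable T : choiceType.
Implicit Types (c d : wser unit rat) (a : T).

(* The series c in one variable evaluated at the letter a. *)
Definition wpow a c : wser T rat :=
  fun w => if all (pred1 a) w then c (nseq (size w) tt) else 0.

Lemma wpow_dl a b c : dl b (wpow a c) = if b == a then wpow a (dl tt c) else 0.
Proof.
apply: wser_eq => w; by rewrite /dl /wpow /=; case: eqVneq.
Qed.

Lemma wpowM a c d : wpow a (c * d) = wpow a c * wpow a d.
Proof.
apply: wser_eq => w; elim: w c => [|b w IHw] c; first by [].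
rewrite wmulE_cons wpow_dl; have [->|ba] := eqVneq b a; last first.
  by rewrite mul0r add0r /wpow /= (negPf ba) mulr0.
rewrite -IHw /wpow /= eqxx /= wmulE_cons.
by case: all => //; rewrite mulr0 addr0.
Qed.

Lemma wpow1 a : wpow a 1 = 1.
Proof. by apply: wser_eq => -[|b w]; rewrite /wpow //=; case: ifP. Qed.

Lemma wdeg_wpow a c : wdeg (wpow a c) = wpow a (wdeg c).
Proof.
apply: wser_eq => w; rewrite /wdeg /wpow size_nseq; case: ifP => // _.
by rewrite mul0rn.
Qed.

Lemma wpow_letter a (k : rat) : wpow a (letter tt k) = letter a k.
Proof.
apply: wser_eq => -[|b [|b' w]]; rewrite /wpow /letter //= ?andbT ?eqseq_cons.
by rewrite andbF; case: ifP.
Qed.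

Lemma wpow_comm a c d : wpow a c * wpow a d = wpow a d * wpow a c.
Proof. by rewrite -!wpowM mulrC. Qed.

End LetterSeries.

Section WordAlgebra.
Variable T : choiceType.
Implicit Types (p q : wser T rat).

Definition wscale (c : rat) p : wser T rat := fun w => c * p w.

Let scaleA a b p : wscale a (wscale b p) = wscale (a * b) p.
Proof. by apply: wser_eq => w; rewrite /wscale mulrA. Qed.
Let scale1 : left_id 1 wscale.
Proof. by move=> p; apply: wser_eq => w; rewrite /wscale mul1r. Qed.
Let scaleDr : right_distributive wscale +%R.
Proof. by move=> c p q; apply: wser_eq => w; rewrite /wscale wserDE mulrDr. Qed.
Let scaleDl p : {morph wscale^~ p : a b / a + b}.
Proof. by move=> a b; apply: wser_eq => w; rewrite /wscale wserDE mulrDl. Qed.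

HB.instance Definition _ := GRing.Zmodule_isLmodule.Build rat (wser T rat)
  scaleA scale1 scaleDr scaleDl.

Lemma wserZE c p w : (c *: p) w = c * p w. Proof. by []. Qed.

Let scaleE c p : c *: p = wcst c * p.
Proof. by apply: wser_eq => w; rewrite wserZE wcst_mul. Qed.

Let scaleAl c p q : c *: (p * q) = (c *: p) * q.
Proof. by rewrite !scaleE mulrA. Qed.
Let scaleAr c p q : c *: (p * q) = p * (c *: q).
Proof.
apply: wser_eq => w; rewrite wserZE; elim: w p => [|a w IHw] p.
  by rewrite !wmulE_nil mulrCA.
by rewrite !wmulE_cons mulrDr IHw mulrCA.
Qed.

HB.instance Definition _ := GRing.Lmodule_isLalgebra.Build rat (wser T rat) scaleAl.
HB.instance Definition _ := GRing.Lalgebra_isAlgebra.Build rat (wser T rat) scaleAr.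

Definition wlie p q := p * q - q * p.

Let wlie_linearl q : linear (wlie^~ q).
Proof.
move=> c u v; rewrite /wlie mulrDl mulrDr -scalerAl -scalerAr opprD addrACA.
by rewrite -scalerBr.
Qed.
Let wlie_linearr q : linear (wlie q).
Proof.
move=> c u v; rewrite /wlie mulrDl mulrDr -scalerAl -scalerAr opprD addrACA.
by rewrite -scalerBr.
Qed.
Let wliexx p : wlie p p = 0. Proof. exact: subrr. Qed.
Let wlie_jacobi p q r :
  wlie p (wlie q r) + wlie q (wlie r p) + wlie r (wlie p q) = 0.
Proof. exact: comm_jacobi. Qed.

HB.instance Definition _ := Lmodule_isLieAlgebra.Build (wser T rat)
  wlie_linearl wlie_linearr wliexx wlie_jacobi.

Lemma wlieE p q : lie p q = p * q - q * p. Proof. by []. Qed.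

Lemma wcompZ k c p : wcomp k (c *: p) = c *: wcomp k p.
Proof. by apply: wser_eq => w; rewrite wserZE /wcomp wserZE; case: eqP; rewrite ?mulr0. Qed.

Lemma wcomp_letterl k a c p : wcomp k.+1 (letter a c * p) = letter a c * wcomp k p.
Proof.
apply: wser_eq => -[|b w]; first by rewrite letter_mul_nil.
rewrite letter_mul_cons {1}/wcomp letter_mul_cons eqSS /wcomp.
by case: (b == a); case: (_ == k) => //; rewrite mulr0.
Qed.

Lemma wcomp_letterr k a c p : wcomp k.+1 (p * letter a c) = wcomp k p * letter a c.
Proof.
apply: wser_eq => w; elim: w k p => [|b w IHw] k p.
  by rewrite wmulE_nil /wcomp /= mulr0.
rewrite [RHS]wmulE_cons {1}/wcomp wmulE_cons eqSS; case: k => [|k].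
  have -> : dl b (wcomp 0 p) = 0 by [].
  rewrite mul0r add0r [wcomp 0 p _]/=; case: eqP => [/size0nil->|w0].
    by rewrite wmulE_nil mulr0 add0r.
  by rewrite /letter eqseq_cons; case: w w0 {IHw} => // *; rewrite andbF mulr0.
have -> : dl b (wcomp k.+1 p) = wcomp k (dl b p) by [].
rewrite -IHw {2}/wcomp mul0r addr0 /wcomp; case: eqP => // wk.
by case: w {IHw} wk => // *; rewrite /letter eqseq_cons andbF mulr0 addr0.
Qed.

End WordAlgebra.

(** * Lie polynomials and Lie series inside the noncommutative series *)

Section LieBracket.
Variable n : nat.

Definition lbr (L : lieAlgType) (y : 'I_n -> L) (i : 'I_n) (w : seq 'I_n) : L :=
  foldl (fun a l => lie a (y l)) (y i) w.

Lemma lbr_rcons (L : lieAlgType) (y : 'I_n -> L) i w l :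
  lbr y i (rcons w l) = lie (lbr y i w) (y l).
Proof. by rewrite /lbr foldl_rcons. Qed.

Local Notation P := (wser 'I_n rat).

Definition wlet (i : 'I_n) : P := letter i 1.

(** The degree-k part of the Lie algebra generated by the letters: left-normed brackets suffice to
    span it. *)
Definition lieS (k : nat) : set P :=
  lspan [set p | exists i w, (size w).+1 = k /\ p = lbr wlet i w].

Lemma wlet_deg i p k : wcomp k p = p -> wcomp k.+1 (lie p (wlet i)) = lie p (wlet i).
Proof.
by move=> pk; rewrite wlieE wcompD wcompN wcomp_letterl wcomp_letterr pk.
Qed.

Lemma lieS_deg k p : lieS k p -> wcomp k p = p.
Proof.
elim=> [|c u v [i [w [<- ->]]] _ IHv].
  by apply: wser_eq => w; rewrite /wcomp; case: eqP.
rewrite wcompD wcompZ IHv; congr (_ *: _ + _); clear IHv.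
elim/last_ind: w => [|w l IHw]; last by rewrite size_rcons lbr_rcons wlet_deg.
by apply: wser_eq => w; rewrite /wcomp /lbr /wlet /letter /=; case: (w =P [:: i]) => [->|_] //; case: eqP.
Qed.

Lemma lieS_lie k p i c : lieS k p -> lieS k.+1 (p * letter i c - letter i c * p).
Proof.
have -> : letter i c = c *: wlet i.
  by apply: wser_eq => w; rewrite wserZE /wlet /letter; case: eqP; rewrite ?mulr1 ?mulr0.
rewrite -[_ - _]/(lie p (c *: wlet i)).
elim=> [|d u v [j [w [<- ->]]] _ IHv]; first by rewrite lie0l; apply: lspan0.
rewrite lie_linearl; apply: lspanD IHv; apply: lspanZ.
have -> : lie (lbr wlet j w) (c *: wlet i) = c *: lbr wlet j (rcons w i).
  by have := lie_linearr (lbr wlet j w) c (wlet i) 0; rewrite addr0 lie0r addr0 lbr_rcons.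
by apply/lspanZ/lspan_mem; exists j, (rcons w i); rewrite size_rcons.
Qed.

Lemma homog_deg k (p : P) : wcomp k p = p -> wdeg p = p *+ k.
Proof.
move=> pk; apply: wser_eq => w; rewrite -pk /wdeg.
have -> : (wcomp k p *+ k) w = wcomp k p w *+ k.
  by elim: k {pk} (wcomp k p) => [|k IHk] q //; rewrite !mulrSr wserDE IHk.
by rewrite /wcomp; case: eqP => [->//|_]; rewrite !mul0rn.
Qed.

Lemma wcomp_wdeg k (p : P) : wcomp k (wdeg p) = wcomp k p *+ k.
Proof.
rewrite -(@homog_deg k (wcomp k p)); last first.
  by apply: wser_eq => w; rewrite /wcomp; case: eqP.
by apply: wser_eq => w; rewrite /wcomp /wdeg; case: eqP => //; rewrite mul0rn.
Qed.

Definition lie_hat (p : P) := forall k, lieS k (wcomp k p).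

Lemma wcomp_sum k (p : P) : word_ord k (p - \sum_(d < k) wcomp d p).
Proof.
elim: k p => [|k IHk] p; first exact: word_ordT.
rewrite big_ord_recr /= opprD addrA.
set q := p - _; have -> : wcomp k p = wcomp k q.
  rewrite /q wcompD wcompN (_ : wcomp k (\sum_(d < k) _) = 0) ?subr0 //.
  elim/big_ind: _ => [|a b a0 b0|d _].
  - by apply: wser_eq => w; rewrite /wcomp; case: eqP.
  - by rewrite wcompD a0 b0 addr0.
  - apply: wser_eq => w; rewrite /wcomp; case: eqP => // ->.
    by rewrite gtn_eqF.
exact/wcomp_sub_ord/IHk.
Qed.

Section Conjugation.
Variables (u v : P) (i : 'I_n) (c : rat).
Hypotheses (uv : u * v = 1) (vu : v * u = 1) (u0 : u [::] = 1).
Hypotheses (uE : wdeg u = letter i c * u) (uC : letter i c * u = u * letter i c).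

(* With E the Euler derivation, q = u^-1 p u satisfies E q = d q + [q, X], so
   (k - d) q_k = [q_(k-1), X] determines the components of q one after the other. *)
Lemma conj_lieS d p : lieS d p -> lie_hat (v * p * u).
Proof.
move=> dp k; have pd := lieS_deg dp; set q := v * p * u.
have ordp : word_ord d p by rewrite -pd; exact: wcomp_word_ord.
have v0 : v [::] = 1.
  by move: (congr1 (fun f : P => f [::]) uv); rewrite wmulE_nil u0 mul1r.
have c0 f : f [::] = 1 -> wcomp 0 f = 1 :> P.
  by move=> f0; apply: wser_eq => -[|a w].
have ordq : word_ord d q.
  by rewrite -[d]addn0; apply: word_ordM => //; rewrite -[d]add0n; exact: word_ordM.
have vE : wdeg v = - (letter i c * v).
  have /(congr1 (fun f : P => v * f)) : wdeg (u * v) = 0 by rewrite uv wdeg1.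
  rewrite mulr0 wdegM mulrDr mulrA uE uC mulrA vu mul1r mulrA vu mul1r => /eqP.
  by rewrite addrC addr_eq0 => /eqP.
have qE : wdeg q = q *+ d + (q * letter i c - letter i c * q).
  rewrite /q !wdegM vE uE uC (homog_deg pd) mulrDl mulrnAr mulrnAl !mulNr !mulrA.
  by rewrite [X in X + _ = _]addrC -addrA; congr (_ + _); rewrite addrC.
have qd : wcomp d q = p.
  rewrite /q -[d]addn0 wcompM_lead //; last by rewrite -[d]add0n; exact: word_ordM.
  by rewrite -[d]add0n wcompM_lead // !c0 // pd mul1r mulr1.
have [kd|dk] := ltnP k d.
  by rewrite wcomp_ord; [exact: lspan0 | exact: word_ord_le ordq].
rewrite -(subnK dk); elim: (k - d)%N => [|e IHe]; first by rewrite add0n qd.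
have := congr1 (wcomp (e + d).+1) qE.
rewrite wcomp_wdeg !wcompD wcompN wcomp_letterl wcomp_letterr.
rewrite (_ : wcomp _ (q *+ d) = wcomp (e + d).+1 q *+ d); last first.
  by rewrite -!scaler_nat wcompZ.
rewrite -addSn mulrnDr addrC => /addrI qe.
have -> : wcomp (e.+1 + d) q = (e.+1%:R)^-1 *: (wcomp (e.+1 + d) q *+ e.+1).
  by rewrite -scaler_nat scalerA mulVf ?scale1r // Num.Theory.pnatr_eq0.
by rewrite qe; apply/lspanZ; rewrite addSn; exact: lieS_lie.
Qed.

Lemma conj_lie_hat l : lie_hat l -> lie_hat (v * l * u).
Proof.
(* Multiplication does not lower the order, so components of l of degree above k do not reach degree
   k. *)
move=> lS k; have -> : v * l * u = v * (l - \sum_(d < k.+1) wcomp d l) * u +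
    \sum_(d < k.+1) v * wcomp d l * u.
  by rewrite -mulr_suml -mulr_sumr -mulrDl -mulrDr subrK.
rewrite wcompD wcomp_ord ?add0r; last first.
  have := word_ordM (word_ordM (word_ordT v) (@wcomp_sum k.+1 l)) (word_ordT u).
  by rewrite add0n addn0.
elim/big_ind: _ => [|a b aS bS|d _].
- by rewrite wcomp_ord; [exact: lspan0 | exact: word_ord0].
- by rewrite wcompD; exact: lspanD.
- exact: conj_lieS.
Qed.

End Conjugation.
End LieBracket.

Section UnitGroup.
Variable R : nzRingType.

(** A unit is stored with its inverse, which gives a target group for F over any ring R. *)
Record ugrp := Ugrp { ugval : R * R;
  _ : (ugval.1 * ugval.2 == 1) && (ugval.2 * ugval.1 == 1) }.

HB.instance Definition _ := [isSub for ugval].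
HB.instance Definition _ := [Choice of ugrp by <:].

Lemma ugK (a : ugrp) : (ugval a).1 * (ugval a).2 = 1.
Proof. by case: a => a /= /andP[/eqP ? _]. Qed.
Lemma ugVK (a : ugrp) : (ugval a).2 * (ugval a).1 = 1.
Proof. by case: a => a /= /andP[_ /eqP]. Qed.

Fact ug_one_subproof (c := (1, 1) : R * R) : (c.1 * c.2 == 1) && (c.2 * c.1 == 1).
Proof. by rewrite /= mulr1 eqxx. Qed.
Definition ug_one := Ugrp ug_one_subproof.

Fact ug_mul_subproof (a b : ugrp)
  (c := ((ugval a).1 * (ugval b).1, (ugval b).2 * (ugval a).2)) :
  (c.1 * c.2 == 1) && (c.2 * c.1 == 1).
Proof.
by rewrite /= !mulrA -(mulrA (ugval a).1) ugK mulr1 ugK -(mulrA (ugval b).2) ugVK mulr1 ugVK eqxx.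
Qed.
Definition ug_mul a b := Ugrp (ug_mul_subproof a b).

Fact ug_inv_subproof (a : ugrp) (c := ((ugval a).2, (ugval a).1)) :
  (c.1 * c.2 == 1) && (c.2 * c.1 == 1).
Proof. by rewrite /= ugK ugVK eqxx. Qed.
Definition ug_inv a := Ugrp (ug_inv_subproof a).

Let ugA : associative ug_mul.
Proof. by move=> a b c; apply: val_inj; rewrite /= !mulrA. Qed.
Let ug1 : left_id ug_one ug_mul.
Proof. by move=> a; apply: val_inj; rewrite /= mul1r mulr1; case: (ugval a). Qed.
Let ugr1 : right_id ug_one ug_mul.
Proof. by move=> a; apply: val_inj; rewrite /= mul1r mulr1; case: (ugval a). Qed.
Let ugV : left_inverse ug_one ug_inv ug_mul.
Proof. by move=> a; apply: val_inj; rewrite /= ugVK. Qed.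
Let ugrV : right_inverse ug_one ug_inv ug_mul.
Proof. by move=> a; apply: val_inj; rewrite /= ugK. Qed.

HB.instance Definition _ := isGroup.Build ugrp ugA ug1 ugr1 ugV ugrV.

End UnitGroup.

Section FreeGroup.
Variables (n : nat) (F : groupType) (x : 'I_n -> F).
Hypothesis F_free : free_on x.

(** The map from F to the subgroup generated by the x_i, followed by the inclusion, is the identity
    by the uniqueness in the universal property. *)
Lemma free_gen (g : F) : gen [set x i | i in [set: 'I_n]] g.
Proof.
pose A := subgrp [set x i | i in [set: 'I_n]].
have xA i : [set x i | i in [set: 'I_n]] (x i) by exists i.
pose y i : A := SubGrp (introT (asboolP _) (gen_mem (xA i))).
have [f [[fM fx] _]] := F_free y; have [h [[_ _] h_uniq]] := F_free x.
have hid : h = id by apply: h_uniq.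
have hf : h = fun g => val (f g).
  by apply: h_uniq; split=> [a b|i]; rewrite ?fM ?fx.
have -> : g = val (f g) by rewrite -[LHS]/(id g) -hid hf.
by case: (f g) => u /= /asboolP.
Qed.

Lemma free_ind (P : F -> Prop) : P 1%g ->
  (forall i g, P g -> P (x i * g)%g) -> (forall i g, P g -> P ((x i)^-1 * g)%g) ->
  forall g, P g.
Proof.
(* Stability of P under left multiplication by g and by g^-1 together is inherited by quotients of
   group elements. *)
move=> P1 Px PV g; suff : (forall h, P h -> P (g * h)%g) /\ (forall h, P h -> P (g^-1 * h)%g).
  by case=> /(_ _ P1); rewrite mulg1.
elim: (free_gen g) => [_ [i _ <-]||a b _ [Pa PaV] _ [Pb PbV]].
- by split=> h Ph; [exact: Px | exact: PV].
- by rewrite invg1; split=> h; rewrite mul1g.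
- rewrite invgM invgK; split=> h Ph; rewrite -mulgA; first exact/Pa/PbV.
  exact/Pb/PaV.
Qed.

Lemma free_unit (R : nzRingType) (u v : 'I_n -> R) :
  (forall i, u i * v i = 1) -> (forall i, v i * u i = 1) ->
  exists f : F -> R, [/\ f 1%g = 1, forall g h, f (g * h)%g = f g * f h,
    forall i, f (x i) = u i & forall i, f (x i)^-1%g = v i].
Proof.
move=> uv vu.
have yP i : ((u i, v i).1 * (u i, v i).2 == 1) && ((u i, v i).2 * (u i, v i).1 == 1).
  by rewrite /= uv vu eqxx.
have [f [[fM fx] _]] := F_free (fun i => Ugrp (yP i)).
exists (fun g => (val (f g)).1); split=> [|g h|i|i].
- by rewrite (morph1g fM).
- by rewrite fM.
- by rewrite fx.
- by rewrite (morphVg fM) fx.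
Qed.

End FreeGroup.

Section LiePart.
Variables (n : nat) (F : groupType) (x : 'I_n -> F).
Hypothesis F_free : free_on x.
Local Notation P := (wser 'I_n rat).

Definition wexp (c : rat) (i : 'I_n) : P := wpow i (expser (R := rat) idfun c).

Lemma wexpD c d i : wexp (c + d) i = wexp c i * wexp d i.
Proof. by rewrite /wexp expserD wpowM. Qed.

Lemma wexp0 i : wexp 0 i = 1.
Proof. by rewrite /wexp expser0 wpow1. Qed.

Lemma wexp_nil c i : wexp c i [::] = 1.
Proof. exact: (expser0E (R := rat) idfun c). Qed.

Lemma wdeg_wexp c i : wdeg (wexp c i) = letter i c * wexp c i.
Proof. by rewrite /wexp wdeg_wpow wdeg_expser wpowM wpow_letter. Qed.

Lemma wexp_comm c i : letter i c * wexp c i = wexp c i * letter i c.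
Proof. by rewrite -wpow_letter wpow_comm. Qed.

Lemma lie_hat_letter i c : lie_hat (letter i c : P).
Proof.
have lS : lieS 1 (wlet i) by apply: lspan_mem; exists i, [::].
have -> : letter i c = c *: wlet i.
  by apply: wser_eq => w; rewrite wserZE /wlet /letter; case: eqP; rewrite ?mulr1 ?mulr0.
move=> k; rewrite wcompZ; apply: lspanZ.
rewrite -(lieS_deg lS); have [<-|k1] := eqVneq 1%N k.
  by rewrite !(lieS_deg lS).
rewrite (_ : wcomp k _ = 0); first exact: lspan0.
apply: wser_eq => w; rewrite /wcomp; case: eqP => // ->.
by rewrite eq_sym (negPf k1).
Qed.

Lemma lie_hatD (p q : P) : lie_hat p -> lie_hat q -> lie_hat (p + q).
Proof. by move=> ph qh k; rewrite wcompD; apply: lspanD; [exact: ph | exact: qh]. Qed.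

Variable mu : F -> P.
Hypotheses (mu1 : mu 1%g = 1) (muM : forall g h, mu (g * h)%g = mu g * mu h).
Hypotheses (mux : forall i, mu (x i) = wexp 1 i) (muV : forall i, mu (x i)^-1%g = wexp (-1) i).

Lemma muK g : mu g^-1%g * mu g = 1.
Proof. by rewrite -muM mulVg. Qed.

(* The logarithmic derivative mu(g)^-1 E(mu g) is a 1-cocycle with value X_i at x_i. *)
Lemma mu_lie_hat g : lie_hat (mu g^-1%g * wdeg (mu g)) /\
  (forall l, lie_hat l -> lie_hat (mu g^-1%g * l * mu g)).
Proof.
(* The logarithmic derivative of h g is that of h conjugated by mu g, plus that of g; this is why
   stability under conjugation is proved in the same induction. *)
have step c i h : mu h^-1%g = wexp (- c) i -> mu h = wexp c i -> forall g,
  (lie_hat (mu g^-1%g * wdeg (mu g)) /\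
    (forall l, lie_hat l -> lie_hat (mu g^-1%g * l * mu g))) ->
  (lie_hat (mu (h * g)^-1%g * wdeg (mu (h * g)%g)) /\
    (forall l, lie_hat l -> lie_hat (mu (h * g)^-1%g * l * mu (h * g)%g))).
  move=> hV hE k [kS kJ]; have uv : wexp c i * wexp (- c) i = 1.
    by rewrite -wexpD subrr wexp0.
  have vu : wexp (- c) i * wexp c i = 1 by rewrite -wexpD addNr wexp0.
  rewrite invgM !muM hV hE; split=> [|l lS].
    rewrite wdegM mulrDr -!mulrA [X in _ + _ * X]mulrA vu mul1r wdeg_wexp.
    rewrite [X in X + _](_ : _ = mu k^-1%g * letter i c * mu k); last first.
      by rewrite wexp_comm -!mulrA (mulrA (wexp (- c) i)) vu mul1r.
    by apply: lie_hatD => //; apply/kJ/lie_hat_letter.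
  rewrite mulrA -!(mulrA (mu k^-1%g)); rewrite mulrA; rewrite mulrA.
  rewrite -(mulrA (mu k^-1%g)); apply: kJ.
  apply: (conj_lie_hat uv vu _ (wdeg_wexp c i) (wexp_comm c i)) => //.
elim/(free_ind F_free): g => [|i g|i g].
- rewrite invg1 mu1 wdeg1 mulr0; split=> [k|l lS].
    by rewrite wcomp_ord; [exact: lspan0 | exact: word_ord0].
  by rewrite mul1r mulr1.
- by apply: (step 1 i); rewrite ?muV ?mux.
- by apply: (step (-1) i); rewrite ?invgK ?muV ?mux ?opprK.
Qed.

(* Up to higher order, k times the leading form of mu g is the leading form of the
   logarithmic derivative. *)
Lemma lie_leading g k : word_ord k (mu g - 1) -> lieS k (wcomp k (mu g - 1)).
Proof.
case: k => [|k] gk.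
  have -> : wcomp 0 (mu g - 1) = 0; last exact: lspan0.
  apply: wser_eq => -[|//]; rewrite /wcomp /= wserDE wserNE.
  suff -> : mu g [::] = 1 by rewrite subrr.
  elim/(free_ind F_free): g {gk} => [|i g E|i g E]; first by rewrite mu1.
    by rewrite muM wmulE_nil E mux wexp_nil mulr1.
  by rewrite muM wmulE_nil E muV wexp_nil mulr1.
have [/(_ k.+1) gS _] := mu_lie_hat g; move: gS.
have -> : mu g^-1%g = 1 - mu g^-1%g * (mu g - 1).
  by rewrite mulrBr muK mulr1 opprB addrC subrK.
have -> : wdeg (mu g) = wdeg (mu g - 1).
  by rewrite -[in LHS](subrK 1 (mu g)) [LHS]wdegD wdeg1 addr0.
rewrite mulrBl mul1r (wcompD k.+1 (wdeg _)) (wcompN k.+1 (_ * _)).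
rewrite (@wcomp_ord _ _ _ (_ * _)) ?subr0; last first.
  apply: (@word_ord_le _ _ _ ((0 + k.+1) + k.+1)); first by rewrite add0n addSn ltnS leq_addl.
  by apply: word_ordM; [apply: word_ordM => //; exact: word_ordT | exact: wdeg_ord].
rewrite wcomp_wdeg => kS.
rewrite -[wcomp _ _]scale1r -(mulVf (_ : k.+1%:R != 0)) ?Num.Theory.pnatr_eq0 //.
by rewrite -scalerA scaler_nat; exact: lspanZ.
Qed.

End LiePart.

(** * Evaluation of series in a filtered algebra *)

Section Evaluation.
Variables (n : nat) (B : algType rat) (Fl : nat -> set B).
Hypotheses (FlT : forall a, Fl 0%N a) (Fl0 : forall k, Fl k 0).
Hypothesis FlL : forall k (c : rat) a b, Fl k a -> Fl k b -> Fl k (c *: a + b).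
Hypothesis FlM : forall i j a b, Fl i a -> Fl j b -> Fl (i + j)%N (a * b).
Hypothesis Fl_desc : forall k a, Fl k.+1 a -> Fl k a.
Local Notation P := (wser 'I_n rat).

Lemma FlD k a b : Fl k a -> Fl k b -> Fl k (a + b).
Proof. by move=> ka kb; rewrite -[a]scale1r; apply: FlL. Qed.
Lemma FlZ k c a : Fl k a -> Fl k (c *: a).
Proof. by move=> ka; rewrite -[_ *: _]addr0; apply: FlL. Qed.
Lemma FlN k a : Fl k a -> Fl k (- a).
Proof. by move=> ka; rewrite -scaleN1r; apply: FlZ. Qed.
Lemma FlB k a b : Fl k a -> Fl k b -> Fl k (a - b).
Proof. by move=> ka kb; apply/FlD/FlN. Qed.
Lemma Fl_mull k a b : Fl k b -> Fl k (a * b).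
Proof. by move=> kb; rewrite -[k]add0n; apply: FlM. Qed.
Lemma Fl_mulr k a b : Fl k a -> Fl k (a * b).
Proof. by move=> ka; rewrite -[k]addn0; apply: FlM. Qed.
Lemma Fl_sum k I (r : seq I) (f : I -> B) : (forall i, Fl k (f i)) -> Fl k (\sum_(i <- r) f i).
Proof. by move=> kf; elim/big_ind: _ => // a b; exact: FlD. Qed.
Lemma Fl_trans k a b c : Fl k (a - b) -> Fl k (b - c) -> Fl k (a - c).
Proof. by move=> ab bc; rewrite -(subrK b a) -addrA; apply: FlD. Qed.
Lemma Fl_le i j a : (i <= j)%N -> Fl j a -> Fl i a.
Proof. by move/subnK <-; elim: (j - i)%N => // d IHd; rewrite addSn => /Fl_desc. Qed.

(* Substitution of the b i for the letters, truncated at words of length N. *)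
Fixpoint ev (b : 'I_n -> B) N (p : P) : B :=
  if N is N'.+1 then p [::] *: 1 + \sum_i b i * ev b N' (dl i p) else 0.

Lemma evS b N p : ev b N.+1 p = p [::] *: 1 + \sum_i b i * ev b N (dl i p).
Proof. by []. Qed.

Lemma ev_linear b N c p q : ev b N (c *: p + q) = c *: ev b N p + ev b N q.
Proof.
elim: N p q => [|N IHN] p q /=; first by rewrite scaler0 addr0.
rewrite scalerDr addrACA scalerA -scalerDl scaler_sumr -big_split /=; congr (_ + _).
apply: eq_bigr => i _.
by rewrite -[dl i _]/(c *: dl i p + dl i q) IHN mulrDr scalerAr.
Qed.

Lemma evD b N p q : ev b N (p + q) = ev b N p + ev b N q.
Proof. by rewrite -[p]scale1r ev_linear !scale1r. Qed.
Lemma ev0 b N : ev b N 0 = 0.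
Proof. by apply: (addrI (ev b N 0)); rewrite -evD !addr0. Qed.
Lemma evZ b N c p : ev b N (c *: p) = c *: ev b N p.
Proof. by rewrite -[c *: p]addr0 ev_linear ev0 addr0. Qed.
Lemma evN b N p : ev b N (- p) = - ev b N p.
Proof. by rewrite -scaleN1r evZ scaleN1r. Qed.
Lemma ev1 b N : ev b N.+1 1 = 1.
Proof. by rewrite evS scale1r big1 ?addr0 // => i _; rewrite dl1 ev0 mulr0. Qed.

Lemma ev_wlet b N i : ev b N.+2 (wlet i) = b i.
Proof.
rewrite evS scale0r add0r (bigD1 i) // big1 => [|j ji].
  rewrite (_ : dl i (wlet i) = 1); last first.
    by apply: wser_eq => -[|a w]; rewrite /dl /wlet /letter eqseq_cons eqxx.
  by rewrite ev1 mulr1; exact: addr0.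
rewrite (_ : dl j (wlet i) = 0) ?ev0 ?mulr0 //.
by apply: wser_eq => w; rewrite /dl /wlet /letter eqseq_cons (negPf ji).
Qed.

Variable b : 'I_n -> B.
Hypothesis b1 : forall i, Fl 1 (b i).

Lemma ev_ord N k p : word_ord k p -> Fl k (ev b N p).
Proof.
elim: N k p => [|N IHN] [|k] p kp //.
rewrite evS kp // scale0r add0r; apply: Fl_sum => i; rewrite -add1n.
by apply: FlM => //; apply: IHN => w wk; apply: kp.
Qed.

Lemma ev_step N q : Fl N (ev b N.+1 q - ev b N q).
Proof.
elim: N q => [|N IHN] q; first exact: FlT.
rewrite evS [ev b N.+1 q]evS opprD addrACA subrr add0r -sumrB; apply: Fl_sum => i.
by rewrite -mulrBr -add1n; apply: FlM.
Qed.

(** The two sides differ only by words of length at least N, and every letter evaluates into Fl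
    1. *)
Lemma ev_mul N p q : Fl N (ev b N (p * q) - ev b N p * ev b N q).
Proof.
elim: N p q => [|N IHN] p q; first exact: FlT.
have -> : ev b N.+1 (p * q) - ev b N.+1 p * ev b N.+1 q =
  \sum_i b i * ((ev b N (dl i p * q) - ev b N (dl i p) * ev b N q) -
     ev b N (dl i p) * (ev b N.+1 q - ev b N q)).
  have E i : ev b N (dl i (p * q)) = ev b N (dl i p * q) + p [::] *: ev b N (dl i q).
    by rewrite addrC -ev_linear addrC; congr ev.
  have -> : ev b N.+1 (p * q) = (p [::] * q [::]) *: 1 +
      (\sum_i b i * ev b N (dl i p * q) + \sum_i p [::] *: (b i * ev b N (dl i q))).
    rewrite evS -big_split; congr (_ + _); apply: eq_bigr => i _.
    by rewrite E mulrDr -scalerAr.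
  have -> : ev b N.+1 p * ev b N.+1 q = (p [::] * q [::]) *: 1 +
      (\sum_i b i * (ev b N (dl i p) * ev b N.+1 q) +
       \sum_i p [::] *: (b i * ev b N (dl i q))).
    rewrite [ev b N.+1 p]evS mulrDl -scalerAl mul1r {1}evS scalerDr scalerA -addrA.
    congr (_ + _); rewrite addrC mulr_suml -scaler_sumr; congr (_ + _).
    by apply: eq_bigr => i _; rewrite mulrA.
  rewrite [X in X - _]addrC addrKA [X in _ - X]addrC addrKA -sumrB.
  apply: eq_bigr => i _; rewrite -mulrBr; congr (_ * _).
  by rewrite mulrBr opprB addrA subrK.
apply: Fl_sum => i; rewrite -add1n; apply: FlM => //; apply: FlB => //.
by apply: Fl_mull; exact: ev_step.
Qed.

(** By telescoping, each word of length at least k acquires one factor b_i - b'_i in Fl 2 in place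
    of a factor in Fl 1. *)
Lemma ev_congr (b' : 'I_n -> B) N k p : (forall i, Fl 2 (b i - b' i)) -> word_ord k p ->
  Fl k.+1 (ev b N p - ev b' N p).
Proof.
move=> bb; elim: N k p => [|N IHN] k p kp; first by rewrite subrr.
rewrite !evS opprD addrACA subrr add0r -sumrB; apply: Fl_sum => i.
have -> : b i * ev b N (dl i p) - b' i * ev b' N (dl i p) =
  (b i - b' i) * ev b N (dl i p) + b' i * (ev b N (dl i p) - ev b' N (dl i p)).
  by rewrite mulrBl mulrBr addrA subrK.
have b'1 : Fl 1 (b' i).
  by rewrite -[b' i](subKr (b i)); apply: FlB => //; exact/Fl_desc/bb.
have kp' : word_ord k.-1 (dl i p) by case: k kp => // k kp w wk; apply: kp.
apply: FlD.
  apply: (@Fl_le _ (2 + k.-1)); last by apply: FlM => //; exact: ev_ord.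
  by case: (k).
apply: (@Fl_le _ (1 + k.-1.+1)); last by apply: FlM => //; exact: IHN.
by case: (k).
Qed.

Fixpoint abr_rec (a : B) (w : seq 'I_n) : B :=
  if w is l :: v then abr_rec (a * b l - b l * a) v else a.

(** Brackets go to commutators up to the error of [ev_mul]. A truncation length of at least 2 lets
    single letters be evaluated exactly. *)
Lemma ev_lbr N i w : Fl N.+2 (ev b N.+2 (lbr (@wlet n) i w) - abr_rec (b i) w).
Proof.
rewrite /lbr; have : Fl N.+2 (ev b N.+2 (wlet i) - b i) by rewrite ev_wlet subrr.
elim: w (wlet i) (b i) => [|l w IHw] p a pa //=; apply: IHw.
have pX := ev_mul N.+2 p (wlet l); have Xp := ev_mul N.+2 (wlet l) p.
have -> : ev b N.+2 (lie p (wlet l)) - (a * b l - b l * a) =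
    (ev b N.+2 (p * wlet l) - a * b l) - (ev b N.+2 (wlet l * p) - b l * a).
  by rewrite wlieE evD evN !opprD !opprK addrACA.
rewrite ev_wlet in pX Xp; apply: FlB.
  by apply: (Fl_trans pX); rewrite -mulrBl; exact: Fl_mulr.
by apply: (Fl_trans Xp); rewrite -mulrBr; exact: Fl_mull.
Qed.

End Evaluation.

(** * The Magnus expansion: faithfulness and leading forms *)

Section Magnus.
Variables (n : nat) (F : groupType) (x : 'I_n -> F).
Hypothesis F_free : free_on x.
Local Notation P := (wser 'I_n rat).

Definition geoser : wser unit rat := fun w => (-1) ^+ size w.

Lemma geoserK : (1 + letter tt 1) * geoser = 1.
Proof.
rewrite mulrDl mul1r; apply: wser_eq => -[|[] w]; rewrite wserDE.
  by rewrite letter_mul_nil addr0.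
by rewrite letter_mul_cons eqxx mul1r /geoser /= exprS mulN1r addNr.
Qed.

Lemma wpowD a (c d : wser unit rat) : wpow a (c + d) = wpow a c + wpow a d :> P.
Proof. by apply: wser_eq => w; rewrite wserDE /wpow; case: ifP; rewrite ?addr0. Qed.

Lemma wpow_mag i : wpow i (1 + letter tt 1) = 1 + wlet i :> P.
Proof. by rewrite wpowD wpow1 wpow_letter. Qed.

Lemma magnus_exists : exists mu : F -> P, [/\ mu 1%g = 1,
  forall g h, mu (g * h)%g = mu g * mu h, forall i, mu (x i) = 1 + wlet i &
  forall i, mu (x i)^-1%g = wpow i geoser].
Proof.
apply: (free_unit F_free) => i; rewrite -wpow_mag -wpowM ?geoserK ?wpow1 //.
by rewrite mulrC geoserK wpow1.
Qed.

Variable mu : F -> P.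
Hypotheses (mu1 : mu 1%g = 1) (muM : forall g h, mu (g * h)%g = mu g * mu h).
Hypotheses (mux : forall i, mu (x i) = 1 + wlet i).
Hypothesis muV : forall i, mu (x i)^-1%g = wpow i geoser.

Lemma mag_nil g : mu g [::] = 1.
Proof.
elim/(free_ind F_free): g => [|i g E|i g E]; first by rewrite mu1.
  by rewrite muM wmulE_nil E mux wserDE mulr1.
by rewrite muM wmulE_nil E muV mulr1.
Qed.

Lemma mag_ord1 g : word_ord 1 (mu g - 1).
Proof. by case=> // _; rewrite wserDE wserNE mag_nil subrr. Qed.

Section Faithful.
Local Open Scope group_scope.

(* The syllable (i, (e, k)) stands for x_i^(k+1), or for its inverse if e holds. *)
Definition syl (s : 'I_n * (bool * nat)) : F :=
  if s.2.1 then (x s.1)^-1 ^+ s.2.2.+1 else x s.1 ^+ s.2.2.+1.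

Definition sylprod (ss : seq ('I_n * (bool * nat))) : F :=
  foldr (fun s g => syl s * g) 1 ss.

Definition no_rep (w : seq 'I_n) := sorted (fun a b => a != b) w.

Lemma syl_mul i (e : bool) ss : no_rep (map fst ss) ->
  exists ss', no_rep (map fst ss') /\
    (if e then (x i)^-1 else x i) * sylprod ss = sylprod ss'.
Proof.
case: ss => [|[j [b k]] ss] ssP.
  by exists [:: (i, (e, 0%N))]; split=> //=; rewrite /syl /=; case: e; rewrite ?expg1.
have [ij|ij] := eqVneq i j; last first.
  exists [:: (i, (e, 0%N)), (j, (b, k)) & ss]; split; first by rewrite /= ij.
  by rewrite /syl /=; case: e; rewrite ?expg1.
rewrite {}ij in ssP *; have [eb|eb] := eqVneq e b.
  exists ((j, (b, k.+1)) :: ss); split=> //; rewrite /= {}eb mulgA; congr (_ * _).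
  by rewrite /syl /=; case: b {ssP}; rewrite [RHS]expgS.
have K a : (if e then a^-1 else a) * (if b then a^-1 else a) = 1 :> F.
  by case: e b eb {ssP} => [] [] // _; rewrite ?mulVg ?mulgV.
have sE a m : syl (a, (b, m)) = (if b then (x a)^-1 else x a) ^+ m.+1.
  by rewrite /syl /=; case: b {ssP eb K}.
case: k ssP => [|k] ssP.
  exists ss; split; first exact: path_sorted ssP.
  by rewrite /= sE expg1 mulgA K mul1g.
exists ((j, (b, k)) :: ss); split=> //.
by rewrite /= !sE (expgS _ k.+1) !mulgA K mul1g.
Qed.

Lemma sylprod_surj g : exists ss, no_rep (map fst ss) /\ g = sylprod ss.
Proof.
elim/(free_ind F_free): g => [|i g [ss [ssP ->]]|i g [ss [ssP ->]]].
- by exists [::].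
- by have [ss' [ssP' E]] := syl_mul i false ssP; exists ss'.
- by have [ss' [ssP' E]] := syl_mul i true ssP; exists ss'.
Qed.

End Faithful.

(** A syllable maps to a power (1 + X_i)^e with e <> 0, whose linear coefficient e is nonzero in
    characteristic 0. *)
Lemma mag_syl s : exists c : wser unit rat,
  [/\ mu (syl s) = wpow s.1 c, c [::] = 1 & c [:: tt] != 0].
Proof.
case: s => i [b k]; rewrite /syl /=.
pose u : wser unit rat := if b then geoser else 1 + letter tt 1.
pose d : rat := if b then -1 else 1.
have -> : (if b then ((x i)^-1 ^+ k.+1)%g else (x i ^+ k.+1)%g) =
   ((if b then (x i)^-1 else x i) ^+ k.+1)%g by case: (b).
have uE : mu (if b then (x i)^-1%g else x i) = wpow i u.
  by rewrite /u; case: (b); rewrite ?muV ?mux ?wpow_mag.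
have u0 : u [::] = 1 by rewrite /u; case: (b).
have u1 : u [:: tt] = d by rewrite /u /d; case: (b).
suff [c [cE c0 c1]] : exists c : wser unit rat,
    [/\ mu ((if b then (x i)^-1 else x i) ^+ k.+1)%g = wpow i c, c [::] = 1 &
        c [:: tt] = d *+ k.+1].
  exists c; split=> //; rewrite c1 -mulr_natr mulf_neq0 ?Num.Theory.pnatr_eq0 //.
  by rewrite /d; case: (b).
elim: k => [|k [c [cE c0 c1]]]; first by exists u; rewrite expg1.
exists (u * c); split.
- by rewrite expgS muM uE cE wpowM.
- by rewrite wmulE_nil u0 c0 mulr1.
- by rewrite wmulE_cons wmulE_nil u0 c0 c1 mul1r mulr1 /dl u1 [RHS]mulrS.
Qed.

(** The word w does not start with i, so only the constant term of the first factor contributes. *)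
Lemma wpow_mul_sep i c (f : P) w : no_rep (i :: w) -> (wpow i c * f) w = c [::] * f w.
Proof.
case: w => [|a w] iw; first by rewrite wmulE_nil.
rewrite wmulE_cons wpow_dl; have /negPf -> : a != i by move: iw; rewrite /= eq_sym => /andP[].
by rewrite mul0r add0r.
Qed.

(* The longest repetition-free word in the expansion of a reduced product of
   syllables is the word of its generators; its coefficient is the product of the
   exponents. *)
Lemma mag_sylprod ss : no_rep (map fst ss) ->
  (forall w, no_rep w -> (size ss < size w)%N -> mu (sylprod ss) w = 0) /\
  mu (sylprod ss) (map fst ss) != 0.
Proof.
elim: ss => [|s ss IHss] ssP.
  by rewrite /= mu1; split=> // -[].
have [IH0 IH1] := IHss (path_sorted ssP); have [c [sE c0 c1]] := mag_syl s.
rewrite /= muM sE; split=> [[//|a w] aw sw|].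
  rewrite wmulE_cons [wpow _ _ [::]]c0 mul1r wpow_dl (IH0 (a :: w)) ?addr0 //; last first.
    exact: ltn_trans (ltnSn _) sw.
  case: eqP => [ai|]; last by rewrite mul0r.
  rewrite wpow_mul_sep -?ai // IH0 ?mulr0 //; exact: path_sorted aw.
rewrite wmulE_cons [wpow _ _ [::]]c0 mul1r wpow_dl eqxx wpow_mul_sep //.
rewrite (IH0 (s.1 :: _)) ?addr0 ?mulf_neq0 //.
by rewrite /= size_map.
Qed.

Lemma mag_faithful g : g <> 1%g -> mu g != 1.
Proof.
have [[|s ss] [ssP ->]] := sylprod_surj g; first by case.
move=> _; apply: contra_neq (mag_sylprod ssP).2 => ->; by [].
Qed.

Lemma mag_leading g : g <> 1%g -> exists k, [/\ (0 < k)%N,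
  word_ord k (mu g - 1) & wcomp k (mu g - 1) != 0].
Proof.
move=> /mag_faithful g1.
have [w gw] : exists w, (mu g - 1) w != 0.
  apply: contrapT => H; move/eqP: g1; apply; apply/eqP; rewrite -subr_eq0.
  apply/eqP/wser_eq => w; apply/eqP; apply: contrapT => /negP gw; apply: H.
  by exists w.
pose S k := `[< exists w, size w = k /\ (mu g - 1) w != 0 >].
have Sw : exists k, S k by exists (size w); apply/asboolP; exists w.
have [k /asboolP[v [vk gv]] k_min] := ex_minnP Sw.
have gk : word_ord k (mu g - 1).
  move=> u; apply: contraTeq => gu; rewrite -leqNgt; apply: k_min.
  by apply/asboolP; exists u.
exists k; split=> //.
  rewrite lt0n; apply/eqP => k0; move: gv; rewrite mag_ord1 ?eqxx //.
  by rewrite vk k0.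
apply: contra_neq gv => /(congr1 (fun p : P => p v)).
by rewrite /wcomp vk eqxx.
Qed.

Section EvGroup.
Variables (B : algType rat) (Fl : nat -> set B).
Hypotheses (FlT : forall a, Fl 0%N a) (Fl0 : forall k, Fl k 0).
Hypothesis FlL : forall k (c : rat) a b, Fl k a -> Fl k b -> Fl k (c *: a + b).
Hypothesis FlM : forall i j a b, Fl i a -> Fl j b -> Fl (i + j)%N (a * b).
Variable gam : F -> B.
Hypotheses (gam1 : gam 1%g = 1) (gamM : forall g h, gam (g * h)%g = gam g * gam h).
Hypothesis gamx : forall i, Fl 1 (gam (x i) - 1).

(** Substituting gam(x_i) - 1 for X_i undoes 1 + X_i on generators, hence turns the expansion of g
    back into gam g. It serves both for QG and for the series ring itself. *)
Lemma ev_group N g : Fl N.+2 (ev (fun i => gam (x i) - 1) N.+2 (mu g) - gam g).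
Proof.
set b := fun i => _; set e := ev b N.+2.
have step h k : Fl N.+2 (e (mu k) - gam k) -> Fl N.+2 (e (mu h * mu k) - e (mu h) * gam k).
  move=> ek; apply: (Fl_trans FlL (ev_mul FlT Fl0 FlL FlM _ N.+2 (mu h) (mu k))) => //.
  by rewrite -mulrBr; apply: (Fl_mull FlT FlM).
have ex i : e (mu (x i)) = gam (x i).
  by rewrite /e mux evD ev1 ev_wlet addrC subrK.
elim/(free_ind F_free): g => [|i g IHg|i g IHg].
- by rewrite mu1 gam1 /e ev1 subrr; exact: Fl0.
- by rewrite muM gamM -ex; exact: step.
(* The expansion of x_i^-1 is infinite; multiplying by x_i reduces this case to that of x_i, and
   gam(x_i) is then cancelled as a unit. *)
have := ev_mul FlT Fl0 FlL FlM gamx N.+2 (mu (x i)) (mu ((x i)^-1 * g)%g).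
rewrite -/b -/e ex -muM mulVKg => E.
have Vx : gam (x i)^-1%g * gam (x i) = 1 by rewrite -gamM mulVg.
rewrite -[e _]mul1r -Vx gamM -mulrA -mulrBr; apply: (Fl_mull FlT FlM).
rewrite -opprB; apply: (FlN Fl0 FlL).
apply: (Fl_trans FlL) E; rewrite -opprB; exact: (FlN Fl0 FlL).
Qed.

End EvGroup.

Lemma wsum_app I (s : seq I) (f : I -> P) w : (\sum_(i <- s) f i) w = \sum_(i <- s) f i w.
Proof. by apply: (big_morph (fun p : P => p w)) => // p q; exact: wserDE. Qed.

Lemma ev_id N (p : P) : word_ord N (ev (@wlet n) N p - p).
Proof.
move=> w; rewrite wserDE wserNE => wN; apply/eqP; rewrite subr_eq0; apply/eqP.
elim: N w p wN => [|N IHN] [|a w] p wN //; rewrite evS wserDE wsum_app.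
  by rewrite big1 => [|i _]; rewrite ?letter_mul_nil // wserZE mulr1 addr0.
rewrite (bigD1 a) // big1 => [|i ia]; last by rewrite letter_mul_cons eq_sym (negPf ia).
rewrite letter_mul_cons eqxx mul1r wserZE mulr0 add0r IHN //; exact: addr0.
Qed.

Lemma word_ordZ k (c : rat) (p : P) : word_ord k p -> word_ord k (c *: p).
Proof. by move=> kp w wk; rewrite wserZE kp // mulr0. Qed.

Lemma word_ordL k (c : rat) (p q : P) : word_ord k p -> word_ord k q -> word_ord k (c *: p + q).
Proof. by move=> kp kq; apply/word_ordD/kq/word_ordZ. Qed.

(* The substitution X_i |-> exp X_i - 1 does not change leading forms, and for the
   exponential expansion lie_leading applies. *)
Lemma magnus_lie g k : word_ord k (mu g - 1) -> lieS k (wcomp k (mu g - 1)).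
Proof.
move=> gk; have ordT (p : P) : word_ord 0 p by exact: word_ordT.
have uv i : wexp 1 i * wexp (-1) i = 1 :> P by rewrite -wexpD subrr wexp0.
have vu i : wexp (-1) i * wexp 1 i = 1 :> P by rewrite -wexpD addNr wexp0.
have [nu [nu1 nuM nux nuV]] := free_unit F_free uv vu.
have nux1 i : word_ord 1 (nu (x i) - 1).
  by case=> // _; rewrite wserDE wserNE nux wexp_nil subrr.
have nux2 i : word_ord 2 ((nu (x i) - 1) - wlet i).
  case=> [|a []] // _; rewrite !(wserDE, wserNE) nux ?wexp_nil ?subrr ?subr0 //.
  rewrite /wlet /letter eqseq_cons andbT /wexp /wpow /= andbT.
  by case: eqP => _; rewrite ?subrr // /expser /= expr1 mulr1 subrr.
(* Evaluation in the series ring: nu g is, up to high order, mu g with exp X_i - 1 substituted for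
   X_i, and exp X_i - 1 agrees with X_i up to order 2. *)
have := @ev_group _ _ ordT (@word_ord0 _ _) word_ordL (@word_ordM _ _) nu nu1 nuM nux1 k g.
set b := fun i => _; rewrite -{1}(subrK 1 (mu g)) evD ev1.
set p := mu g - 1 => bk.
have alg (E W q h : P) : h - 1 - q = - (E + 1 - h) + ((E - W) + (W - q)).
  by rewrite (addrA (E - W)) subrK opprB [E + 1]addrC opprD !addrA subrK.
have pk : word_ord k.+1 (nu g - 1 - p).
  have le2 (q : P) : word_ord k.+2 q -> word_ord k.+1 q by exact: word_ord_le.
  have -> : nu g - 1 - p = - (ev b k.+2 p + 1 - nu g) +
      ((ev b k.+2 p - ev (@wlet n) k.+2 p) + (ev (@wlet n) k.+2 p - p)).
    exact: alg.
  apply: word_ordD; first by apply/word_ordN/le2.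
  apply: word_ordD; last exact/le2/ev_id.
  apply: (@ev_congr _ _ _ ordT (@word_ord0 _ _) word_ordL (@word_ordM _ _)) => //.
  by move=> j q; apply: word_ord_le.
have -> : wcomp k p = wcomp k (nu g - 1).
  by rewrite -[nu g - 1](subrK p) (wcompD k (nu g - 1 - p)) (wcomp_ord pk) [RHS]add0r.
apply: (lie_leading F_free nu1 nuM nux nuV).
rewrite -[nu g - 1](subrK p); apply: word_ordD => //; exact: word_ord_le pk.
Qed.

End Magnus.

(** * Logarithms in the Malcev Lie algebra *)

Section BinomialPolynomial.

Definition binpoly (j : nat) : {poly rat} := (j`!%:R)^-1 *: \prod_(i < j) ('X - (i%:R)%:P).

Lemma binpolyE j m : (binpoly j).[m%:R] = 'C(m, j)%:R.
Proof.
rewrite /binpoly hornerZ horner_prod.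
have -> : \prod_(i < j) ('X - (i%:R)%:P).[m%:R] = (m ^_ j)%:R :> rat.
  elim: j => [|j IHj]; first by rewrite big_ord0.
  rewrite big_ord_recr /= IHj ffactnSr natrM !hornerE; have [jm|mj] := leqP j m.
    by rewrite natrB.
  by rewrite ffact_small // !mul0r.
rewrite -bin_ffact natrM mulrCA mulVf ?mulr1 //.
by rewrite Num.Theory.pnatr_eq0 -lt0n fact_gt0.
Qed.

Lemma size_binpoly j : (size (binpoly j) <= j.+1)%N.
Proof.
apply: leq_trans (size_scale_leq _ _) _.
by rewrite size_prod_XsubC; rewrite /index_enum -enumT size_enum_ord.
Qed.

Lemma binpoly0 : binpoly 0 = 1.
Proof. by rewrite /binpoly big_ord0 invr1 scale1r. Qed.

Lemma binpolyS0 j : (binpoly j.+1)`_0 = 0.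
Proof. by rewrite -horner_coef0 -[0 in X in X = _]/(0%:R) binpolyE. Qed.

(* Coefficient of a^j in log(1 + a): log(1 + a) is the coefficient of m in (1 + a)^m,
   whose expansion has polynomial coefficients in m. *)
Definition logc (j : nat) : rat := (binpoly j)`_1.

Lemma logc0 : logc 0 = 0.
Proof. by rewrite /logc binpoly0 coef1. Qed.

Lemma logc1 : logc 1 = 1.
Proof. by rewrite /logc /binpoly big_ord1 subr0 invr1 scale1r coefX. Qed.

(** Leibniz rule for the linear coefficient: the constant term of [binpoly j] is 1 for j = 0 and 0
    otherwise. *)
Lemma logcM i j : (binpoly i * binpoly j)`_1 = (if j == 0%N then logc i else 0) + (if i == 0%N then logc j else 0).
Proof.
case: i j => [|i] [|j]; rewrite ?binpoly0 ?mul1r ?mulr1 ?addr0 ?add0r //=.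
- by rewrite coef1 logc0 addr0.
- by rewrite coefM big_ord_recr big_ord1 /= !binpolyS0 mul0r mulr0 addr0.
Qed.

(* Polynomial identities in m are tested on natural numbers, which makes log_add a
   consequence of ((1 + A) (1 + C))^m = (1 + A)^m (1 + C)^m. *)
Lemma coef1_functional M : exists q : 'I_M -> rat, forall p : {poly rat},
  (size p <= M)%N -> \sum_m q m * p.[m%:R] = p`_1.
Proof.
(* Inverting the Vandermonde matrix of the nodes 0, .., M - 1 expresses the linear coefficient
   through the values at these nodes. *)
pose a : 'rV[rat]_M := \row_m m%:R.
have Vu : Vandermonde M a \in unitmx.
  rewrite unitmxE det_Vandermonde unitfE; apply/prodf_neq0 => i _.
  apply/prodf_neq0 => j ij; rewrite !mxE subr_eq0 Num.Theory.eqr_nat.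
  by rewrite gtn_eqF.
pose d : 'cV[rat]_M := \col_e (e == 1%N :> nat)%:R.
pose q := invmx (Vandermonde M a) *m d.
have qE (e : 'I_M) : \sum_(m < M) (m%:R ^+ e) * q m 0 = (e == 1%N :> nat)%:R.
  have := mulKVmx Vu d => /matrixP /(_ e 0); rewrite [RHS]mxE => <-.
  by rewrite [RHS]mxE; apply: eq_bigr => m _; rewrite !mxE.
exists (fun m => q m 0) => p pM.
transitivity (\sum_(e < M) p`_e * (e == 1%N :> nat)%:R).
  rewrite (eq_bigr (fun m : 'I_M => \sum_(e < M) q m 0 * (p`_e * m%:R ^+ e))); last first.
    by move=> m _; rewrite (horner_coef_wide _ pM) mulr_sumr.
  rewrite exchange_big; apply: eq_bigr => e _; rewrite -qE mulr_sumr.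
  by apply: eq_bigr => m _; rewrite mulrC -mulrA.
have [M1|M1] := ltnP 1 M.
  rewrite (bigD1 (Ordinal M1)) //= mulr1 big1 ?addr0 // => e e1.
  by rewrite -val_eqE /= in e1; rewrite (negPf e1) mulr0.
rewrite nth_default ?(leq_trans pM) // big1 // => e _.
by rewrite ltn_eqF ?mulr0 // (leq_trans (ltn_ord e)).
Qed.

End BinomialPolynomial.

Section Logarithm.
Variables (B : algType rat) (Fl : nat -> set B).
Hypotheses (FlT : forall a, Fl 0%N a) (Fl0 : forall k, Fl k 0).
Hypothesis FlL : forall k (c : rat) a b, Fl k a -> Fl k b -> Fl k (c *: a + b).
Hypothesis FlM : forall i j a b, Fl i a -> Fl j b -> Fl (i + j)%N (a * b).
Hypothesis Fl_desc : forall k a, Fl k.+1 a -> Fl k a.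

(** Truncations below degree N of log (1 + a) and, for [bins], of (1 + a)^m. *)
Definition logs N (a : B) : B := \sum_(j < N) logc j *: a ^+ j.
Definition bins N m (a : B) : B := \sum_(j < N) ('C(m, j)%:R : rat) *: a ^+ j.

Lemma Fl_exp a j : Fl 1 a -> Fl j (a ^+ j).
Proof.
move=> a1; elim: j => [|j IHj]; first exact: FlT.
by rewrite exprS -add1n; apply: FlM.
Qed.

Lemma bins_expr N m a : Fl 1 a -> Fl N ((1 + a) ^+ m - bins N m a).
Proof.
move=> a1; have -> : (1 + a) ^+ m = bins (maxn N m.+1) m a.
  rewrite exprDn_comm; last exact/commr_sym/commr1.
  rewrite /bins (big_ord_widen (maxn N m.+1)
    (fun j => 1 ^+ (m - j) * a ^+ j *+ 'C(m, j))) ?leq_maxr // big_mkcond.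
  apply: eq_bigr => j _; rewrite expr1n mul1r scaler_nat ltnS; case: leqP => // mj.
  by rewrite bin_small.
rewrite {2}/bins (big_ord_widen (maxn N m.+1)
  (fun j => ('C(m, j)%:R : rat) *: a ^+ j)) ?leq_maxl //.
rewrite [X in _ - X]big_mkcond -sumrB; apply: (Fl_sum Fl0 FlL) => j.
case: ltnP => [_|Nj]; first by rewrite subrr.
by rewrite subr0; apply: (FlZ Fl0 FlL); apply: (Fl_le Fl_desc Nj); exact: Fl_exp.
Qed.

Lemma log_add N (A C D : B) : Fl 1 A -> Fl 1 C -> Fl 1 D -> GRing.comm A C ->
  1 + D = (1 + A) * (1 + C) -> Fl N (logs N D - (logs N A + logs N C)).
Proof.
move=> A1 C1 D1 AC DE.
have E m : Fl N (bins N m D - bins N m A * bins N m C).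
  have CA : GRing.comm (1 + A) (1 + C).
    by apply: commrD; [exact: commr1 | apply: commr_sym; apply: commrD; [exact: commr1 | exact: commr_sym]].
  have := bins_expr N m D1; rewrite DE exprMn_comm // => ED.
  rewrite -opprB; apply: (FlN Fl0 FlL).
  apply: (Fl_trans FlL _ ED).
  apply: (Fl_trans FlL (b := bins N m A * (1 + C) ^+ m)).
    rewrite -mulrBr; apply: (Fl_mull FlT FlM).
    by rewrite -opprB; apply: (FlN Fl0 FlL); exact: bins_expr.
  rewrite -mulrBl; apply: (Fl_mulr FlT FlM).
  by rewrite -opprB; apply: (FlN Fl0 FlL); exact: bins_expr.
(* A product of two binomial polynomials of index below N has size at most 2N, so 2N nodes capture
   its linear coefficient. *)
have [q qE] := coef1_functional (N + N)%N.
have : Fl N (\sum_m q m *: (bins N m D - bins N m A * bins N m C)).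
  by apply: (Fl_sum Fl0 FlL) => m; apply: (FlZ Fl0 FlL).
suff -> : \sum_m q m *: (bins N m D - bins N m A * bins N m C) =
  logs N D - (logs N A + logs N C) by [].
rewrite (eq_bigr (fun m : 'I_(N + N) => q m *: bins N m D - q m *: (bins N m A * bins N m C))); last first.
  by move=> m _; rewrite scalerBr.
rewrite sumrB; congr (_ - _).
  rewrite (eq_bigr (fun m : 'I_(N + N) => \sum_(j < N) (q m * 'C(m, j)%:R) *: D ^+ j)); last first.
    by move=> m _; rewrite scaler_sumr; apply: eq_bigr => j _; rewrite scalerA.
  rewrite exchange_big; apply: eq_bigr => j _; rewrite -scaler_suml; congr (_ *: _).
  rewrite /logc -qE; last by apply: leq_trans (size_binpoly j) (leq_trans (ltn_ord j) (leq_addr _ _)).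
  by apply: eq_bigr => m _; rewrite binpolyE.
rewrite (eq_bigr (fun m : 'I_(N + N) => \sum_(i < N) \sum_(j < N)
   (q m * ('C(m, i)%:R * 'C(m, j)%:R)) *: (A ^+ i * C ^+ j))); last first.
  move=> m _; rewrite /bins mulr_suml scaler_sumr; apply: eq_bigr => i _.
  rewrite mulr_sumr scaler_sumr; apply: eq_bigr => j _.
  by rewrite -scalerAl -scalerAr !scalerA mulrA.
rewrite exchange_big /=.
transitivity (\sum_(i < N) \sum_(j < N) ((binpoly i * binpoly j)`_1) *: (A ^+ i * C ^+ j)).
  apply: eq_bigr => i _; rewrite exchange_big; apply: eq_bigr => j _.
  rewrite -scaler_suml; congr (_ *: _); rewrite -qE.
    by apply: eq_bigr => m _; rewrite hornerM !binpolyE.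
  apply: leq_trans (size_polyMleq _ _) _.
  apply: leq_trans (leq_pred _) (leq_add _ _).
    exact: leq_trans (size_binpoly i) (ltn_ord i).
  exact: leq_trans (size_binpoly j) (ltn_ord j).
rewrite /logs; case: (N) => [|N']; first by rewrite !big_ord0 addr0.
have z0 (V : lmodType rat) (f : 'I_N'.+1 -> V) : f ord0 =
    \sum_(j < N'.+1) if j == 0%N :> nat then f j else 0.
  rewrite (bigD1 ord0) //= big1 ?addr0 // => j j0.
  by rewrite -val_eqE /= in j0; rewrite (negPf j0).
transitivity (\sum_(i < N'.+1) \sum_(j < N'.+1)
  ((if j == 0%N :> nat then logc i *: (A ^+ i * C ^+ j) else 0) +
   (if i == 0%N :> nat then logc j *: (A ^+ i * C ^+ j) else 0))).
  apply: eq_bigr => i _; apply: eq_bigr => j _; rewrite logcM scalerDl.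
  by congr (_ + _); case: eqP; rewrite ?scale0r.
under eq_bigr do rewrite big_split /=.
rewrite big_split; congr (_ + _).
  apply: eq_bigr => i _.
  by rewrite -(z0 _ (fun j : 'I_N'.+1 => logc i *: (A ^+ i * C ^+ j))) mulr1.
rewrite exchange_big; apply: eq_bigr => j _.
by rewrite -(z0 _ (fun i : 'I_N'.+1 => logc j *: (A ^+ i * C ^+ j))) mul1r.
Qed.

End Logarithm.

Section LogMalcev.
Variable G : groupType.

Lemma augI_full (a : galg G) : augI 0 a. Proof. by []. Qed.
Lemma augI0 k : augI k (0 : galg G). Proof. by case: (@augI_submod G k). Qed.

Lemma aug_ginj1 (g : G) : augI 1 (ginj g - 1 : galg G).
Proof. by apply: augI1P; rewrite -scaleN1r augD augZ !augU mulr1 subrr. Qed.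

Lemma galgmap_logs (H : groupType) (f : G -> H) N (a : galg G) :
  {morph f : u v / (u * v)%g} -> galgmap f (logs N a) = logs N (galgmap f a).
Proof.
move=> fM; have L := galgmap_linear f.
rewrite /logs (big_morph (galgmap f) (id1 := 0) (op1 := +%R)) ?galgmap0 //; last first.
  by move=> u v; have := L 1 u v; rewrite !scale1r.
apply: eq_bigr => j _.
have -> : galgmap f (logc j *: a ^+ j) = logc j *: galgmap f (a ^+ j).
  by have := L (logc j) (a ^+ j) 0; rewrite !addr0 galgmap0 addr0.
congr (_ *: _); elim: (j : nat) => [|k IHk]; first by rewrite !expr0 galgmap1.
by rewrite !exprS (galgmapM fM) IHk.
Qed.

Lemma logs2 (B : algType rat) (a : B) : logs 2 a = a.
Proof. by rewrite /logs big_ord_recr big_ord1 /= logc0 logc1 scale0r add0r scale1r. Qed.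

Lemma log_compat (g : G) k :
  ctrans (\pi_(lquo (augF G k.+1)) (logs k.+1 (ginj g - 1))) =
  \pi_(lquo (augF G k)) (logs k (ginj g - 1)).
Proof.
rewrite ctransE; apply/filP; rewrite /logs big_ord_recr /= addrAC subrr add0r.
rewrite -[_ *: _]addr0; apply: augI_linear; last exact: augI0.
by apply: (Fl_exp augI_full (@augI_mul G)); exact: aug_ginj1.
Qed.

Definition clog (g : G) : cgalg G := compl_of (@log_compat g).

(** The coproduct of g is (g, g) = (g, 1) (1, g), a product of commuting elements, on which the
    logarithm is additive. *)
Lemma clog_primitive g : primitive (clog g).
Proof.
apply: compl_eq => k; rewrite cptD.
have E : clog g k = \pi_(lquo (augF G k)) (logs k (ginj g - 1)) by [].
rewrite (complmapE _ _ E) (complmapE _ _ E) (complmapE _ _ E) -lquo_piD.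
rewrite (galgmap_logs _ _ (@pairl_morph G)) (galgmap_logs _ _ (@pairr_morph G)).
rewrite (galgmap_logs _ _ (@diag_morph G)); apply/filP.
rewrite -!/(tensl _) -!/(tensr _) -!/(coprod _).
have one1 (f : G -> (G * G)%type) : {morph f : u v / (u * v)%g} ->
    galgmap f (ginj g - 1) = ginj (f g) - 1.
  by move=> fM; rewrite galgmapB galgmapU (galgmap1 fM).
apply: (@log_add _ (tensF G) (@tensI_full G) (@tensI0 G) (@tensI_linear G) (@tensI_mul G) (@tensI_desc G)).
- exact/tensl_fil/aug_ginj1.
- exact/tensr_fil/aug_ginj1.
- exact/coprod_fil/aug_ginj1.
- exact: tensC.
- rewrite /tensl /tensr /coprod (one1 _ (@pairl_morph G)) (one1 _ (@pairr_morph G)).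
  rewrite (one1 _ (@diag_morph G)) ![1 + (_ - 1)]addrC !subrK.
  by rewrite -ginjM; congr ginj; rewrite -[RHS]/((g * 1)%g, (1 * g)%g) mulg1 mul1g.
Qed.

Definition mlog (g : G) : malcev G := Malcev (introT (asboolP _) (clog_primitive g)).

End LogMalcev.

Section LieMorph.
Variables (n : nat) (L M : lieAlgType) (f : L -> M).
Hypothesis fM : lie_morph f.

Lemma lie_morphD u v : f (u + v) = f u + f v.
Proof. by have := fM.1 1 u v; rewrite !scale1r. Qed.
Lemma lie_morph0 : f 0 = 0.
Proof. by apply: (addrI (f 0)); rewrite -lie_morphD !addr0. Qed.
Lemma lie_morphZ c u : f (c *: u) = c *: f u.
Proof. by have := fM.1 c u 0; rewrite lie_morph0 !addr0. Qed.
Lemma lie_morphB u v : f (u - v) = f u - f v.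
Proof. by rewrite -scaleN1r lie_morphD lie_morphZ scaleN1r. Qed.
Lemma lie_morph_sum I (r : seq I) (F : I -> L) :
  f (\sum_(i <- r) F i) = \sum_(i <- r) f (F i).
Proof. by apply: (big_morph f lie_morphD lie_morph0). Qed.
Lemma lbr_morph (y : 'I_n -> L) i w : f (lbr y i w) = lbr (fun i => f (y i)) i w.
Proof.
elim/last_ind: w => [//|w l IHw]; by rewrite !lbr_rcons fM.2 IHw.
Qed.

End LieMorph.

Section LieDegree.
Variables (m : nat) (L : lieAlgType) (y : 'I_m -> L).

(** Both degrees are treated together: a bracket of total degree at most 1 has a factor of degree 0,
    which vanishes. *)
Lemma lie_deg01 k u : lie_deg y k u ->
  (k = 0%N -> u = 0) /\ (k = 1%N -> exists a : 'I_m -> rat, u = \sum_j a j *: y j).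
Proof.
elim=> {k u} [i|k|k c u v _ [u0 u1] _ [v0 v1]|i j u v _ [u0 u1] _ [v0 v1]]; split=> // k1.
- exists (fun j => (j == i)%:R); rewrite (bigD1 i) // big1 => [|j /negPf ->].
    by rewrite eqxx scale1r [RHS]addr0.
  by rewrite scale0r.
- by exists (fun=> 0); rewrite big1 // => j _; rewrite scale0r.
- by rewrite u0 // v0 // scaler0 addr0.
- have [[a ->] [b ->]] := (u1 k1, v1 k1); exists (fun j => c * a j + b j).
  rewrite scaler_sumr -big_split; apply: eq_bigr => j _.
  by rewrite scalerDl scalerA.
- by case: i k1 u0 {u1} => // k1 ->; rewrite ?lie0l.
- exists (fun=> 0); rewrite big1 => [|l _]; last by rewrite scale0r.
  case: i k1 u0 {u1} => [|i] k1 u0; first by rewrite u0 ?lie0l.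
  rewrite v0 ?lie0r //; by case: j i k1 {u0 v0 v1} => [|j] [|i].
Qed.

Definition deg1_seq (u : L) (k : nat) : L := if k == 1%N then u else 0.

Fact deg1_subproof (a : 'I_m -> rat) k : lie_deg y k (deg1_seq (\sum_j a j *: y j) k).
Proof.
rewrite /deg1_seq; case: eqP => [->|_]; last exact: lie_deg0.
elim/big_ind: _ => [|u v Du Dv|j _]; first exact: lie_deg0.
  by rewrite -[u]scale1r; exact: lie_deg_linear.
by rewrite -[_ *: _]addr0; apply: lie_deg_linear; [exact: lie_deg_gen | exact: lie_deg0].
Qed.

Definition deg1 (a : 'I_m -> rat) : degcompl y :=
  DegCompl (introT (asboolP _) (deg1_subproof a)).

Lemma degcompl_lieE (u v : degcompl y) k :
  lie u v k = \sum_(i < k.+1) lie (u i) (v (k - i)%N).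
Proof. by []. Qed.

Lemma lie_supp (V W : degcompl y) k u v :
  (forall l, V l = if l == k then u else 0) -> (forall l, W l = deg1_seq v l) ->
  forall l, lie V W l = if l == k.+1 then lie u v else 0.
Proof.
move=> Vk W1 l; rewrite degcompl_lieE.
rewrite (eq_bigr (fun i : 'I_l.+1 => if (i == k :> nat) then if l == k.+1 then lie u v else 0 else 0)).
  have [->|lk] := eqVneq l k.+1; last by rewrite big1 // => i _; case: ifP.
  have kk : (k < k.+2)%N by rewrite ltnS leqnSn.
  rewrite (bigD1 (Ordinal kk)) //= eqxx big1 ?addr0 // => i ik.
  by rewrite -val_eqE /= in ik; rewrite (negPf ik).
move=> i _; rewrite Vk; case: eqP => [->|_]; last by rewrite lie0l.
rewrite W1 /deg1_seq; have [il|li] := leqP k l.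
  rewrite -(eqn_add2l k) subnKC // addn1; by case: eqP; rewrite ?lie0r.
have /eqP -> : (l - k)%N == 0%N by rewrite subn_eq0 ltnW.
by rewrite lie0r ltn_eqF // (ltn_trans li).
Qed.

Lemma lbr_deg1 n (a : 'I_n -> 'I_m -> rat) i w l :
  lbr (fun i => deg1 (a i)) i w l =
  if l == (size w).+1 then lbr (fun i => \sum_j a i j *: y j) i w else 0.
Proof.
elim/last_ind: w l => [//|w j IHw] l; rewrite !lbr_rcons size_rcons.
exact: lie_supp.
Qed.

End LieDegree.

(** * Computing in the Malcev Lie algebra with representatives in QG *)

Section Representatives.
Variable G : groupType.
Local Notation pi k := (\pi_(lquo (augF G k))).

Lemma augF_pi0 k (a : galg G) : pi k a = 0 <-> augI k a.
Proof.
have := @filP _ (augF G) k a 0; rewrite subr0 => -[IE EI].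
by split=> [/EI | /IE].
Qed.

Lemma cpt_le (X : cgalg G) N k a : (k <= N)%N -> X N = pi N a -> X k = pi k a.
Proof.
move/subnK <-; elim: (N - k)%N => [|d IHd] //; rewrite addSn => Xa; apply: IHd.
by rewrite -(cptP X) Xa ctransE.
Qed.

Definition rep N (X : malcev G) (a : galg G) := malcev_val X N = pi N a.

Lemma rep_exists N X : exists a, rep N X a.
Proof. by exists (repr (malcev_val X N)); rewrite /rep reprK. Qed.

Lemma repL N c X Y a b : rep N X a -> rep N Y b -> rep N (c *: X + Y) (c *: a + b).
Proof.
move=> Xa Yb; rewrite /rep -[malcev_val _]/(c *: malcev_val X + malcev_val Y).
by rewrite cptD cptZ Xa Yb lquo_piD lquo_piZ.
Qed.

Lemma repZ N c X a : rep N X a -> rep N (c *: X) (c *: a).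
Proof. by move=> Xa; rewrite -[c *: X]addr0 -[c *: a]addr0; apply: repL. Qed.

Lemma repB N X Y a b : rep N X a -> rep N Y b -> rep N (X - Y) (a - b).
Proof. by move=> Xa Yb; rewrite addrC [a - b]addrC -2!scaleN1r; apply: repL. Qed.

Lemma rep_sum N I (r : seq I) (X : I -> malcev G) (a : I -> galg G) :
  (forall i, rep N (X i) (a i)) -> rep N (\sum_(i <- r) X i) (\sum_(i <- r) a i).
Proof.
move=> Xa; elim/big_rec2: _ => // i b Y _ Yb.
by rewrite -[X i]scale1r -[a i]scale1r; apply: repL.
Qed.

Lemma rep_lie N X Y a b : rep N X a -> rep N Y b -> rep N (lie X Y) (a * b - b * a).
Proof.
move=> Xa Yb; rewrite /rep.
have -> : malcev_val (lie X Y) = (-1) *: (malcev_val Y * malcev_val X) + malcev_val X * malcev_val Y.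
  by rewrite scaleN1r addrC.
rewrite cptD cptZ (cptM Xa Yb) (cptM Yb Xa) -lquo_piZ -lquo_piD.
by rewrite scaleN1r addrC.
Qed.

Lemma rep_lbr n N (X : 'I_n -> malcev G) (b : 'I_n -> galg G) i w :
  (forall i, rep N (X i) (b i)) -> rep N (lbr X i w) (abr_rec b (b i) w).
Proof.
move=> Xb; rewrite /lbr; have := Xb i; elim: w (X i) (b i) => [//|l w IHw] Y a Ya /=.
by apply: IHw; exact: rep_lie.
Qed.

Lemma rep_fil N X a : rep N X a -> malcev_fil N X <-> augI N a.
Proof. by move=> Xa; rewrite /malcev_fil /= Xa; exact: augF_pi0. Qed.

Lemma rep_le N k X a : (k <= N)%N -> rep N X a -> rep k X a.
Proof. exact: cpt_le. Qed.

End Representatives.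

(** * The relator of a 1-formal group has a nonzero quadratic part *)

Section MagnusLowerCentral.
Variables (n : nat) (F : groupType).
Local Notation P := (wser 'I_n rat).
Variable mu : F -> P.
Hypotheses (mu1 : mu 1%g = 1) (muM : forall g h, mu (g * h)%g = mu g * mu h).
Hypothesis mu_nil : forall g, word_ord 1 (mu g - 1).

Lemma mag_divE g h : mu (g * h^-1)%g - 1 = ((mu g - 1) - (mu h - 1)) * mu h^-1%g.
Proof. by rewrite opprB addrA subrK mulrBl -!muM mulgV mu1. Qed.

Lemma mag_div k g h : word_ord k (mu g - 1) -> word_ord k (mu h - 1) ->
  word_ord k (mu (g * h^-1)%g - 1).
Proof.
move=> gk hk; rewrite mag_divE -[k]addn0; apply: word_ordM; last exact: word_ordT.
by apply: word_ordD => //; apply: word_ordN.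
Qed.

(** From [g, h] = (h g)^-1 (g h): a group commutator minus 1 is a unit times the ring commutator of
    mu g - 1 and mu h - 1, so orders add. *)
Lemma mag_commE g h : mu [~ g, h]%g - 1 =
  mu (g^-1 * h^-1)%g * ((mu g - 1) * (mu h - 1) - (mu h - 1) * (mu g - 1)).
Proof.
have -> : [~ g, h]%g = (g^-1 * h^-1 * (g * h))%g by rewrite /commg /conjg !mulgA.
have one : mu (g^-1 * h^-1)%g * mu (h * g)%g = 1 by rewrite -muM -invgM mulVg mu1.
rewrite muM -[X in _ - X = _]one -mulrBr; congr (_ * _); rewrite !muM.
have E (s t : P) : (s - 1) * (t - 1) = s * t - (s + t - 1).
  by rewrite mulrBl mulrBr mulr1 mul1r -[LHS]addrA -opprD addrA.
by rewrite !E [mu h + _]addrC; move: (_ + _ - 1) => w; rewrite [in RHS]opprB addrA subrK.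
Qed.

Lemma mag_lcs k g : lcs F k.+1 g -> word_ord k.+1 (mu g - 1).
Proof.
elim: k g => [|k IHk] g; first by move=> _; exact: mu_nil.
move: g; apply: gen_min.
- by rewrite mu1 subrr; exact: word_ord0.
- by move=> g h; exact: mag_div.
move=> _ [a /IHk ak [b _ <-]]; rewrite mag_commE -[k.+2]add0n.
apply: word_ordM; first exact: word_ordT.
apply: word_ordD; first by rewrite -addn1; exact: word_ordM.
by apply: word_ordN; rewrite -add1n; exact: word_ordM.
Qed.

(** The class lives in a tensor product with Q, so its vanishing does not directly place g in the
    third term of the series; instead the quadratic part of mu is read as a linear map on gr_2. *)
Lemma mag_gcl2 g : der1 F g -> gcl 2 g = 0 -> word_ord 3 (mu g - 1).
Proof.
move=> g2 g0.
have [Phi PhiE] : exists Phi : {linear gr F 2 -> P}, forall h, lcs F 2 h ->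
    Phi (gcl 2 h) = wcomp 2 (mu h - 1).
  apply: gcl_lift => [h k h2 k2|h h3]; last by rewrite wcomp_ord //; exact: mag_lcs.
  have -> : mu (h * k)%g - 1 = (mu h - 1) + (mu k - 1) + (mu h - 1) * (mu k - 1).
    rewrite muM mulrBl mulrBr mulr1 mul1r; move: (mu h) (mu k) (mu k - 1) => u v t.
    by rewrite [RHS]addrC [u - 1 + t]addrC !addrA subrK subrK.
  rewrite wcompD [X in _ + X]wcomp_ord ?addr0 ?wcompD //.
  apply: (@word_ord_le _ _ _ (2 + 2)) => //.
  by apply: word_ordM; exact: mag_lcs.
have := PhiE _ g2; rewrite g0 linear0 => g20.
rewrite -[mu g - 1]subr0 g20; apply: wcomp_sub_ord; exact: mag_lcs.
Qed.

End MagnusLowerCentral.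

(** * A relator trivial up to order 3 contradicts 1-formality *)

Section Formality.
Variables (n : nat) (F : groupType) (x : 'I_n -> F) (r : F).
Hypothesis F_free : free_on x.
Local Notation P := (wser 'I_n rat).
Local Notation G := (one_relator r).
Variable mu : F -> P.
Hypotheses (mu1 : mu 1%g = 1) (muM : forall g h, mu (g * h)%g = mu g * mu h).
Hypotheses (mux : forall i, mu (x i) = 1 + wlet i).
Hypothesis muV : forall i, mu (x i)^-1%g = wpow i geoser.
Hypothesis r3 : word_ord 3 (mu r - 1).

Let pr (g : F) : G := \pi_(quo [set r]) g.

Let prM : {morph pr : g h / (g * h)%g}. Proof. exact: quo_morph. Qed.

(* Only defined up to order 3, where it does not depend on the representative. *)
Definition magG (u : G) : P := mu (repr u).

Lemma mag_normal g : normal_closure [set r] g -> word_ord 3 (mu g - 1).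
Proof.
move: g; apply: normal_closure_min.
- by rewrite mu1 subrr; exact: word_ord0.
- by move=> g h; exact: mag_div.
- move=> g h g3; have -> : mu (g ^ h)%g - 1 = mu h^-1%g * (mu g - 1) * mu h.
    rewrite mulrBr mulrBl mulr1 -!muM mulVg mu1; congr (mu _ - 1).
    by rewrite conjgE mulgA.
  apply: (@word_ordM _ _ 3 0); last exact: word_ordT.
  by apply: (@word_ordM _ _ 0 3) => //; exact: word_ordT.
- by move=> _ ->.
Qed.

Lemma magG_pr g : word_ord 3 (magG (pr g) - mu g).
Proof.
rewrite /magG; set h := repr _.
have /eqP/quoP hg : \pi_(quo [set r]) h = pr g by rewrite reprK.
have -> : g = (h * (h^-1 * g))%g by rewrite mulVKg.
rewrite muM -[X in X - _]mulr1 -mulrBr -opprB mulrN.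
by apply: word_ordN; apply: (@word_ordM _ _ 0 3); [exact: word_ordT | exact: mag_normal].
Qed.

Definition magQ : galg G -> P := fglift magG.

Lemma magQ_linear c u v : magQ (c *: u + v) = c *: magQ u + magQ v.
Proof. exact: fglift_linear. Qed.
Lemma magQ0 : magQ 0 = 0. Proof. exact: fglift0. Qed.
Lemma magQD u v : magQ (u + v) = magQ u + magQ v. Proof. exact: fgliftD. Qed.
Lemma magQZ c u : magQ (c *: u) = c *: magQ u. Proof. exact: fgliftZ. Qed.
Lemma magQN u : magQ (- u) = - magQ u.
Proof. by rewrite -scaleN1r magQZ scaleN1r. Qed.
Lemma magQU g : magQ (ginj g) = magG g. Proof. exact: fglift1. Qed.
Lemma magQ_sum I (s : seq I) (f : I -> galg G) :
  magQ (\sum_(i <- s) f i) = \sum_(i <- s) magQ (f i).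
Proof. exact: (big_morph magQ magQD magQ0). Qed.

Lemma magQM a b : word_ord 3 (magQ (a * b) - magQ a * magQ b).
Proof.
elim/galg_ind: a => [|c g a IHa]; first by rewrite mul0r magQ0 mul0r subr0; exact: word_ord0.
rewrite mulrDl -scalerAl !magQ_linear mulrDl -scalerAl opprD addrACA -scalerBr.
apply: word_ordL => //; elim/galg_ind: b {IHa} => [|d h b IHb].
  by rewrite mulr0 magQ0 mulr0 subr0; exact: word_ord0.
rewrite mulrDr -scalerAr !magQ_linear mulrDr -scalerAr opprD addrACA -scalerBr.
apply: word_ordL => //; rewrite -ginjM !magQU.
have -> : (g * h)%g = pr (repr g * repr h)%g by rewrite prM /pr !reprK.
by rewrite /magG -muM; exact: magG_pr.
Qed.

Lemma magQ_nil a : magQ a [::] = aug a.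
Proof.
elim/galg_ind: a => [|c g a IHa]; first by rewrite magQ0 aug0.
rewrite magQ_linear wserDE wserZE IHa augD augZ magQU augU.
by rewrite /magG (mag_nil F_free mu1 muM mux muV).
Qed.

(** Augmentation 0 means no constant term, and products add orders; [magQ] is multiplicative only up
    to order 3, whence the bound on k. *)
Lemma magQ_ord k a : (k <= 3)%N -> augI k a -> word_ord k (magQ a).
Proof.
elim: k a => [|k IHk] a k3; first by move=> _; exact: word_ordT.
elim=> [|c u v [b [d [kb d0 ->]]] _ IHv]; first by rewrite magQ0; exact: word_ord0.
rewrite magQ_linear; apply: word_ordL => //.
rewrite -(subrK (magQ b * magQ d) (magQ _)); apply: word_ordD.
  exact: word_ord_le (magQM b d).
rewrite -addn1; apply: word_ordM; first by apply: IHk => //; exact: ltnW.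
by case=> // _; rewrite magQ_nil.
Qed.

Lemma degcompl_sumE (m : nat) (L : lieAlgType) (y : 'I_m -> L) I (s : seq I)
  (g : I -> degcompl y) k : (\sum_(i <- s) g i) k = \sum_(i <- s) g i k.
Proof. exact: (big_morph (fun u : degcompl y => u k)). Qed.

Lemma wcomp_sumE k I (s : seq I) (g : I -> P) :
  wcomp k (\sum_(i <- s) g i) = \sum_(i <- s) wcomp k (g i).
Proof. by apply: (big_morph (wcomp k)) => [u v|]; [exact: wcompD | exact: wcomp_ord]. Qed.

Lemma lieS_list k (p : P) : lieS k p -> exists s : seq (rat * ('I_n * seq 'I_n)),
  all (fun t => (size t.2.2).+1 == k) s /\
  p = \sum_(t <- s) t.1 *: lbr (@wlet n) t.2.1 t.2.2.
Proof.
elim=> [|c u v [i [w [wk ->]]] _ [s [sk ->]]]; first by exists [::]; rewrite big_nil.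
by exists ((c, (i, w)) :: s); rewrite big_cons /= wk eqxx.
Qed.

Hypothesis r_neq1 : r <> 1%g.

Theorem not_formal_ord3 : ~ one_formal G.
Proof.
move=> [m [R [L [y [[yR y_univ] [f [fM [f' ff' f'f] f_fil]]]]]]].
pose e j (k : 'I_m) : rat := (k == j)%:R.
have eE j : \sum_k e j k *: y k = y j.
  rewrite (bigD1 j) //= big1 ?addr0 => [|k /negPf kj]; first by rewrite /e eqxx scale1r.
  by rewrite /e kj scale0r.
(* The generators y_j of L transported to m(G). Representatives modulo I^3 are precise enough for
   quadratic relations. *)
pose z j : malcev G := f' (deg1 y (e j)).
have fz j : f (z j) = deg1 y (e j) by exact: f'f.
have [zr zrP] := choice (fun j => rep_exists 3 (z j)).
have zr1 j : augI 1 (zr j).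
  apply/(rep_fil (rep_le (isT : (1 <= 3)%N) (zrP j)))/f_fil.
  by rewrite fz; case.
pose zeta j : P := wcomp 1 (magQ (zr j)).
have mzr j : word_ord 1 (magQ (zr j)) by apply: magQ_ord.
(* The relations hold for the z_j in m(G), hence modulo I^3 in QG; [magQ] carries them to the
   degree-2 components, which are brackets of the zeta_j. *)
have zeta_sat : lie_satisfies R (L := wser 'I_n rat) zeta.
  move=> c Rc.
  have fz0 : f (\sum_i \sum_j c i j *: lie (z i) (z j)) = 0.
    have comp i j k : lie (f (z i)) (f (z j)) k = if k == 2 then lie (y i) (y j) else 0.
      by rewrite !fz (@lie_supp _ _ _ _ _ 1 (y i) (y j)) // => l; rewrite /= /deg1_seq eE.
    rewrite (lie_morph_sum fM); apply: degcompl_eq => k; rewrite degcompl_sumE.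
    rewrite (eq_bigr (fun i => \sum_j c i j *: (if k == 2 then lie (y i) (y j) else 0))).
      case: (k == 2); first exact: yR.
      by rewrite big1 // => i _; rewrite big1 // => j _; rewrite scaler0.
    move=> i _; rewrite (lie_morph_sum fM) degcompl_sumE; apply: eq_bigr => j _.
    by rewrite (lie_morphZ fM) fM.2 -comp.
  have z0 : \sum_i \sum_j c i j *: lie (z i) (z j) = 0.
    by rewrite -[LHS]ff' fz0 -(lie_morph0 fM) ff'.
  have zz0 : rep 3 (\sum_i \sum_j c i j *: lie (z i) (z j))
      (\sum_i \sum_j c i j *: (zr i * zr j - zr j * zr i)).
    by apply: rep_sum => i; apply: rep_sum => j; apply: repZ; exact: rep_lie.
  have : augI 3 (\sum_i \sum_j c i j *: (zr i * zr j - zr j * zr i)).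
    by apply/(rep_fil zz0); rewrite z0.
  move=> /(magQ_ord (leqnn 3)) => ord3.
  rewrite -[RHS](wcomp_ord ord3) magQ_sum wcomp_sumE; apply: eq_bigr => i _.
  rewrite magQ_sum wcomp_sumE; apply: eq_bigr => j _.
  rewrite magQZ wcompZ magQD magQN; congr (_ *: _); rewrite wlieE /zeta.
  rewrite -!(@wcompM_lead _ _ 1 1) // -wcompN -wcompD; apply/eqP.
  rewrite eq_sym -subr_eq0 -wcompN -wcompD wcomp_ord //.
  have -> : magQ (zr i * zr j) - magQ (zr j * zr i) -
     (magQ (zr i) * magQ (zr j) - magQ (zr j) * magQ (zr i)) =
     (magQ (zr i * zr j) - magQ (zr i) * magQ (zr j)) -
     (magQ (zr j * zr i) - magQ (zr j) * magQ (zr i)).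
    by rewrite !opprD !opprK addrACA.
  by apply: word_ordD; [exact: magQM | apply: word_ordN; exact: magQM].
have [h [[hM hy] _]] := y_univ _ zeta zeta_sat.
pose X i := mlog (pr (x i)).
have X1 i : exists a : 'I_m -> rat, f (X i) 1%N = \sum_j a j *: y j.
  exact: (lie_deg01 (degcomplP (f (X i)) 1)).2.
have [a aE] := choice X1.
(* The degree-1 part of log x_i: homogeneous for the grading of L, and equal to log x_i modulo
   filtration 2. *)
pose v i : malcev G := \sum_j a i j *: z j.
have fv i : f (v i) = deg1 y (a i).
  rewrite (lie_morph_sum fM); apply: degcompl_eq => k; rewrite degcompl_sumE.
  rewrite (eq_bigr (fun j => a i j *: deg1_seq (y j) k)); last first.
    move=> j _; rewrite (lie_morphZ fM) fz.
    by rewrite -[LHS]/(a i j *: deg1_seq (\sum_k e j k *: y k) k) eE.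
  rewrite -[RHS]/(deg1_seq (\sum_j a i j *: y j) k) /deg1_seq; case: (k == 1%N) => //.
  by rewrite big1 // => j _; rewrite scaler0.
have vX i : malcev_fil 2 (X i - v i).
  apply/f_fil => -[|[|//]] _; rewrite (lie_morphB fM) fv.
    rewrite -[LHS]/(f (X i) 0%N - deg1 y (a i) 0%N).
    by rewrite ((lie_deg01 (degcomplP (f (X i)) 0)).1 erefl) subr0.
  by rewrite -[LHS]/(f (X i) 1%N - deg1 y (a i) 1%N) aE subrr.
have Xrep i k : rep k (X i) (logs k (ginj (pr (x i)) - 1)) by [].
pose b' i : galg G := ginj (pr (x i)) - 1.
have Xrep2 i : rep 2 (X i) (b' i) by rewrite -[b' i]logs2.
(* Modulo I^2, x_i - 1 represents log x_i and v_i, and its Magnus image starts with X_i. Hence h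
   sends the degree-1 part of log x_i to X_i. *)
have wletE i : wlet i = \sum_j a i j *: zeta j :> P.
  have vrep : rep 2 (v i) (\sum_j a i j *: zr j).
    by apply: rep_sum => j; apply: repZ; apply: rep_le (zrP j).
  have /(rep_fil (repB (Xrep2 i) vrep)) := vX i.
  move=> /(@magQ_ord 2 _ isT) /wcomp_ord /eqP.
  rewrite magQD magQN wcompD wcompN subr_eq0 magQ_sum wcomp_sumE => /eqP E.
  transitivity (wcomp 1 (magQ (b' i))); last first.
    by rewrite E; apply: eq_bigr => j _; rewrite magQZ wcompZ.
  have -> : wlet i = wcomp 1 (mu (x i) - mu 1%g).
    rewrite mux mu1 addrC addKr lieS_deg //.
    by apply: lspan_mem; exists i, [::].
  have pr1 : (1 : galg G) = ginj (pr 1) by [].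
  rewrite /b' pr1 magQD magQN !magQU; apply/esym/eqP.
  rewrite -subr_eq0 -wcompN -wcompD wcomp_ord //.
  have -> : magG (pr (x i)) - magG (pr 1) - (mu (x i) - mu 1%g) =
    (magG (pr (x i)) - mu (x i)) - (magG (pr 1) - mu 1%g).
    by rewrite !opprD !opprK addrACA.
  apply: (@word_ord_le _ _ _ 3) => //; apply: word_ordD; first exact: magG_pr.
  by apply: word_ordN; exact: magG_pr.
have [[|k] [k0 rk rho0]] := mag_leading F_free mu1 muM mux muV r_neq1 => //.
have := magnus_lie F_free mu1 muM mux rk.
set rho := wcomp _ _ in rho0 *; move=> /lieS_list[s [sk rhoE]].
move/eqP: rho0; apply.
have huE i : h (\sum_j a i j *: y j) = wlet i.
  rewrite (lie_morph_sum hM) wletE; apply: eq_bigr => j _.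
  by rewrite (lie_morphZ hM) hy.
(* The Lie polynomial rho at the v_i. Its image under f sits in degree k + 1 alone, so filtration k
   + 2 makes it vanish, and applying h gives rho = 0. *)
pose Lam : malcev G := \sum_(t <- s) t.1 *: lbr v t.2.1 t.2.2.
suff LamF : malcev_fil k.+2 Lam.
  have /(f_fil k.+2)/(_ k.+1 (ltnSn _)) := LamF.
  rewrite (lie_morph_sum fM) degcompl_sumE => Lam0.
  have : h (\sum_(t <- s) t.1 *: lbr (fun i => \sum_j a i j *: y j) t.2.1 t.2.2) = 0.
    rewrite -(lie_morph0 hM); congr h; rewrite -[RHS]Lam0 !big_seq; apply: eq_bigr => t ts.
    rewrite (lie_morphZ fM) (lbr_morph fM).
    have -> : (fun i => f (v i)) = (fun i => deg1 y (a i)) by apply/funext.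
    by rewrite -[RHS]/(t.1 *: lbr (fun i => deg1 y (a i)) _ _ k.+1) lbr_deg1 (eqP (allP sk _ ts)) eqxx.
  rewrite (lie_morph_sum hM) rhoE => h0; rewrite -[RHS]h0; apply: eq_bigr => t _.
  rewrite (lie_morphZ hM) (lbr_morph hM); congr (_ *: lbr _ _ _).
  by apply/funext => i; rewrite huE.
(* In QG modulo I^(k+2): rho at representatives b_i of v_i agrees with rho at b'_i = x_i - 1,
   because rho has order k + 1; the latter agrees with mu r - 1 at the b'_i, which is 0 since r = 1
   in G. *)
have [b bP] := choice (fun i => rep_exists k.+2 (v i)).
have Arep : rep k.+2 Lam (\sum_(t <- s) t.1 *: abr_rec b (b t.2.1) t.2.2).
  by apply: rep_sum => t; apply: repZ; exact: rep_lbr.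
apply/(rep_fil Arep).
have aT := @augI_full G; have a0 := @augI0 G; have aL := @augI_linear G.
have aM := @augI_mul G; have aD := @augI_desc G.
have bb' i : augI 2 (b i - b' i).
  have [E _] := rep_fil (repB (Xrep2 i) (rep_le (isT : (2 <= k.+2)%N) (bP i))).
  by have /(FlN a0 aL) := E (vX i); rewrite opprB.
have b'1 i : augI 1 (b' i) by exact: aug_ginj1.
have b1 i : augI 1 (b i).
  by rewrite -(subrK (b' i) (b i)); apply: (FlD aL) => //; apply: augI_desc.
set A := \sum_(t <- s) _.
have ev_s : augI k.+2 (ev b k.+2 rho - A).
  rewrite {1}rhoE (big_morph (ev b k.+2) (evD b k.+2) (ev0 b k.+2)) /A -sumrB.
  apply: (Fl_sum a0 aL) => t; rewrite evZ -scalerBr; apply: (FlZ a0 aL).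
  exact: (ev_lbr aT a0 aL aM b1).
have ev_bb' : augI k.+2 (ev b k.+2 rho - ev b' k.+2 rho).
  by apply: (ev_congr aT a0 aL aM aD b1 _ bb'); exact: wcomp_word_ord.
have ev_r : augI k.+2 (ev b' k.+2 rho).
  have gM g1 g2 : ginj (pr (g1 * g2)%g) = ginj (pr g1) * ginj (pr g2) by rewrite prM ginjM.
  have := ev_group F_free mu1 muM mux aT a0 aL aM (gam := fun g => ginj (pr g))
    (erefl _) gM b'1 k r.
  have -> : pr r = 1%g by apply/quo_ker/normal_closure_mem.
  have -> : mu r = 1 + (rho + (mu r - 1 - rho)) by rewrite (addrC rho) subrK [RHS]addrC subrK.
  rewrite evD ev1 evD addrC addrA addNr add0r => E.
  rewrite -[ev b' k.+2 rho](addrK (ev b' k.+2 (mu r - 1 - rho))); apply: (FlB a0 aL) => //.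
  by apply: (ev_ord aT a0 aL aM b'1); exact: wcomp_sub_ord.
rewrite -[A](subKr (ev b k.+2 rho)); apply: (FlB a0 aL) => //.
by rewrite -(subrK (ev b' k.+2 rho) (ev b k.+2 rho)); apply: (FlD aL).
Qed.

End Formality.

(** * Fox derivatives *)

(* A crossed homomorphism on F is a homomorphism into the affine group, hence
   exists with prescribed values on a free basis. *)
Section AffineGroup.
Variables (R : comNzRingType) (n : nat).

Definition affgrp : Type := (ugrp R * 'rV[R]_n)%type.
HB.instance Definition _ := Choice.on affgrp.
Implicit Types a b c : affgrp.

Definition affu a : R := (val a.1).1.

Definition aff_one : affgrp := (1%g, 0).
Definition aff_mul a b : affgrp := ((a.1 * b.1)%g, a.2 + affu a *: b.2).
Definition aff_inv a : affgrp := (a.1^-1%g, - ((val a.1).2 *: a.2)).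

Let affA : associative aff_mul.
Proof.
by move=> a b c; congr pair; rewrite /= ?mulgA // scalerDr scalerA addrA.
Qed.
Let aff1 : left_id aff_one aff_mul.
Proof. by case=> a u; congr pair; rewrite /= ?mul1g // scale1r add0r. Qed.
Let affr1 : right_id aff_one aff_mul.
Proof. by case=> a u; congr pair; rewrite /= ?mulg1 // scaler0 addr0. Qed.
Let affV : left_inverse aff_one aff_inv aff_mul.
Proof. by case=> a u; congr pair; rewrite /= ?mulVg // /affu /= addNr. Qed.
Let affrV : right_inverse aff_one aff_inv aff_mul.
Proof.
by case=> a u; congr pair; rewrite /= ?mulgV // /affu /= scalerN scalerA ugK scale1r subrr.
Qed.

HB.instance Definition _ := isGroup.Build affgrp affA aff1 affr1 affV affrV.

End AffineGroup.

Lemma fox_exists (R : comNzRingType) (n : nat) (F : groupType) (x : 'I_n -> F)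
    (u v : 'I_n -> R) : free_on x -> (forall i, u i * v i = 1) ->
  exists (bar : F -> R) (D : F -> 'rV[R]_n),
    [/\ bar 1%g = 1, forall g h, bar (g * h)%g = bar g * bar h,
        forall i, bar (x i) = u i,
        forall g h, D (g * h)%g = D g + bar g *: D h &
        forall i, D (x i) = delta_mx 0 i].
Proof.
move=> F_free uv.
have yP i : ((u i, v i).1 * (u i, v i).2 == 1) && ((u i, v i).2 * (u i, v i).1 == 1).
  by rewrite /= [v i * _]mulrC uv eqxx.
have [f [[fM fx] _]] := F_free (affgrp R n) (fun i => (Ugrp (yP i), delta_mx 0 i)).
exists (fun g => affu (f g)), (fun g => (f g).2); split=> [|g h|i|g h|i].
- by rewrite (morph1g fM).
- by rewrite fM.
- by rewrite fx.
- by rewrite fM.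
- by rewrite fx.
Qed.

(** * Crossed homomorphisms along the lower central series *)

Section Cocycle.
Variables (A : comNzRingType) (F : groupType) (m : nat).
Local Notation R := (wser unit A).
Variables (bar : F -> R) (d : F -> 'rV[R]_m).
Hypotheses (bar1 : bar 1%g = 1) (barM : forall g h, bar (g * h)%g = bar g * bar h).
Hypothesis bar_nil : forall g, bar g [::] = 1.
Hypothesis dM : forall g h, d (g * h)%g = d g + bar g *: d h.

Definition rv_ord k (v : 'rV[R]_m) := forall j, word_ord k (v 0 j).
Definition cf k (f : R) : A := f (nseq k tt).

Lemma cfD k f g : cf k (f + g) = cf k f + cf k g. Proof. by []. Qed.
Lemma cfN k f : cf k (- f) = - cf k f. Proof. by []. Qed.

Lemma word_ord_cf k (f : R) : word_ord k f -> cf k f = 0 -> word_ord k.+1 f.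
Proof.
move=> fk f0 w; rewrite ltnS leq_eqVlt => /predU1P[wk|/fk //].
have -> : w = nseq k tt by rewrite -wk; elim: w {wk} => //= -[] w <-.
exact: f0.
Qed.

Lemma cf_lt i k f : word_ord k f -> (i < k)%N -> cf i f = 0.
Proof. by move=> fk ik; apply: fk; rewrite size_nseq. Qed.

Lemma cfM i j f g : word_ord i f -> word_ord j g ->
  cf (i + j) (f * g) = cf i f * cf j g.
Proof.
rewrite /cf; elim: i f => [|i IHi] f fi gj.
  case: j gj => [|j] gj; first by rewrite wmulE_nil.
  have := word_ordM (word_ordT (dl tt f)) gj (w := nseq j tt); rewrite size_nseq => dfg.
  by rewrite add0n -[nseq j.+1 tt]/(tt :: nseq j tt) wmulE_cons dfg // add0r.
rewrite addSn -[nseq (i + j).+1 tt]/(tt :: nseq (i + j) tt) wmulE_cons.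
rewrite (fi [::]) // mul0r addr0.
by rewrite IHi // => w wi; apply: fi.
Qed.

Lemma barVK g : bar g^-1%g * bar g = 1. Proof. by rewrite -barM mulVg. Qed.

Lemma bar_der1 g : der1 F g -> bar g = 1.
Proof.
move: g; apply: gen_min => // [g h g1 h1|_ [a _ [b _ <-]]].
  by rewrite barM g1 mul1r -(mulr1 (bar _)) -{1}h1 -barM mulVg.
rewrite /commg /conjg !barM [bar b^-1%g * _]mulrCA.
by rewrite (barVK b) mulr1 (barVK a).
Qed.

Lemma d1 : d 1%g = 0.
Proof.
have := dM 1%g 1%g; rewrite mulg1 bar1 scale1r => E.
by apply: (addrI (d 1%g)); rewrite addr0.
Qed.

Lemma dV g : d g^-1%g = - (bar g^-1%g *: d g).
Proof. by apply/eqP; rewrite -addr_eq0 -dM mulVg d1. Qed.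

Lemma d_div g h : d (g * h^-1)%g = d g - bar (g * h^-1)%g *: d h.
Proof. by rewrite dM dV scalerN scalerA -barM. Qed.

(** Compare the two expansions of d on h g [g, h] = g h. *)
Lemma d_comm g h : d [~ g, h]%g =
  bar (g^-1 * h^-1)%g *: ((1 - bar h) *: d g - (1 - bar g) *: d h).
Proof.
have alg (a b c e : 'rV[R]_m) : (a + b) + ((c - b) + (e - a)) = c + e.
  by rewrite (addrC a) addrACA [b + _]addrC subrK [a + _]addrC subrK.
have := dM (h * g)%g [~ g, h]%g; rewrite -commgC dM [d (h * g)%g]dM => E.
have -> : (1 - bar h) *: d g - (1 - bar g) *: d h = bar (h * g)%g *: d [~ g, h]%g.
  apply: (addrI (d h + bar h *: d g)); rewrite -E !scalerBl !scale1r opprB.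
  exact: alg.
by rewrite scalerA -barM -invgM mulVg bar1 scale1r.
Qed.

Lemma bar_ord g : word_ord 1 (1 - bar g).
Proof. by case=> // _; rewrite wserDE wserNE bar_nil subrr. Qed.

Lemma rv_ordD k v w : rv_ord k v -> rv_ord k w -> rv_ord k (v + w).
Proof. by move=> vk wk j; rewrite mxE; exact: word_ordD. Qed.
Lemma rv_ordN k v : rv_ord k v -> rv_ord k (- v).
Proof. by move=> vk j; rewrite mxE; exact: word_ordN. Qed.
Lemma rv_ordZ i j f v : word_ord i f -> rv_ord j v -> rv_ord (i + j) (f *: v).
Proof. by move=> fi vj l; rewrite mxE; exact: word_ordM. Qed.

Lemma d_lcs k g : lcs F k.+1 g -> rv_ord k (d g).
Proof.
elim: k g => [|k IHk] g; first by move=> _ j; exact: word_ordT.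
move: g; apply: gen_min.
- by rewrite d1 => j; rewrite mxE; exact: word_ord0.
- move=> g h gk hk; rewrite d_div; apply/rv_ordD/rv_ordN => //.
  by apply: (@rv_ordZ 0) => //; exact: word_ordT.
move=> _ [a ka [b _ <-]]; rewrite d_comm; apply: (@rv_ordZ 0); first exact: word_ordT.
apply: rv_ordD; first by apply: (@rv_ordZ 1); [exact: bar_ord | exact: IHk].
(* In the second term the factor 1 - bar a has order 1, which is enough for k = 0; from the derived
   subgroup on it vanishes. *)
case: k IHk ka => [|k] IHk ka.
  by apply/rv_ordN/(@rv_ordZ 1 0); [exact: bar_ord | move=> j; exact: word_ordT].
rewrite (bar_der1 (lcs_le (isT : (2 <= k.+2)%N) ka)) subrr scale0r oppr0.
by move=> j; rewrite mxE; exact: word_ord0.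
Qed.

(** The twist by bar g is invisible in the leading coefficient, so d induces an additive map in
    degree k on the term k + 1 of the series. *)
Lemma cf_dM k g h j : lcs F k.+1 g -> lcs F k.+1 h ->
  cf k (d (g * h)%g 0 j) = cf k (d g 0 j) + cf k (d h 0 j).
Proof.
move=> kg kh; rewrite dM !mxE cfD; congr (_ + _).
have := cfM (word_ordT (bar g)) (d_lcs kh j); rewrite add0n => ->.
by rewrite [cf 0 _]bar_nil mul1r.
Qed.

Lemma cf_bar_sub a b : cf 1 (bar a * (1 - bar b)) = - cf 1 (bar b).
Proof.
have := cfM (word_ordT (bar a)) (bar_ord b); rewrite add0n => ->.
by rewrite [cf 0 _]bar_nil mul1r cfD cfN add0r.
Qed.

Lemma bar_sub_ord a b : word_ord 1 (bar a * (1 - bar b)).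
Proof. by apply: (@word_ordM _ _ 0 1); [exact: word_ordT | exact: bar_ord]. Qed.

Lemma cf_d_comm k g h j : lcs F k.+2 g ->
  cf k.+2 (d [~ g, h]%g 0 j) = - (cf 1 (bar h) * cf k.+1 (d g 0 j)).
Proof.
move=> kg; have g2 : bar g = 1 by apply: bar_der1; apply: (@lcs_le _ 2 k.+2 g) kg.
rewrite d_comm g2 subrr scale0r subr0 scalerA mxE.
by rewrite -[k.+2]add1n (cfM (bar_sub_ord _ _) (d_lcs kg j)) cf_bar_sub mulNr.
Qed.

Lemma cf_d_comm1 g h j :
  cf 1 (d [~ g, h]%g 0 j) = cf 1 (bar g) * cf 0 (d h 0 j) - cf 1 (bar h) * cf 0 (d g 0 j).
Proof.
rewrite d_comm !mxE mulrBr cfD cfN !mulrA.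
have T (f : R) a b : cf 1 (bar a * (1 - bar b) * f) = - (cf 1 (bar b) * cf 0 f).
  by rewrite -{1}[1%N]addn0 (cfM (bar_sub_ord _ _) (word_ordT f)) cf_bar_sub mulNr.
by rewrite !T opprK addrC.
Qed.

End Cocycle.

(** * The Koszul complex in degree two *)

Section MonomialLift.
Variables (m : nat) (V : lmodType rat) (f : 'X_{1..m} -> V).
Local Notation A := {mpoly rat[m]}.

Definition mlift (p : A) : V := fglift f (mpoly_val p).

Fact mlift_linear : linear mlift.
Proof. by move=> c p q; rewrite /mlift !mpoly_valK fglift_linear. Qed.

HB.instance Definition _ := GRing.isLinear.Build rat A V _ mlift mlift_linear.

Lemma mliftX mon : mlift 'X_[mon] = f mon.
Proof. by rewrite /mlift unlock mpoly_valK fglift1. Qed.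

End MonomialLift.

Section Homogeneous.
Variable m : nat.
Local Notation A := {mpoly rat[m]}.

Lemma homog_linear_eq (V : lmodType rat) (f g : {linear A -> V}) d (p : A) :
  (forall mon, mdeg mon = d -> f 'X_[mon] = g 'X_[mon]) -> p \is d.-homog -> f p = g p.
Proof.
move=> fg /dhomogP pd; rewrite [p]mpolyE !linear_sum big_seq [RHS]big_seq.
by apply: eq_bigr => mon /pd mond; rewrite !linearZ fg.
Qed.

Lemma mderivXU l i : ('X_l)^`M(i) = (l == i)%:R :> A.
Proof.
rewrite mderivX mnm1E; case: eqP => [->|_]; last by rewrite scale0r.
rewrite scale1r (_ : (U_(i) - U_(i) = 0)%MM) ?mpolyX0 //.
by apply/mnmP => j; rewrite mnmBE subnn mnm0E.
Qed.

Lemma homogX_sum mon : \sum_l 'X_l * ('X_[mon])^`M(l) = (mdeg mon)%:R *: 'X_[mon] :> A.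
Proof.
rewrite mdegE natr_sum scaler_suml; apply: eq_bigr => l _.
rewrite mderivX -scalerAr -mpolyXD; have [->|ml] := eqVneq (mon l) 0%N.
  by rewrite !scale0r.
by rewrite addmC submK // lep1mP.
Qed.

Lemma euler d (p : A) : p \is d.-homog -> \sum_l 'X_l * p^`M(l) = d%:R *: p.
Proof.
move=> pd; have L1 : linear (fun p : A => \sum_l 'X_l * p^`M(l)).
  move=> c u v; rewrite scaler_sumr -big_split; apply: eq_bigr => l _.
  by rewrite linearP mulrDr -scalerAr.
have L2 : linear (fun p : A => (d%:R : rat) *: p).
  by move=> c u v; rewrite scalerDr !scalerA mulrC.
have [f fE] := linear_pack L1; have [g gE] := linear_pack L2.
rewrite -[LHS]fE -[RHS]gE; apply: homog_linear_eq pd => mon mond.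
by rewrite fE gE homogX_sum mond.
Qed.

Lemma homog_mderiv d l (p : A) : p \is d.+1.-homog -> p^`M(l) \is d.-homog.
Proof.
move=> /dhomogP pd; rewrite [p]mpolyE linear_sum big_seq.
apply: rpred_sum => mon /pd mond; rewrite linearZ /= mderivX.
have [->|ml] := eqVneq (mon l) 0%N; first by rewrite scale0r scaler0 rpred0.
have := mdegD (mon - U_(l)) U_(l); rewrite submK ?lep1mP // mdeg1 addn1 mond => -[dE].
by do 2!apply: rpredZ; rewrite dhomogX; apply/eqP.
Qed.

Lemma homog0_mderiv l (p : A) : p \is 0.-homog -> p^`M(l) = 0.
Proof.
move=> /dhomogP pd; rewrite [p]mpolyE linear_sum big_seq big1 // => mon /pd /eqP.
by rewrite mdeg_eq0 => /eqP ->; rewrite linearZ /= mderivX mnm0E scale0r scaler0.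
Qed.

(** A chosen ordering of the letters of a monomial; by [lcom_perm] the choice does not affect
    commutators. *)
Definition mword (mon : 'X_{1..m}) : seq 'I_m := flatten [seq nseq (mon l) l | l <- enum 'I_m].

Lemma count_mword mon i : count_mem i (mword mon) = mon i.
Proof.
rewrite /mword count_flatten -map_comp sumnE big_map enumT (bigD1_seq i) ?index_enum_uniq ?mem_index_enum //=.
rewrite count_nseq /= eqxx mul1n big1 ?addn0 // => l li.
by rewrite count_nseq /= (negPf li).
Qed.

Lemma mword_add l mon : perm_eq (mword (U_(l) + mon)) (l :: mword mon).
Proof.
by apply/allP => i _; rewrite /= !count_mword mnmDE mnm1E.
Qed.

Lemma size_mword mon : size (mword mon) = mdeg mon.
Proof.
rewrite /mword size_flatten /shape -map_comp sumnE big_map mdegE enumT.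
by apply: eq_bigr => i _; rewrite /= size_nseq.
Qed.

Lemma mword_mnm w : exists mon, mdeg mon = size w /\ perm_eq (mword mon) w.
Proof.
elim: w => [|l w [mon [mw pw]]].
  exists 0%MM; rewrite mdeg0; split=> //.
  by rewrite (size0nil (_ : size (mword 0%MM) = 0%N)) // size_mword mdeg0.
exists (U_(l) + mon)%MM; rewrite mdegD mdeg1 mw; split=> //.
by apply: perm_trans (mword_add l mon) _; rewrite perm_cons.
Qed.

Local Notation W := {ffun 'I_m -> A}.

(* The Koszul boundary of q e_a /\ e_b. *)
Definition kap (a b : 'I_m) (q : A) : W :=
  [ffun j => q * ('X_a *+ (j == b) - 'X_b *+ (j == a))].

Fact kap_linear a b : linear (kap a b).
Proof. by move=> c p q; apply/ffunP => j; rewrite !ffunE mulrDl scalerAl. Qed.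

HB.instance Definition _ a b := GRing.isLinear.Build rat A W _ (kap a b) (kap_linear a b).

(** One half of the double sum is (k + 1) w by Euler's formula; the other half is w, by
    differentiating the cycle condition. *)
Lemma kap_sum k (w : W) : (forall j, w j \is k.+1.-homog) -> \sum_j 'X_j * w j = 0 ->
  \sum_j \sum_l kap l j (w j)^`M(l) = k.+2%:R *: w.
Proof.
move=> wk w0; apply/ffunP => i; rewrite !ffunE.
transitivity (\sum_l 'X_l * (w i)^`M(l) - \sum_j 'X_j * (w j)^`M(i)).
  rewrite sum_ffunE; under eq_bigr do rewrite sum_ffunE.
  under eq_bigr => j _ do under eq_bigr => l _ do rewrite ffunE mulrBr !mulrnAr.
  under eq_bigr do rewrite sumrB; rewrite sumrB; congr (_ - _).
    rewrite (bigD1 i) //= [X in _ + X]big1 ?addr0 => [|j ji].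
      by apply: eq_bigr => l _; rewrite eqxx mulrC.
    by rewrite big1 // => l _; rewrite eq_sym (negPf ji).
  apply: eq_bigr => j _; rewrite (bigD1 i) //= big1 ?addr0 => [|l li].
    by rewrite eqxx mulrC.
  by rewrite eq_sym (negPf li).
rewrite (euler (wk i)); have /eqP := congr1 (mderiv i) w0.
rewrite linear0 linear_sum /=.
under eq_bigr do rewrite mderivM mderivXU.
rewrite big_split /= addr_eq0 => /eqP E.
rewrite -[X in _ - X]opprK -E opprK (bigD1 i) //= big1 ?addr0 => [|j ji].
  rewrite eqxx mul1r.
  by rewrite -[in RHS]addn1 natrD scalerDl scale1r.
by rewrite (negPf ji) mul0r.
Qed.

End Homogeneous.

(** * The contracting homotopy with values in an alternating Jacobi family *)

Section KoszulHomotopy.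
Variables (m k : nat) (V : lmodType rat).
Local Notation A := {mpoly rat[m]}.
Local Notation W := {ffun 'I_m -> A}.
Variable B : 'I_m -> 'I_m -> {linear A -> V}.
Hypothesis B_altX : forall a b mon, mdeg mon = k -> B a b 'X_[mon] = - B b a 'X_[mon].
Hypothesis B_jacX : forall a b l mon, (mdeg mon).+1 = k ->
  B a b ('X_l * 'X_[mon]) + B b l ('X_a * 'X_[mon]) + B l a ('X_b * 'X_[mon]) = 0.

Lemma zero_linear (U U' : lmodType rat) : exists z : {linear U -> U'}, z =1 fun=> 0.
Proof. by apply: linear_pack => c u v; rewrite scaler0 addr0. Qed.

Lemma brac_alt a b q : q \is k.-homog -> B a b q = - B b a q.
Proof.
have L : linear (fun q => - B b a q) by move=> c u v; rewrite linearP opprD scalerN.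
have [f fE] := linear_pack L; rewrite -fE; apply: homog_linear_eq => mon mk.
by rewrite fE B_altX.
Qed.

Lemma brac_jacobi a b l q e : e.+1 = k -> q \is e.-homog ->
  B a b ('X_l * q) + B b l ('X_a * q) + B l a ('X_b * q) = 0.
Proof.
move=> ek; have L : linear (fun q => B a b ('X_l * q) + B b l ('X_a * q) + B l a ('X_b * q)).
  move=> c u v; rewrite !mulrDr -!scalerAr !linearD !linearZ /= ?scalerDr.
  by rewrite [X in X + _ = _]addrACA [LHS]addrACA.
have [f fE] := linear_pack L; have [z zE] := zero_linear A V.
rewrite -fE -[RHS](zE q); apply: homog_linear_eq => mon mk; rewrite fE zE /=.
by apply: B_jacX; rewrite mk.
Qed.

Definition bsum (j : 'I_m) (p : A) : V := \sum_l B l j p^`M(l).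

Fact bsum_linear j : linear (bsum j).
Proof.
move=> c u v; rewrite /bsum scaler_sumr -big_split; apply: eq_bigr => l _.
by rewrite !linearP.
Qed.

HB.instance Definition _ j := GRing.isLinear.Build rat A V _ (bsum j) (bsum_linear j).

(* Inverse of kap on cycles (kap_sum): the contracting homotopy of the Koszul complex,
   with B in place of the basis e_a /\ e_b. *)
Definition theta (w : W) : V := k.+2%:R^-1 *: \sum_j bsum j (w j).

Fact theta_linear : linear theta.
Proof.
move=> c u v; rewrite /theta scalerA mulrC -scalerA -scalerDr; congr (_ *: _).
rewrite scaler_sumr -big_split; apply: eq_bigr => j _.
by rewrite !ffunE linearP.
Qed.

HB.instance Definition _ := GRing.isLinear.Build rat W V _ theta theta_linear.

Lemma bsum_mulX a b q : bsum b ('X_a * q) = B a b q + \sum_l B l b ('X_a * q^`M(l)).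
Proof.
rewrite /bsum; under eq_bigr do rewrite mderivM linearD.
rewrite big_split; congr (_ + _).
rewrite (bigD1 a) // big1 => [|l la].
  by rewrite mderivXU eqxx mul1r; exact: addr0.
by rewrite mderivXU eq_sym (negPf la) mul0r linear0.
Qed.

Lemma sum_pick (U : lmodType rat) (f : 'I_m -> U) b : \sum_j f j *+ (j == b) = f b.
Proof. by rewrite (bigD1 b) //= eqxx big1 ?addr0 // => j /negPf ->. Qed.

Lemma theta_kapE a b q : theta (kap a b q) =
  k.+2%:R^-1 *: (bsum b ('X_a * q) - bsum a ('X_b * q)).
Proof.
rewrite /theta; congr (_ *: _).
rewrite -(sum_pick (fun j => bsum j ('X_a * q))) -(sum_pick (fun j => bsum j ('X_b * q)) a).
rewrite -sumrB; apply: eq_bigr => j _.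
by rewrite ffunE mulrBr !mulrnAr linearB !linearMn /= ![q * _]mulrC.
Qed.

(** The two undifferentiated terms give 2 B a b q and, by Jacobi and Euler, the differentiated ones
    give k B a b q: hence the factor (k + 2)^-1 in [theta]. *)
Lemma theta_kap a b q : q \is k.-homog -> theta (kap a b q) = B a b q.
Proof.
move=> qk; rewrite theta_kapE !bsum_mulX opprD addrACA -sumrB -(brac_alt _ _ qk).
have -> : \sum_l (B l b ('X_a * q^`M(l)) - B l a ('X_b * q^`M(l))) = B a b (k%:R *: q).
  rewrite -(euler qk) linear_sum; apply: eq_bigr => l _.
  (* Jacobi is available only with a factor of degree k - 1; for k = 0 all derivatives vanish. *)
  have [k0|k0] := posnP k.
    by move: qk; rewrite k0 => qk; rewrite (homog0_mderiv _ qk) !mulr0 !linear0 ?addr0.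
  have qk' : q \is k.-1.+1.-homog by rewrite prednK.
  have ql := homog_mderiv l qk'.
  have qX c : 'X_c * q^`M(l) \is k.-homog.
    by rewrite -(prednK k0) -add1n; apply: dhomogM => //; rewrite dhomogX /= mdeg1.
  have /eqP := brac_jacobi a b l (prednK k0) ql.
  rewrite (@brac_alt b l _ (qX a)) -addrA addr_eq0 => /eqP E.
  by rewrite [RHS]E opprD opprK.
rewrite linearZ /= -[B a b q as X in X + X + _]scale1r -!scalerDl scalerA.
have -> : (1 + 1 + k%:R : rat) = k.+2%:R by rewrite -[k.+2]addn2 natrD addrC.
by rewrite mulVf ?scale1r // Num.Theory.pnatr_eq0.
Qed.

Lemma theta_rel (c : 'I_m -> 'I_m -> rat) q : q \is k.-homog ->
  (forall mon, mdeg mon = k -> \sum_i \sum_j c i j *: B i j 'X_[mon] = 0) ->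
  theta (\sum_i \sum_j c i j *: kap i j q) = 0.
Proof.
move=> qk rel.
have -> : theta (\sum_i \sum_j c i j *: kap i j q) = \sum_i \sum_j c i j *: B i j q.
  rewrite linear_sum; apply: eq_bigr => i _; rewrite linear_sum; apply: eq_bigr => j _.
  by rewrite linearZ /= theta_kap.
have L : linear (fun q => \sum_i \sum_j c i j *: B i j q).
  move=> d u v; rewrite scaler_sumr -big_split; apply: eq_bigr => i _.
  rewrite scaler_sumr -big_split; apply: eq_bigr => j _.
  by rewrite linearP scalerDr !scalerA mulrC.
have [f fE] := linear_pack L; have [z zE] := zero_linear A V.
rewrite -[LHS]fE -[RHS](zE q); apply: homog_linear_eq qk => mon mk.
by rewrite fE zE rel.
Qed.

Variables (V' : lmodType rat) (phi : {linear V -> V'}) (Pi : {linear W -> V'}) (s : rat).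
Hypothesis phiE : forall a b mon, mdeg mon = k ->
  phi (B a b 'X_[mon]) = s *: Pi (kap a b 'X_[mon]).

(** This bounds the kernel of theta on cycles: for s <> 0 it lies in the kernel of Pi. *)
Lemma phi_theta (w : W) : (forall j, w j \is k.+1.-homog) -> \sum_j 'X_j * w j = 0 ->
  phi (theta w) = s *: Pi w.
Proof.
move=> wk w0; have phib a b q : q \is k.-homog -> phi (B a b q) = s *: Pi (kap a b q).
  have L : linear (fun q => s *: Pi (kap a b q)).
    by move=> c u v; rewrite (linearP (kap a b)) (linearP Pi) scalerDr !scalerA mulrC.
  have [f fE] := linear_pack L; rewrite -fE -[LHS]/((phi \o B a b) q).
  by apply: homog_linear_eq => mon mk; rewrite fE /= phiE.
rewrite linearZ linear_sum /=; under eq_bigr do rewrite linear_sum.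
have -> : \sum_j \sum_l phi (B l j (w j)^`M(l)) = s *: Pi (k.+2%:R *: w).
  rewrite -(kap_sum wk w0) linear_sum scaler_sumr; apply: eq_bigr => j _.
  rewrite linear_sum scaler_sumr; apply: eq_bigr => l _.
  by rewrite phib //; exact: homog_mderiv.
by rewrite [Pi _]linearZ /= !scalerA mulrAC mulVf ?mul1r // Num.Theory.pnatr_eq0.
Qed.

End KoszulHomotopy.

Section VectorQuotient.
Variables (W : vectType rat) (V : lmodType rat) (K U : {vspace W}) (psi : {linear W -> V}).
Hypothesis UK : (U <= K)%VS.
Hypothesis psi_surj : forall v, exists2 w, w \in K & psi w = v.
Hypothesis psi_ker : forall w, w \in K -> psi w = 0 <-> w \in U.

(** A complement of U in K maps isomorphically onto V; V is only an [lmodType], so its coordinates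
    are transported along this isomorphism. *)
Lemma vector_quotient : inhabited (Vector.axiom (\dim K - \dim U) V).
Proof.
pose C := (K :\: U)%VS.
have <- : \dim C = (\dim K - \dim U)%N.
  by have := dimv_cap_compl K U; rewrite (capv_idPr UK) => <-; rewrite addKn.
have CK w : w \in C -> w \in K by exact/subvP/diffvSl.
pose g (u : subvs_of C) : V := psi (vsval u).
have gL : linear g by move=> c u v; rewrite /g !linearP.
have g_inj u : g u = 0 -> u = 0.
  move=> /psi_ker; rewrite CK ?subvsP // => /(_ isT) uU; apply: val_inj => /=.
  have : vsval u \in (C :&: U)%VS by rewrite memv_cap subvsP uU.
  by rewrite capv_diff memv0 => /eqP.
have g_surj v : exists u, g u = v.
  have [w wK <-] := psi_surj v; move: wK; rewrite -{1}(addv_diff_cap K U).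
  rewrite (capv_idPr UK) => /memv_addP[c cC [u uU ->]].
  exists (Subvs cC); rewrite /g /= linearD.
  by rewrite ((psi_ker _).2 uU) ?addr0 //; exact: (subvP UK).
have [f fE] := choice g_surj.
have gf : cancel g f.
  move=> u; apply/eqP; rewrite -subr_eq0; apply/eqP/g_inj.
  have gB : g (f (g u) - u) = g (f (g u)) - g u.
    by rewrite [f (g u) - u]addrC -[- u]scaleN1r gL scaleN1r addrC.
  by rewrite gB fE subrr.
have fL : linear f.
  by move=> c u v; apply: (can_inj gf); rewrite gL !fE.
have [v2r v2rL v2r_bij] := subvs_vect_iso C.
constructor; exists (v2r \o f); first by move=> c u v /=; rewrite fL v2rL.
by apply: bij_comp => //; exists g.
Qed.

End VectorQuotient.

(** * Dimension of the cycles modulo the multiples of a linear cycle *)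

Section KoszulDimension.
Variables (n k : nat).
Local Notation m := n.+1.
Local Notation A := {mpoly rat[m]}.
Local Notation W := {ffun 'I_m -> A}.
Local Notation S := (dhomog m rat).

Lemma homogP d (p : S d) : (p : A) \is d.-homog. Proof. by case: p. Qed.

Definition divf (w : {ffun 'I_m -> S k.+1}) : A := \sum_j 'X_j * (w j : A).

Fact divf_homog w : divf w \is k.+2.-homog.
Proof.
apply: rpred_sum => j _; rewrite -[k.+2]add1n; apply: dhomogM; last exact: homogP.
by rewrite dhomogX /= mdeg1.
Qed.

Definition divh (w : {ffun 'I_m -> S k.+1}) : S k.+2 := DHomog (divf_homog w).

Fact divh_linear : linear divh.
Proof.
move=> c u v; apply: val_inj => /=; rewrite /divf scaler_sumr -big_split.
by apply: eq_bigr => j _; rewrite !ffunE /= mulrDr scalerAr.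
Qed.
HB.instance Definition _ := GRing.isLinear.Build rat _ _ _ divh divh_linear.

Variable om : W.
Hypothesis om1 : forall j, om j \is 1.-homog.

Fact mulom_homog (q : S k) j : (q : A) * om j \is k.+1.-homog.
Proof. by rewrite -[k.+1]addn1; apply: dhomogM => //; exact: homogP. Qed.

Definition mulom (q : S k) : {ffun 'I_m -> S k.+1} := [ffun j => DHomog (mulom_homog q j)].

Fact mulom_linear : linear mulom.
Proof.
move=> c u v; apply/ffunP => j; apply: val_inj; rewrite !ffunE /=.
by rewrite mulrDl scalerAl.
Qed.
HB.instance Definition _ := GRing.isLinear.Build rat _ _ _ mulom mulom_linear.

Definition Kv : {vspace {ffun 'I_m -> S k.+1}} := lker (linfun divh).
Definition Uv : {vspace {ffun 'I_m -> S k.+1}} := limg (linfun mulom).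

Lemma mem_Kv w : (w \in Kv) = (divf w == 0).
Proof. by rewrite memv_ker lfunE /= -val_eqE. Qed.

Lemma mem_Uv w : w \in Uv <-> exists q : S k, w = mulom q.
Proof.
split=> [/memv_imgP[q _ ->]|[q ->]]; first by exists q; rewrite lfunE.
by rewrite -[mulom q]lfunE; apply: memv_img; exact: memvf.
Qed.

Lemma dim_Kv : (\dim Kv + 'C(k.+2 + n, k.+2) = m * 'C(k.+1 + n, k.+1))%N.
Proof.
have := limg_ker_dim (linfun divh) fullv; rewrite capfv dimvf.
have -> : limg (linfun divh) = fullv.
  apply/eqP; rewrite eqEsubv subvf; apply/subvP => p _.
  (* By Euler's formula the partial derivatives of p, divided by k + 2, form a preimage of p. *)
  pose f j : S k.+1 := DHomog (homog_mderiv j (homogP p)).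
  have -> : p = linfun divh (k.+2%:R^-1 *: [ffun j => f j]).
    rewrite lfunE; apply: val_inj; rewrite linearZ /= /divf.
    under eq_bigr do rewrite ffunE /=.
    by rewrite (euler (homogP p)) scalerA mulVf ?scale1r // Num.Theory.pnatr_eq0.
  exact/memv_img/memvf.
rewrite dimvf -/Kv => E.
have -> : (m * 'C(k.+1 + n, k.+1))%N = dim {ffun 'I_m -> S k.+1}.
  by rewrite -{1}[m]card_ord.
by rewrite -E.
Qed.

Lemma dim_Uv : \dim Uv = if om == 0 then 0%N else 'C(k + n, k).
Proof.
have := limg_ker_dim (linfun mulom) fullv; rewrite capfv dimvf -/Uv.
case: eqP => [om0 _|/eqP om0].
  apply/eqP; rewrite dimv_eq0 -subv0; apply/subvP => w /mem_Uv[q ->].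
  rewrite memv0; apply/eqP/ffunP => j; apply: val_inj; rewrite !ffunE /= om0 ffunE.
  by rewrite mulr0.
(* Multiplication by a nonzero component of om is injective, the polynomial ring being a domain. *)
have -> : lker (linfun mulom) = 0%VS.
  apply/eqP; rewrite -subv0; apply/subvP => q; rewrite memv_ker lfunE => /eqP q0'.
  have q0 j : mulom q j = 0 by rewrite [mulom q]q0' ffunE.
  rewrite memv0.
  have [j omj] : exists j, om j != 0.
    apply: contrapT => N; move/eqP: om0; apply; apply/ffunP => j; rewrite ffunE.
    by apply/eqP; apply: contrapT => /negP Nj; apply: N; exists j.
  have := congr1 val (q0 j); rewrite !ffunE /= => /eqP.
  by rewrite mulf_eq0 (negPf omj) orbF => /eqP q00; apply/eqP/val_inj.
by rewrite dimv0 add0n.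
Qed.

Variables (V : lmodType rat) (B : 'I_m -> 'I_m -> {linear A -> V}).
Hypothesis B_altX : forall a b mon, mdeg mon = k -> B a b 'X_[mon] = - B b a 'X_[mon].
Hypothesis B_jacX : forall a b l mon, (mdeg mon).+1 = k ->
  B a b ('X_l * 'X_[mon]) + B b l ('X_a * 'X_[mon]) + B l a ('X_b * 'X_[mon]) = 0.
Hypothesis B_span : forall v, lspan [set v | exists a b mon, mdeg mon = k /\ v = B a b 'X_[mon]] v.
Variable c : 'I_m -> 'I_m -> rat.
Hypothesis c_rel : forall mon, mdeg mon = k -> \sum_i \sum_j c i j *: B i j 'X_[mon] = 0.
Hypothesis om_c : om = \sum_i \sum_j c i j *: kap i j 1.
Local Notation Us := [set w : W | exists q, q \is k.-homog /\ w = [ffun j => q * om j]].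
Variables (phi : {linear V -> lquo Us}) (s : rat).
Hypothesis s_neq0 : s != 0.
Hypothesis phiE : forall a b mon, mdeg mon = k ->
  phi (B a b 'X_[mon]) = s *: \pi_(lquo Us) (kap a b 'X_[mon]).

Lemma kap_mul i j (q : A) l : kap i j q l = q * kap i j 1 l.
Proof. by rewrite !ffunE mul1r. Qed.

Lemma om_mul q : [ffun l => q * om l] = \sum_i \sum_j c i j *: kap i j q :> W.
Proof.
apply/ffunP => l; rewrite ffunE om_c !sum_ffunE mulr_sumr; apply: eq_bigr => i _.
rewrite !sum_ffunE mulr_sumr; apply: eq_bigr => j _.
have E (u : W) (d : rat) : (d *: u) l = d *: u l by rewrite ffunE.
by rewrite !E (kap_mul i j q) -scalerAr.
Qed.

Lemma div_kap (i j : 'I_m) (q : A) : \sum_l 'X_l * kap i j q l = 0.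
Proof.
transitivity (\sum_l (('X_l * (q * 'X_i)) *+ (l == j) - ('X_l * (q * 'X_j)) *+ (l == i))).
  by apply: eq_bigr => l _; rewrite ffunE mulrBr !mulrnAr mulrBr !mulrnAr.
rewrite sumrB !sum_pick; apply/eqP; rewrite subr_eq0; apply/eqP.
by rewrite mulrCA [X in _ = X]mulrCA [X in _ * X]mulrC.
Qed.

Definition toW (w : {ffun 'I_m -> S k.+1}) : W := [ffun j => (w j : A)].

Lemma toWE w j : toW w j = w j. Proof. by rewrite [LHS]ffunE. Qed.

Lemma divf_toW w : divf w = \sum_j 'X_j * toW w j.
Proof. by apply: eq_bigr => j _; rewrite toWE. Qed.

Lemma toW_mulom q : toW (mulom q) = [ffun l => (q : A) * om l].
Proof. by apply/ffunP => j; rewrite !ffunE. Qed.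

Theorem koszul_dim : exists d, inhabited (Vector.axiom d V) /\
  d%:R = m%:R * 'C(k.+1 + n, k.+1)%:R - 'C(k.+2 + n, k.+2)%:R
    - (if om == 0 then 0 else 'C(k + n, k)%:R) :> rat.
Proof.
have toWL : linear toW by move=> d u v; apply/ffunP => j; rewrite !ffunE.
have [psi psiE] : exists psi : {linear {ffun 'I_m -> S k.+1} -> V},
    psi =1 fun w => @theta _ k _ B (toW w).
  by apply: linear_pack => d u v; rewrite toWL linearP.
have UK : (Uv <= Kv)%VS.
  apply/subvP => w /mem_Uv[q ->]; rewrite mem_Kv; apply/eqP.
  rewrite divf_toW toW_mulom om_mul.
  transitivity (\sum_l \sum_i \sum_j c i j *: ('X_l * kap i j (val q) l)).
    apply: eq_bigr => l _; rewrite sum_ffunE mulr_sumr; apply: eq_bigr => i _.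
    rewrite sum_ffunE mulr_sumr; apply: eq_bigr => j _.
    by rewrite [in LHS]ffunE -/(kap i j _) scalerAr.
  rewrite exchange_big big1 // => i _; rewrite exchange_big big1 // => j _.
  by rewrite -scaler_sumr div_kap scaler0.
exists (\dim Kv - \dim Uv)%N; split; last first.
  rewrite natrB ?dimvS // dim_Uv -natrM -dim_Kv natrD addrK.
  by case: (om == 0).
apply: (vector_quotient (psi := psi)) => //.
- move=> v; elim: (B_span v) => [|d u v' [a [b [mon [mk ->]]]] _ [w wK wE]].
    by exists 0; [exact: mem0v | rewrite linear0].
  have Xk : ('X_[mon] : A) \is k.-homog by rewrite dhomogX /=; apply/eqP.
  have kh j : kap a b 'X_[mon] j \is k.+1.-homog.
    rewrite ffunE -[k.+1]addn1; apply: dhomogM => //.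
    by apply: rpredB; apply: rpredMn; rewrite dhomogX /= mdeg1.
  exists (d *: [ffun j => DHomog (kh j)] + w).
    apply: rpredD => //; apply: rpredZ; rewrite mem_Kv; apply/eqP.
    by rewrite -[RHS](div_kap a b 'X_[mon]) divf_toW; apply: eq_bigr => j _; rewrite toWE [in LHS]ffunE.
  rewrite linearP wE; congr (_ *: _ + _); rewrite psiE.
  have -> : toW [ffun j => DHomog (kh j)] = kap a b 'X_[mon].
    by apply/ffunP => j; rewrite toWE [in LHS]ffunE.
  exact: (theta_kap B_altX B_jacX).
- move=> w; rewrite mem_Kv => /eqP w0; rewrite psiE; split=> [t0|/mem_Uv[q ->]].
    have [Pi PiE] : exists Pi : {linear W -> lquo Us}, Pi =1 \pi_(lquo Us).
      by apply: linear_pack => d u v; rewrite lquo_piD lquo_piZ.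
    have phiE' a b mon : mdeg mon = k -> phi (B a b 'X_[mon]) = s *: Pi (kap a b 'X_[mon]).
      by move=> mk; rewrite PiE phiE.
    have wh j : toW w j \is k.+1.-homog by rewrite toWE; exact: homogP.
    have wd : \sum_j 'X_j * toW w j = 0.
      by rewrite -divf_toW.
    (* A cycle killed by theta has class 0 in the quotient by [Us], and [Us], being closed under
       linear combinations, is its own span. *)
    have := phi_theta phiE' wh wd; rewrite t0 linear0 PiE => /esym/eqP.
    rewrite scaler_eq0 (negPf s_neq0) => /eqP/lquo_pi0 wU.
    have [q [qk qE]] : Us (toW w).
      apply: (lspan_min _ _ _ wU) => [|d _ _ [q1 [q1k ->]] [q2 [q2k ->]]|//].
        by exists 0; rewrite rpred0; split=> //; apply/ffunP => j; rewrite !ffunE mul0r.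
      exists (d *: q1 + q2); split; first by apply: rpredD => //; exact: rpredZ.
      by apply/ffunP => j; rewrite !ffunE mulrDl scalerAl.
    apply/mem_Uv; exists (DHomog qk); apply/ffunP => j; apply: val_inj.
    by transitivity (toW w j); [rewrite toWE | rewrite qE !ffunE].
  rewrite toW_mulom om_mul; apply: (theta_rel B_altX B_jacX) => //; exact: homogP.
Qed.

End KoszulDimension.

(** * Coefficients of series with denominator (1 - t)^m *)

Lemma series_div_inverse (p q u v : {poly rat}) k : q`_0 = 1 -> q * u = 1 + 'X^(k.+1) * v ->
  series_div p q k = (p * u)`_k.
Proof.
move=> q0 qu; rewrite /series_div; set S := \sum_(j < _) _.
have [c cE] : exists c, (1 - q) ^+ k.+1 = c * 'X^(k.+1).
  have /factor_theorem [c c1] : root (1 - q) 0.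
    by rewrite /root horner_coef0 coefB coef1 q0 subrr.
  by exists (c ^+ k.+1); rewrite c1 subr0 exprMn.
have qS : q * S = 1 - c * 'X^(k.+1).
  by rewrite -cE -[RHS]opprB subrX1 addrAC subrr add0r mulNr opprK.
have : u * (q * S) = u - u * c * 'X^(k.+1) by rewrite qS mulrBr mulr1 mulrA.
rewrite mulrCA mulrA qu mulrDl mul1r => uS.
have -> : S = u - (u * c + v * S) * 'X^(k.+1).
  by rewrite mulrDl opprD addrA -uS [v * S * _]mulrC mulrA addrK.
by rewrite mulrBr coefB mulrA coefMXn ltnSn subr0.
Qed.

(* The coefficients of (1 - t)^-m. *)
Definition mcoef (m i : nat) : nat := if m is n.+1 then 'C(i + n, i) else i == 0%N.

Lemma mcoef0 m : mcoef m 0 = 1%N.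
Proof. by case: m => //= n; rewrite bin0. Qed.

Lemma mcoefS m i : mcoef m.+1 i.+1 = (mcoef m.+1 i + mcoef m i.+1)%N.
Proof.
case: m => [|n] /=; first by rewrite !addn0 !binn.
by rewrite (addSnnS i n) addSn binS addnC.
Qed.

Arguments mcoef : simpl never.

Lemma inv_powP m N : (0 < N)%N ->
  exists v, (1 - 'X) ^+ m * \poly_(i < N) (mcoef m i)%:R = 1 + 'X^N * v :> {poly rat}.
Proof.
move=> N0; elim: m => [|m [v IHm]].
  exists 0; rewrite mulr0 addr0 mul1r; apply/polyP => i.
  by rewrite coef_poly coef1 /=; case: i => [|i]; rewrite ?N0 //; case: ifP.
(* By Pascal's rule, multiplying the truncation by 1 - X lowers m by one and leaves a single
   boundary term, in degree N. *)
pose w : {poly rat} := (- (mcoef m.+1 N.-1)%:R)%:P.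
suff wE : (1 - 'X) * \poly_(i < N) (mcoef m.+1 i)%:R = \poly_(i < N) (mcoef m i)%:R + 'X^N * w.
  exists (v + (1 - 'X) ^+ m * w); rewrite exprSr -mulrA wE mulrDr IHm.
  by rewrite -addrA mulrDr mulrCA.
apply/polyP => i; rewrite mulrBl mul1r coefB coefXM coefD coefXnM coefC !coef_poly.
case: i => [|i] /=; first by rewrite N0 /= !mcoef0 [LHS]subr0 [RHS]addr0.
have [iN|iN|<-] := ltngtP i.+1 N.
- by rewrite [RHS]addr0 mcoefS natrD addrAC subrr add0r.
- by rewrite subn_eq0 leqNgt iN /= [LHS]subr0 [RHS]addr0.
- by rewrite subnn [LHS]sub0r [RHS]add0r.
Qed.

Lemma series_div_pow (p : {poly rat}) m k : series_div p ((1 - 'X) ^+ m) k =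
  \sum_(i < k.+1) p`_i * (mcoef m (k - i))%:R.
Proof.
have [v vE] := inv_powP m (ltn0Sn k).
rewrite (series_div_inverse _ _ vE).
  rewrite coefM; apply: eq_bigr => i _.
  by rewrite coef_poly ltnS leq_subr.
by rewrite -horner_coef0 !hornerE ?subr0 ?addr0 ?oppr0 ?addr0 expr1n.
Qed.

(** The flag e says whether t^2 occurs in the numerator; the formulas of the theorem are the
    instances (n, true) and (n - 1, false). *)
Definition hilb (m : nat) (e : bool) (k : nat) : rat :=
  (1 + m%:R *: 'X)`_k - series_div (1 - m%:R *: 'X + 'X^2 *+ e) ((1 - 'X) ^+ m) k.

Lemma coef_num (m : nat) (e : bool) i : (1 - m%:R *: 'X + 'X^2 *+ e)`_i =
  (i == 0%N)%:R - m%:R * (i == 1%N)%:R + (i == 2)%:R * e%:R :> rat.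
Proof. by rewrite !coefD coefN coefZ coefX coef1 coefMn coefXn -[X in _ + X]mulr_natr. Qed.

Lemma hilb0 m e : hilb m e 0 = 0.
Proof.
rewrite /hilb series_div_pow big_ord1 coef_num coefD coefZ coefX coef1 mcoef0 /=.
ring.
Qed.

Lemma hilb1 m e : hilb m e 1 = m%:R.
Proof.
rewrite /hilb series_div_pow big_ord_recl big_ord1 !coef_num coefD coefZ coefX coef1.
rewrite mcoef0 /=; case: m => [|m]; rewrite /mcoef /= ?bin1 ?add1n; ring.
Qed.

Lemma hilbSS m e k : hilb m e k.+2 =
  m%:R * (mcoef m k.+1)%:R - (mcoef m k.+2)%:R - (mcoef m k)%:R * e%:R.
Proof.
rewrite /hilb series_div_pow !big_ord_recl big1 => [|i _]; last first.
  by rewrite coef_num /=; ring.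
rewrite !coef_num coefD coefZ coefX coef1 /= /bump /= !subSS !subn0; ring.
Qed.

(** * The metabelian quotient and its graded Lie algebra *)

Section Kernel.
Variables (F : groupType) (r : F).
Local Open Scope group_scope.

Definition proj (g : F) : quo (der2 (one_relator r)) :=
  \pi_(quo (der2 (one_relator r))) (\pi_(quo [set r]) g : one_relator r).

Lemma projM : {morph proj : g h / g * h}.
Proof. by move=> g h; rewrite /proj (quo_morph [set r]) quo_morph. Qed.

Lemma proj_surj u : exists g, proj g = u.
Proof.
have [v <-] := quo_surj u; have [g <-] := quo_surj (v : quo [set r]); by exists g.
Qed.

(** The kernel of F -> G/G'' is the normal closure of r times F'', because F'' maps onto G''. *)
Lemma ker_min (K : set F) : K 1 -> (forall g h, K g -> K h -> K (g * h^-1)) ->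
  (forall g h, K g -> K (g ^ h)) -> K r ->
  (forall g h, der1 F g -> der1 F h -> K [~ g, h]) -> forall g, proj g = 1 -> K g.
Proof.
move=> K1 KD KJ Kr Kcomm.
have KM g h : K g -> K h -> K (g * h).
  by move=> Kg Kh; rewrite -[h]invgK; apply: (KD) => //; rewrite -[h^-1]mul1g; apply: (KD).
pose pr (g : F) : one_relator r := \pi_(quo [set r]) g.
have prM : {morph pr : g h / g * h} by exact: quo_morph.
have prK g : pr g = 1 -> K g.
  by move=> /quo_ker; move: g; apply: normal_closure_min => // _ ->.
have pr_surj u : exists g, pr g = u by have [g <-] := quo_surj u; exists g.
suff H u : normal_closure (der2 (one_relator r)) u -> forall g, pr g = u -> K g.
  by move=> g /quo_ker/H; apply.
move: u; apply: normal_closure_min.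
- exact: prK.
- move=> u v Pu Pv g gu; have [h hv] := pr_surj v.
  rewrite -[g](mulgK h); apply: (KD); last exact: Pv.
  by apply: Pu; rewrite prM gu hv mulgVK.
- move=> u v Pu g gu; have [h hv] := pr_surj v.
  rewrite -[g](conjgKV h); apply: KJ; apply: Pu.
  by rewrite conjgE !prM !(morphVg prM) invgK gu hv conjgE !mulgA mulgV mul1g mulgK.
- move=> u u2 g gu; have [h [h2 hu]] := der2_surj prM pr_surj u2.
  rewrite -[g](mulVKg h); apply: KM.
    by move: h2; apply: gen_min => // _ [a a1 [b b1 <-]]; exact: Kcomm.
  by apply: prK; rewrite prM (morphVg prM) gu hu mulVg.
Qed.

Lemma proj_metab (a b : quo (der2 (one_relator r))) : der1 _ a -> der1 _ b -> commute a b.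
Proof.
move=> a1 b1; apply/commgP/eqP.
pose q (v : one_relator r) : quo (der2 (one_relator r)) := \pi v.
have qM : {morph q : g h / g * h} by exact: quo_morph.
have [g [g1 <-]] := @lcs_surj _ _ q qM (@quo_surj _ _) 2 a a1.
have [h [h1 <-]] := @lcs_surj _ _ q qM (@quo_surj _ _) 2 b b1.
rewrite -(morphRg qM); apply/quo_ker/normal_closure_mem/gen_mem.
by exists g => //; exists h.
Qed.

End Kernel.

Section GradedSeries.
Variable m : nat.
Local Notation A := {mpoly rat[m]}.
Local Notation R := (wser unit A).

(* The coefficient of the k-th power is a form of degree k + e. *)
Definition hser e (f : R) := forall w, f w \is (size w + e)%N.-homog.

Lemma hserD e f g : hser e f -> hser e g -> hser e (f + g).
Proof. by move=> fe ge w; rewrite wserDE; apply: rpredD. Qed.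
Lemma hserN e f : hser e f -> hser e (- f).
Proof. by move=> fe w; rewrite wserNE rpredN. Qed.
Lemma hser0 e : hser e 0. Proof. by move=> w; exact: rpred0. Qed.
Lemma hser1 : hser 0 1.
Proof. by move=> [|a w]; rewrite woneE; [exact: dhomog1 | exact: rpred0]. Qed.

Lemma hserM e e' f g : hser e f -> hser e' g -> hser (e + e')%N (f * g).
Proof.
move=> fe ge w; elim: w e f fe => [|a w IHw] e f fe.
  by rewrite wmulE_nil; have := dhomogM (fe [::]) (ge [::]); rewrite /= !add0n.
rewrite wmulE_cons; apply: rpredD.
  rewrite /= addSnnS -addSn; apply: IHw => v.
  by rewrite addnS -addSn; exact: (fe (a :: v)).
by have := dhomogM (fe [::]) (ge (a :: w)); rewrite /= add0n addnCA.
Qed.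

Lemma hser_cf k f : hser 0 f -> cf k f \is k.-homog.
Proof. by move=> /(_ (nseq k tt)); rewrite size_nseq addn0. Qed.

Definition xexp (lam : A) : R := expser (@mpolyC m rat) lam.

Lemma hser_exp lam : lam \is 1.-homog -> hser 0 (xexp lam).
Proof.
move=> l1 w; rewrite addn0 /xexp /expser mul_mpolyC; apply: rpredZ.
by have := dhomogMn (size w) l1; rewrite mul1n.
Qed.

Lemma cf1_exp lam : cf 1 (xexp lam) = lam.
Proof. by rewrite /cf /xexp /expser /= mul_mpolyC invr1 scale1r expr1. Qed.

End GradedSeries.

Lemma basis_axiom (V V' : lmodType rat) m (v : 'I_m -> V) (Phi : {linear V -> V'}) :
  (forall u, lspan [set v i | i in [set: 'I_m]] u) ->
  (forall u : 'rV[rat]_m, \sum_l u 0 l *: Phi (v l) = 0 -> u = 0) ->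
  inhabited (Vector.axiom m V).
Proof.
move=> v_span v_free.
have [psi psiE] : exists psi : {linear 'rV[rat]_m -> V}, psi =1 fun u => \sum_l u 0 l *: v l.
  apply: linear_pack => c u w; rewrite scaler_sumr -big_split; apply: eq_bigr => l _.
  by rewrite !mxE scalerDl scalerA.
have -> : m = (\dim (fullv : {vspace 'rV[rat]_m}) - \dim (0%VS : {vspace 'rV[rat]_m}))%N.
  by rewrite dimv0 subn0 dimvf /dim /= mul1n.
apply: (vector_quotient (psi := psi)) => [|u|u _]; first exact: sub0v.
- elim: (v_span u) => [|c _ w [l _ <-] _ [w' _ <-]]; first by exists 0; rewrite ?memvf ?linear0.
  exists (c *: delta_mx 0 l + w'); rewrite ?memvf // linearP psiE; congr (_ *: _ + _).
  rewrite (bigD1 l) //= big1 => [|i /negPf il]; first by rewrite mxE !eqxx scale1r addr0.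
  by rewrite mxE il scale0r.
- rewrite psiE memv0; split=> [u0|/eqP ->]; last first.
    by rewrite big1 // => l _; rewrite mxE scale0r.
  apply/eqP/v_free; have := congr1 Phi u0; rewrite linear0 linear_sum => E; rewrite -[RHS]E.
  by apply: eq_bigr => l _; rewrite linearZ.
Qed.

Lemma empty_axiom (V : lmodType rat) : (forall v : V, v = 0) -> inhabited (Vector.axiom 0 V).
Proof.
move=> V0; have [z _] := zero_linear V V.
apply: (basis_axiom (v := fun=> 0) (Phi := z)) => [v|u _].
  by rewrite [v]V0; exact: lspan0.
by apply/rowP => -[].
Qed.

Lemma gr0_axiom (H : groupType) : inhabited (Vector.axiom 0 (gr H 0)).
Proof.
apply: empty_axiom => v; elim/gcl_ind: v => // c g v _ ->.
by rewrite gcl0 // scaler0 addr0.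
Qed.

(** This is the case of rank one with r outside [F,F], kept apart because the Koszul computation is
    set over n + 1 variables. *)
Lemma unspanned_hilbert (H : groupType) (y : 'I_0 -> H) :
  (forall v : gr H 1, lspan [set gcl 1 (y i) | i in [set: 'I_0]] v) ->
  is_hilbert (gr H) (hilb 0 false).
Proof.
move=> y_span [|[|k]].
- by exists 0; rewrite hilb0; split=> //; exact: gr0_axiom.
- exists 0; rewrite hilb1; split=> //; apply: empty_axiom => v.
  by elim: (y_span v) => // c u w [[]].
- have h0 : hilb 0 false k.+2 = 0 by rewrite hilbSS /mcoef /=; ring.
  exists 0; rewrite h0; split=> //.
  by apply: empty_axiom => v; elim: (gr_span y_span v) => // c u w [[[]]].
Qed.

(** * The Hilbert series read off from a crossed homomorphism *)

Section CocycleHilbert.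
Variables (F : groupType) (r : F) (n : nat).
Local Notation m := n.+1.
Local Notation A := {mpoly rat[m]}.
Local Notation R := (wser unit A).
Local Notation W := {ffun 'I_m -> A}.
Local Notation H := (quo (der2 (one_relator r))).
Variables (bar : F -> R) (d : F -> 'rV[R]_m).
Hypotheses (bar1 : bar 1%g = 1) (barM : forall g h, bar (g * h)%g = bar g * bar h).
Hypothesis bar_nil : forall g, bar g [::] = 1.
Hypothesis dM : forall g h, d (g * h)%g = d g + bar g *: d h.
Hypothesis bar_h : forall g, hser 0 (bar g).
Hypothesis bar_r : bar r = 1.
Hypothesis dr0 : forall j, cf 0 (d r 0 j) = 0.
Definition omega : W := [ffun j => cf 1 (d r 0 j)].
Hypothesis omega_r : omega <> 0 \/ d r = 0.
Variables (y : 'I_m -> F) (a : rat).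
Hypothesis bar_y : forall l, cf 1 (bar (y l)) = 'X_l.
Hypothesis d_y : forall l j, cf 0 (d (y l) 0 j) = a%:MP *+ (j == l).

Definition cfv k g : W := [ffun j => cf k (d g 0 j)].

(** On the kernel of bar, d is additive and conjugation by h multiplies it by bar h^-1; it vanishes
    on [F', F'] because bar is trivial on F'. Homogeneity of p makes its coefficients forms of the
    degree required in [Uset]. *)
Lemma ker_cocycle g : proj r g = 1%g ->
  bar g = 1 /\ exists p, hser 0 p /\ d g = p *: d r.
Proof.
move: g; apply: ker_min.
- by rewrite bar1 (d1 bar1 dM); split=> //; exists 0; rewrite scale0r; split=> //; exact: hser0.
- move=> g h [g1 [p [ph pE]]] [h1 [q [qh qE]]].
  have gh1 : bar (g * h^-1)%g = 1.
    by rewrite barM g1 mul1r -(mulr1 (bar _)) -{1}h1 (barVK bar1 barM).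
  split=> //; exists (p - q); split; first by apply/hserD/hserN.
  by rewrite (d_div bar1 barM dM) gh1 scale1r pE qE scalerBl.
- move=> g h [g1 [p [ph pE]]].
  have gh1 : bar (g ^ h)%g = 1.
    by rewrite conjgE !barM g1 mul1r (barVK bar1 barM).
  split=> //; exists (bar h^-1%g * p); split; first by apply: (@hserM _ 0 0).
  rewrite conjgE !dM g1 scale1r scalerDr (dV bar1 dM h) pE scalerA.
  by rewrite [X in _ + X]addrC addKr.
- split=> //; exists 1; rewrite scale1r; split=> //; exact: hser1.
- move=> g h g1 h1; have [bg bh] := (bar_der1 bar1 barM g1, bar_der1 bar1 barM h1).
  split; first by apply: (bar_der1 bar1 barM); exact: der1_comm.
  exists 0; split; first exact: hser0.
  by rewrite (d_comm bar1 barM dM) bg bh subrr !scale0r subrr scaler0.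
Qed.

Definition Uset k : set W := [set w | exists q, q \is k.-homog /\ w = [ffun j => q * omega j]].

Lemma cfvM k g h : lcs F k.+1 g -> lcs F k.+1 h -> cfv k (g * h)%g = cfv k g + cfv k h.
Proof.
by move=> gk hk; apply/ffunP => j; rewrite !ffunE (cf_dM bar1 barM bar_nil dM).
Qed.

Lemma cfv_ker0 g : proj r g = 1%g -> cfv 0 g = 0.
Proof.
move=> /ker_cocycle[_ [p [_ pE]]]; apply/ffunP => j; rewrite !ffunE pE mxE.
have := cfM (word_ordT p) (word_ordT (d r 0 j)); rewrite addn0 => ->.
by rewrite dr0 mulr0.
Qed.

Lemma cfv_ker k g : proj r g = 1%g -> lcs F k.+2 g -> Uset k (cfv k.+1 g).
Proof.
move=> /ker_cocycle[_ [p [ph pE]]] gk.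
have [w0|dr] := omega_r; last first.
  exists 0; split; first exact: rpred0.
  by apply/ffunP => j; rewrite !ffunE pE dr scaler0 mxE mul0r.
have r1 j : word_ord 1 (d r 0 j) by apply: word_ord_cf => //; exact: word_ordT.
have [j0 j0P] : exists j, cf 1 (d r 0 j) != 0.
  apply: contrapT => N; apply: w0; apply/ffunP => j; rewrite !ffunE; apply/eqP.
  by apply: contrapT => /negP Nj; apply: N; exists j.
(* Since d g = p (d r) has order k + 1 and d r has the nonzero leading coefficient omega in degree
   1, the coefficients of p below k vanish one after the other in a domain. *)
have pk : word_ord k p.
  have := leqnn k; elim: {1 3}k => [|i IHi] ik; first exact: word_ordT.
  have pi := IHi (ltnW ik); apply: word_ord_cf => //.
  have := cfM pi (r1 j0); have -> : p * d r 0 j0 = d g 0 j0 by rewrite pE mxE.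
  rewrite addn1 (cf_lt (d_lcs bar1 barM bar_nil dM gk j0)) ?ltnS // => /esym/eqP.
  by rewrite mulf_eq0 (negPf j0P) orbF => /eqP.
exists (cf k p); split; first exact: hser_cf.
by apply/ffunP => j; rewrite !ffunE pE mxE -(cfM pk (r1 j)) addn1.
Qed.

Lemma cfv_wd k g h : lcs F k.+2 g -> lcs F k.+2 h -> proj r g = proj r h ->
  \pi_(lquo (Uset k)) (cfv k.+1 g) = \pi_(lquo (Uset k)) (cfv k.+1 h).
Proof.
move=> gk hk gh; apply/esym/eqP/lquoP/lspan_mem.
have ghk : lcs F k.+2 (g^-1 * h)%g by apply: lcsM => //; exact: lcsV.
have E : cfv k.+1 h = cfv k.+1 g + cfv k.+1 (g^-1 * h)%g.
  by rewrite -(cfvM gk ghk) mulVKg.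
rewrite E addrC addKr; apply: cfv_ker => //.
by rewrite projM (morphVg (@projM F r)) gh mulVg.
Qed.

Lemma phi_exists k : exists Phi : {linear gr H k.+2 -> lquo (Uset k)},
  forall g, lcs F k.+2 g -> Phi (gcl k.+2 (proj r g)) = \pi_(lquo (Uset k)) (cfv k.+1 g).
Proof.
(* Lifts must stay in the same term of the series, where d has order k + 1; elsewhere a junk value
   is taken. *)
have L (u : H) : exists g, lcs H k.+2 u -> lcs F k.+2 g /\ proj r g = u.
  have [ku|nku] := pselect (lcs H k.+2 u); last by exists 1%g.
  by have [g gP] := lcs_surj (@projM F r) (@proj_surj F r) ku; exists g.
have [lift liftP] := choice L.
have [|| Phi PhiE] := @gcl_lift H k.+2 _ (fun u => \pi_(lquo (Uset k)) (cfv k.+1 (lift u))).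
- move=> u v uk vk; rewrite -lquo_piD -cfvM; try by case: (liftP _ uk); case: (liftP _ vk).
  have [[uF uE] [vF vE]] := (liftP _ uk, liftP _ vk).
  have [uvF uvE] := liftP _ (lcsM uk vk).
  by apply: cfv_wd => //; [exact: lcsM | rewrite uvE projM uE vE].
- move=> u uk; have [uF uE] := liftP _ (lcs_desc uk).
  have [g [gk gu]] := lcs_surj (@projM F r) (@proj_surj F r) uk.
  rewrite (@cfv_wd _ _ g) //; [|exact: lcs_desc|by rewrite gu].
  have -> : cfv k.+1 g = 0; last by [].
  apply/ffunP => j; rewrite !ffunE; apply: (cf_lt (d_lcs bar1 barM bar_nil dM gk j)); exact: ltnSn.
exists Phi => g gk; rewrite PhiE; last exact: (lcs_morph (@projM F r)).
have [lF lE] := liftP _ (lcs_morph (@projM F r) gk).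
by apply: cfv_wd.
Qed.

Lemma phi1_exists : exists Phi : {linear gr H 1 -> W},
  forall g, Phi (gcl 1 (proj r g)) = cfv 0 g.
Proof.
have [lift liftP] := choice (@proj_surj F r).
have wd g h : proj r g = proj r h -> cfv 0 g = cfv 0 h.
  move=> gh; rewrite -(mulVKg g h) cfvM // [X in _ + X]cfv_ker0 ?addr0 //.
  by rewrite projM (morphVg (@projM F r)) gh mulVg.
have hom g h : cfv 0 (g * h)%g = cfv 0 g + cfv 0 h by exact: cfvM.
have [|| Phi PhiE] := @gcl_lift H 1 _ (fun u => cfv 0 (lift u)).
- by move=> u v _ _; rewrite -hom; apply: wd; rewrite projM !liftP.
- apply: hom_gen_comm => u v; rewrite -hom; apply: wd; by rewrite projM !liftP.
by exists Phi => g; rewrite PhiE //; apply: wd; rewrite liftP.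
Qed.

Lemma cfv0_y l : cfv 0 (y l) = [ffun j => a%:MP *+ (j == l)].
Proof. by apply/ffunP => j; rewrite !ffunE d_y. Qed.

(** The innermost commutator gives a times the Koszul boundary, and each further bracket with y_h
    multiplies by - X_h: hence the sign. *)
Lemma cfv_lcom i l w : cfv (size w).+1 (lcom y i l w) =
  ((-1) ^+ size w * a) *: kap i l (\prod_(h <- w) 'X_h).
Proof.
elim/last_ind: w => [|w h IHw]; apply/ffunP => j.
  rewrite !ffunE big_nil mul1r expr0 mul1r (cf_d_comm1 bar1 barM bar_nil dM).
  by rewrite !bar_y !d_y !mulrnAr ![_ * a%:MP]mulrC !mul_mpolyC scalerBr !scalerMnr.
rewrite /lcom foldl_rcons -/(lcom y i l w) size_rcons ffunE.
rewrite (cf_d_comm bar1 barM bar_nil dM); last exact: lcom_lcs.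
have := congr1 (fun f : W => f j) IHw; rewrite ffunE => ->.
rewrite bar_y !ffunE big_rcons /= -scalerAr exprS mulN1r mulNr scaleNr mulrA.
by rewrite [_ * 'X_h]mulrC.
Qed.

Lemma Xprod_mword mon : \prod_(h <- mword mon) 'X_h = 'X_[mon] :> A.
Proof.
rewrite /mword big_flatten big_map enumT mpolyXE_id; apply: eq_bigr => i _.
by rewrite big_nseq -iter_mulr_1 iter_mulr mulr1.
Qed.

Lemma proj_lcom i l w : proj r (lcom y i l w) = lcom (fun i => proj r (y i)) i l w.
Proof.
elim/last_ind: w => [|w h IHw]; first exact: (morphRg (@projM F r)).
rewrite /lcom !foldl_rcons (morphRg (@projM F r)).
by rewrite -/(lcom y i l w) -/(lcom (fun i => proj r (y i)) i l w) -IHw.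
Qed.

Hypothesis a_neq0 : a != 0.
Local Notation yH := (fun i => proj r (y i)).
Hypothesis y_span : forall v : gr H 1, lspan [set gcl 1 (yH i) | i in [set: 'I_m]] v.

Lemma gr1_axiom : inhabited (Vector.axiom m (gr H 1)).
Proof.
have [Phi PhiE] := phi1_exists.
apply: (basis_axiom (Phi := Phi) y_span) => u u0; apply/rowP => j; rewrite mxE.
have := congr1 (fun w : W => w j) u0.
have -> : \sum_l u 0 l *: Phi (gcl 1 (yH l)) = \sum_l u 0 l *: [ffun i => a%:MP *+ (i == l)].
  by apply: eq_bigr => l _; rewrite PhiE cfv0_y.
rewrite sum_ffunE !ffunE (eq_bigr (fun l => (u 0 l *: a%:MP) *+ (l == j))) => [|l _].
  rewrite sum_pick => /eqP; rewrite scaler_eq0 mpolyC_eq0 (negPf a_neq0) orbF.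
  by move/eqP.
by rewrite !ffunE scalerMnr eq_sym.
Qed.

Variable c : 'I_m -> 'I_m -> rat.
Hypothesis omega_c : omega = \sum_i \sum_j c i j *: kap i j 1.
Hypothesis c_rel : \sum_i \sum_j c i j *: gcl 2 [~ yH i, yH j]%g = 0 :> gr H 2.

Lemma gr_axiom k : exists d, inhabited (Vector.axiom d (gr H k.+2)) /\
  hilb m (omega != 0) k.+2 = d%:R.
Proof.
have [phi phiE] := phi_exists k.
(* Commutators with a fixed pair (i, j), extended linearly from monomials; [koszul_dim] applies to
   this family. *)
pose f i j mon : gr H k.+2 := gcl k.+2 (lcom yH i j (mword mon)).
pose B i j : {linear A -> gr H k.+2} := mlift (f i j).
have BX i j mon : B i j 'X_[mon] = f i j mon by exact: mliftX.
have BXl i j l mon : B i j ('X_l * 'X_[mon]) = gcl k.+2 (lcom yH i j (l :: mword mon)).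
  rewrite -mpolyXD BX /f (@lcom_perm H m yH (@proj_metab F r) i j _ _ (mword_add l mon)).
  by [].
have om1 j : omega j \is 1.-homog.
  rewrite omega_c sum_ffunE; apply: rpred_sum => i _; rewrite sum_ffunE.
  apply: rpred_sum => l _; rewrite !ffunE mul1r; apply: rpredZ.
  by apply: rpredB; apply: rpredMn; rewrite dhomogX /= mdeg1.
have B_alt i j mon : mdeg mon = k -> B i j 'X_[mon] = - B j i 'X_[mon].
  by move=> mk; rewrite !BX; apply: lcom_alt; rewrite size_mword mk.
have B_jac i j l mon : (mdeg mon).+1 = k -> B i j ('X_l * 'X_[mon]) +
    B j l ('X_i * 'X_[mon]) + B l i ('X_j * 'X_[mon]) = 0.
  by move=> mk; rewrite !BXl; apply: lcom_jacobi; rewrite size_mword mk.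
have B_lcom i j w : size w = k -> exists2 mon, mdeg mon = k &
    gcl k.+2 (lcom yH i j w) = B i j 'X_[mon].
  move=> wk; have [mon [mw pw]] := mword_mnm w; exists mon; first by rewrite mw.
  by rewrite BX /f -(@lcom_perm H m yH (@proj_metab F r) i j _ _ pw).
have B_span v : lspan [set v | exists i j mon, mdeg mon = k /\ v = B i j 'X_[mon]] v.
  apply: lspan_mono (gr_span y_span v) => _ [[i j] _ [w wk <-]].
  have [mon mk E] := B_lcom i j w wk.
  by apply: lspan_mem; exists i, j, mon; split; [exact: mk | exact: E].
have B_rel mon : mdeg mon = k -> \sum_i \sum_j c i j *: B i j 'X_[mon] = 0.
  move=> mk; rewrite -[RHS](@lcom_rel H m yH c (mword mon) k.+2 _ c_rel); last by rewrite size_mword mk.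
  by apply: eq_bigr => i _; apply: eq_bigr => j _; rewrite BX.
have s0 : (-1) ^+ k * a != 0 by rewrite mulf_neq0 // signr_eq0.
have phiB i j mon : mdeg mon = k ->
    phi (B i j 'X_[mon]) = ((-1) ^+ k * a) *: \pi_(lquo (Uset k)) (kap i j 'X_[mon]).
  move=> mk; rewrite BX /f -proj_lcom phiE; last first.
    by rewrite -mk -size_mword; exact: lcom_lcs.
  by rewrite -lquo_piZ -Xprod_mword -[k in cfv k.+1]mk -size_mword cfv_lcom size_mword mk.
have [e [eV eE]] := koszul_dim om1 B_alt B_jac B_span B_rel omega_c s0 phiB.
exists e; split; first exact: eV.
rewrite hilbSS eE /mcoef; congr (_ - _).
by case: (omega == 0); rewrite ?mulr0 ?mulr1.
Qed.

Theorem cocycle_hilbert : is_hilbert (gr H) (hilb m (omega != 0)).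
Proof.
move=> [|[|k]]; last by have [e eP] := gr_axiom k; exists e.
  by exists 0; rewrite hilb0; split=> //; exact: gr0_axiom.
by exists m; rewrite hilb1; split=> //; exact: gr1_axiom.
Qed.

End CocycleHilbert.

(** * Exponent sums in a free group *)

Section FreeAbelianization.
Variables (n : nat) (F : groupType) (x : 'I_n -> F).
Hypothesis F_free : free_on x.
Definition abq (g : F) : quo (der1 F) := \pi g.
Local Notation q := abq.

Fact abqM : {morph q : g h / (g * h)%g}. Proof. exact: quo_morph. Qed.

Lemma abqC (u v : quo (der1 F)) : (u * v = v * u)%g.
Proof.
have [[g <-] [h <-]] := (quo_surj u, quo_surj v); apply/commgP/eqP.
by rewrite -(morphRg abqM); apply/quo_ker/normal_closure_mem; exact: der1_comm.
Qed.

Definition xprod (s : seq 'I_n) : F := foldr (fun i g => x i * g)%g 1%g s.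

Lemma ab_word g : exists s t, (q g * q (xprod t) = q (xprod s))%g.
Proof.
elim/(free_ind F_free): g => [|i g [s [t E]]|i g [s [t E]]].
- by exists [::], [::]; rewrite /= -abqM mulg1.
- by exists (i :: s), t; rewrite /= !abqM -mulgA E.
- exists s, (i :: t); rewrite -E /= !abqM (morphVg abqM) (abqC (q (x i))^-1%g).
  by rewrite -mulgA mulKg.
Qed.

Lemma xprod_perm s t : perm_eq s t -> q (xprod s) = q (xprod t).
Proof.
have cat u v : q (xprod (u ++ v)) = (q (xprod u) * q (xprod v))%g.
  elim: u => [|i u IHu] /=; first by rewrite -abqM mul1g.
  by rewrite !abqM IHu mulgA.
move=> st; apply: (catCA_perm_ind (P := fun u => q (xprod s) = q (xprod u)) _ st) => //.
by move=> u v w ->; rewrite !cat !mulgA (abqC (q (xprod u))).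
Qed.

Lemma hom_xprod (V : lmodType rat) (f : F -> V) s : (forall g h, f (g * h)%g = f g + f h) ->
  f (xprod s) = \sum_i (count_mem i s)%:R *: f (x i).
Proof.
move=> fM; have f1 : f 1%g = 0 by apply: (addrI (f 1%g)); rewrite -fM mulg1 addr0.
elim: s => [|j s IHs]; first by rewrite /= f1 big1 // => i _; rewrite scale0r.
rewrite /= fM IHs -[f (x j)](sum_pick (fun i => f (x i))) -big_split.
apply: eq_bigr => i _; rewrite natrD scalerDl eq_sym.
by case: eqP => _; rewrite ?scale1r ?scale0r.
Qed.

(** e i is the exponent sum of x_i. Stating it for every homomorphism to a rational vector space
    lets it apply alike to Fox derivatives, linear forms and classes in gr_1. *)
Lemma exponents g : exists e : 'I_n -> rat,
  (forall (V : lmodType rat) (f : F -> V), (forall g h, f (g * h)%g = f g + f h) ->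
     f g = \sum_i e i *: f (x i)) /\
  ((forall i, e i = 0) -> der1 F g).
Proof.
have [s [t E]] := ab_word g.
have der h : q h = 1%g -> der1 F h.
  move=> /quo_ker; move: h; apply: normal_closure_min => //.
  - exact: (@lcs_one _ 2).
  - by move=> h k; exact: (@lcs_div _ 2).
  - by move=> h k; exact: (@lcsJ _ 2).
exists (fun i => (count_mem i s)%:R - (count_mem i t)%:R); split=> [V f fM|e0].
  have g0 : f (g * xprod t * (xprod s)^-1)%g = 0.
    by apply: (hom_gen_comm fM); apply: der; rewrite !abqM E (morphVg abqM) mulgV.
  have f1 : f 1%g = 0 by apply: (addrI (f 1%g)); rewrite -fM mulg1 addr0.
  have fV h : f h^-1%g = - f h by apply/eqP; rewrite -addr_eq0 -fM mulVg f1.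
  move: g0; rewrite !fM fV !hom_xprod // => /eqP; rewrite subr_eq0 => /eqP g0.
  under eq_bigr do rewrite scalerBl.
  by rewrite sumrB -g0 addrK.
(* Zero exponents make s and t permutations of each other, so they agree modulo F'. *)
apply: der; apply: (mulIg (q (xprod t))); rewrite E mul1g; apply: xprod_perm.
apply/allP => i _ /=; have := e0 i => /eqP; rewrite subr_eq0 Num.Theory.eqr_nat.
by [].
Qed.

Lemma lspan_sum (V : lmodType rat) (T : set V) (e : 'I_n -> rat) (v : 'I_n -> V) :
  (forall i, lspan T (v i)) -> lspan T (\sum_i e i *: v i).
Proof.
move=> Tv; elim/big_ind: _ => [|u w|i _]; [exact: lspan0 | exact: lspanD | exact: lspanZ].
Qed.

Lemma gr1_span (H : groupType) (p : F -> H) (T : set (gr H 1)) :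
  {morph p : g h / (g * h)%g} -> (forall u, exists g, p g = u) ->
  (forall i, lspan T (gcl 1 (p (x i)))) -> forall v, lspan T v.
Proof.
move=> pM p_surj Tx v; elim/gcl_ind: v => [|c u v _ Tv]; first exact: lspan0.
apply: lspanD => //; apply: lspanZ; have [g <-] := p_surj u.
have [e [eE _]] := exponents g.
rewrite (eE (gr H 1) (fun g => gcl 1 (p g))); last by move=> h k; rewrite pM gclM.
exact: lspan_sum.
Qed.

End FreeAbelianization.

(** * The two kinds of relators *)

Section ExponentialCocycle.
Variables (n m : nat) (F : groupType) (x : 'I_n -> F).
Hypothesis F_free : free_on x.
Local Notation A := {mpoly rat[m]}.
Local Notation R := (wser unit A).
Variable lam : 'I_n -> A.
Hypothesis lam1 : forall i, lam i \is 1.-homog.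

Lemma xexp_cocycle : exists (bar : F -> R) (D : F -> 'rV[R]_n),
  [/\ [/\ bar 1%g = 1, forall g h, bar (g * h)%g = bar g * bar h,
          forall g, bar g [::] = 1, forall g h, D (g * h)%g = D g + bar g *: D h &
          forall g, hser 0 (bar g)],
      forall i, bar (x i) = xexp (lam i), forall i, D (x i) = delta_mx 0 i &
      forall g (e : 'I_n -> rat), (forall (V : lmodType rat) (f : F -> V),
        (forall g h, f (g * h)%g = f g + f h) -> f g = \sum_i e i *: f (x i)) ->
        bar g = xexp (\sum_i e i *: lam i) /\ forall i, cf 0 (D g 0 i) = (e i)%:MP].
Proof.
have xexpD a b : xexp (a + b) = xexp a * xexp b by exact: expserD.
have xexp_nil a : xexp a [::] = 1 by exact: expser0E.
have uv i : xexp (lam i) * xexp (- lam i) = 1 by rewrite -xexpD subrr; exact: expser0.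
have [bar [D [bar1 barM barx dM Dx]]] := fox_exists F_free uv.
have barxV i : bar (x i)^-1%g = xexp (- lam i).
  by rewrite -[LHS]mulr1 -(uv i) mulrA -barx -barM mulVg bar1 mul1r.
have bar_nil g : bar g [::] = 1.
  elim/(free_ind F_free): g => [|i g IHg|i g IHg]; first by rewrite bar1.
  - by rewrite barM barx wmulE_nil xexp_nil IHg mulr1.
  - by rewrite barM barxV wmulE_nil xexp_nil IHg mulr1.
pose cD i g : A := cf 0 (D g 0 i).
have cDM i g h : cD i (g * h)%g = cD i g + cD i h by exact: (cf_dM bar1 barM bar_nil dM).
have cDx i j : cD i (x j) = (i == j)%:R by rewrite /cD Dx mxE eqxx; case: (_ == _).
(* The additive map with L(x_j) = lam_j; bar and g |-> exp(L g) are multiplicative and agree on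
   generators. *)
pose L g := \sum_i cD i g * lam i.
have LM g h : L (g * h)%g = L g + L h.
  by rewrite -big_split; apply: eq_bigr => i _; rewrite cDM mulrDl.
have Lx j : L (x j) = lam j.
  rewrite /L (bigD1 j) //= cDx eqxx mul1r big1 ?addr0 // => i /negPf ij.
  by rewrite cDx ij mul0r.
have LV j : L (x j)^-1%g = - lam j.
  apply/eqP; rewrite -addr_eq0 -[X in _ + X]Lx -LM mulVg; apply/eqP.
  by apply: (addrI (L 1%g)); rewrite -LM mulg1 addr0.
have L1 : L 1%g = 0 by apply: (addrI (L 1%g)); rewrite -LM mulg1 addr0.
have barE g : bar g = xexp (L g).
  elim/(free_ind F_free): g => [|i g IHg|i g IHg].
  - by rewrite bar1 L1; exact/esym/expser0.
  - by rewrite barM barx IHg LM Lx xexpD.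
  - by rewrite barM barxV IHg LM LV xexpD.
have main g (e : 'I_n -> rat) : (forall (V : lmodType rat) (f : F -> V),
    (forall g h, f (g * h)%g = f g + f h) -> f g = \sum_i e i *: f (x i)) ->
    bar g = xexp (\sum_i e i *: lam i) /\ forall i, cf 0 (D g 0 i) = (e i)%:MP.
  move=> eE; split=> [|i]; first by rewrite barE (eE A L LM); under eq_bigr do rewrite Lx.
  rewrite -/(cD i g) (eE A (cD i) (cDM i)) (bigD1 i) //= cDx eqxx big1 ?addr0 => [|j ji].
    by rewrite -mul_mpolyC mulr1.
  by rewrite cDx eq_sym (negPf ji) scaler0.
have bar_h g : hser 0 (bar g).
  have [e [eE _]] := exponents F_free g; have [-> _] := main g e eE.
  by apply: hser_exp; apply: rpred_sum => i _; apply: rpredZ; exact: lam1.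
exists bar, D; split; [split | exact: barx | exact: Dx | exact: main].
- exact: bar1.
- exact: barM.
- exact: bar_nil.
- exact: dM.
- exact: bar_h.
Qed.

End ExponentialCocycle.

Lemma lspan_comb (V : lmodType rat) (I : finType) (b : I -> V) (T : set V) v :
  T `<=` [set b i | i in [set: I]] -> lspan T v -> exists c, v = \sum_i c i *: b i.
Proof.
move=> Tb; elim=> [|d u w /Tb[i _ <-] _ [c ->]].
  by exists (fun=> 0); rewrite big1 // => i _; rewrite scale0r.
exists (fun j => d *+ (j == i) + c j).
under [RHS]eq_bigr do rewrite /= scalerDl; rewrite big_split; congr (_ + _).
rewrite (bigD1 i) //= eqxx big1 ?addr0 // => j /negPf ->.
by rewrite mulr0n scale0r.
Qed.

Lemma eq_opp0 (V : lmodType rat) (v : V) : v = - v -> v = 0.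
Proof.
move=> vN; have : (2 : rat) *: v = 0 by rewrite scaler_nat mulr2n {2}vN subrr.
by move/eqP; rewrite scaler_eq0 => /eqP.
Qed.

Lemma lspan_solve (V : lmodType rat) (T : set V) a u w :
  a != 0 -> a *: u + w = 0 -> lspan T w -> lspan T u.
Proof.
move=> a0 /eqP; rewrite addr_eq0 => /eqP E Tw.
rewrite -[u]scale1r -(mulVf a0) -scalerA E; exact/lspanZ/lspanN.
Qed.

Section Relator.
Variables (p : nat) (F : groupType) (x : 'I_p.+1 -> F) (r : F).
Hypothesis F_free : free_on x.
Local Notation H := (quo (der2 (one_relator r))).
Local Notation n := p.+1.
Local Notation A := {mpoly rat[n]}.
Local Notation W := {ffun 'I_n -> A}.

Lemma proj_r : proj r r = 1%g.
Proof.
rewrite /proj; have -> : \pi_(quo [set r]) r = 1%g.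
  by apply/quo_ker/normal_closure_mem.
exact: (morph1g (@quo_morph _ _)).
Qed.

(** The coefficient of X_i in component l is c_il - c_li: alternation is the only linear relation
    among the boundaries. *)
Lemma kap_sum_eq0 (c : 'I_n -> 'I_n -> rat) :
  \sum_i \sum_j c i j *: kap i j 1 = 0 :> W -> forall i j, c i j = c j i.
Proof.
move=> c0 i l; have E : \sum_k (c k l - c l k) *: 'X_k = 0 :> A.
  have := congr1 (fun w : W => w l) c0; rewrite [in RHS]ffunE => E; rewrite -[RHS]E.
  rewrite sum_ffunE; under [RHS]eq_bigr do rewrite sum_ffunE.
  under [RHS]eq_bigr => k _ do under eq_bigr => j _ do
    rewrite 2!ffunE mul1r scalerBr -!scalerMnr (eq_sym l j) (eq_sym l k).
  under [RHS]eq_bigr do rewrite sumrB; rewrite sumrB [X in _ = _ - X]exchange_big -sumrB.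
  apply: eq_bigr => k _; rewrite scalerBl; congr (_ - _).
    by rewrite (sum_pick (fun j => c k j *: 'X_k)).
  by rewrite (sum_pick (fun j => c j k *: 'X_k)).
have := congr1 (mcoeff U_(i)) E; rewrite linear_sum mcoeff0 (bigD1 i) //=.
rewrite mcoeffZ mcoeffXU eqxx mulr1 big1 => [|k /negPf ki].
  by rewrite addr0 => /eqP; rewrite subr_eq0 => /eqP.
by rewrite mcoeffZ mcoeffXU ki mulr0.
Qed.

Lemma commutator_relator : der1 F r -> r <> 1%g -> one_formal (one_relator r) ->
  is_hilbert (gr H) (hilb n true).
Proof.
move=> r2 r1 formal.
have x_span (v : gr F 1) : lspan [set gcl 1 (x i) | i in [set: 'I_n]] v.
  apply: (gr1_span F_free (p := id)) => // [u|i]; first by exists u.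
  by apply: lspan_mem; exists i.
(* The same c then gives omega, through the crossed homomorphism, and the relation in gr_2 H,
   through the projection. *)
have [c cE] : exists c, gcl 2 r = \sum_i \sum_j c i j *: gcl 2 [~ x i, x j]%g.
  have [|c cE] := @lspan_comb _ _ (fun ij => gcl 2 [~ x ij.1, x ij.2]%g) _ _ _ (gr_span x_span (gcl 2 r)).
    by move=> _ [ij _ [w /= /size0nil -> <-]]; exists ij.
  exists (fun i j => c (i, j)); rewrite cE pair_bigA; apply: eq_bigr => -[i j] _.
  by [].
have lamX (i : 'I_n) : ('X_i : A) \is 1.-homog by rewrite dhomogX /= mdeg1.
have [bar [D [[bar1 barM bar_nil dM bar_h] barx Dx _]]] := xexp_cocycle F_free lamX.
have bar_r : bar r = 1 by exact: bar_der1.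
have dr0 j : cf 0 (D r 0 j) = 0.
  exact: (cf_lt (d_lcs bar1 barM bar_nil dM (r2 : lcs F 2 r) j)).
have bar_x l : cf 1 (bar (x l)) = 'X_l by rewrite barx cf1_exp.
have d_x l j : cf 0 (D (x l) 0 j) = (1 : rat)%:MP *+ (j == l).
  by rewrite Dx mxE eqxx mpolyC1 /=; case: (j == l).
have [Psi PsiE] : exists Psi : {linear gr F 2 -> W},
    forall g, lcs F 2 g -> Psi (gcl 2 g) = cfv D 1 g.
  apply: gcl_lift => [g h g2 h2|g g3]; first exact: (cfvM bar1 barM bar_nil dM).
  by apply/ffunP => j; rewrite !ffunE; exact: (cf_lt (d_lcs bar1 barM bar_nil dM g3 j)).
have om_c : omega r D = \sum_i \sum_j c i j *: kap i j 1.
  rewrite -[LHS]/(cfv D 1 r) -(PsiE r r2) cE linear_sum; apply: eq_bigr => i _.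
  rewrite linear_sum; apply: eq_bigr => j _; rewrite linearZ /= PsiE; last exact: der1_comm.
  have := cfv_lcom bar1 barM bar_nil dM bar_x d_x i j [::].
  by rewrite expr0 mul1r scale1r big_nil => ->.
have c_rel : \sum_i \sum_j c i j *: gcl 2 [~ proj r (x i), proj r (x j)]%g = 0 :> gr H 2.
  have [P PE] : exists P : {linear gr F 2 -> gr H 2},
      forall g, lcs F 2 g -> P (gcl 2 g) = gcl 2 (proj r g).
    apply: gcl_lift => [g h g2 h2|g g3].
      by rewrite projM gclM //; exact: (lcs_morph (@projM F r)).
    by apply: gcl0; exact: (lcs_morph (@projM F r)).
  rewrite -[RHS](gcl_one H 2) -proj_r -(PE r r2) cE linear_sum; apply: eq_bigr => i _.
  rewrite linear_sum; apply: eq_bigr => j _; rewrite linearZ /= PE; last exact: der1_comm.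
  by rewrite (morphRg (@projM F r)).
(* If omega = 0 then c is symmetric while the commutators alternate, so the class of r equals its
   opposite and vanishes; the Magnus expansion of r is then trivial below degree 3, against
   formality. *)
have om0 : omega r D != 0.
  apply/eqP => om0; rewrite om0 in om_c; have c_sym := kap_sum_eq0 (esym om_c).
  have r0 : gcl 2 r = 0.
    have S : gcl 2 r = - gcl 2 r.
      rewrite [LHS]cE exchange_big [in RHS]cE -sumrN; apply: eq_bigr => i _.
      rewrite -sumrN; apply: eq_bigr => j _.
      by rewrite c_sym (gcl_comm_alt (x j)) // scalerN.
    exact: eq_opp0 S.
  have [mu [mu1 muM mux muV]] := magnus_exists F_free.
  have r3 := mag_gcl2 mu1 muM (mag_ord1 F_free mu1 muM mux muV) r2 r0.
  exact: (not_formal_ord3 F_free mu1 muM mux muV r3 r1 formal).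
have y_span (v : gr H 1) : lspan [set gcl 1 (proj r (x i)) | i in [set: 'I_n]] v.
  apply: (gr1_span F_free (@projM F r) (@proj_surj F r)) => i.
  by apply: lspan_mem; exists i.
have := cocycle_hilbert bar1 barM bar_nil dM bar_h bar_r dr0 (or_introl (elimN eqP om0))
  bar_x d_x (oner_neq0 _) y_span om_c c_rel.
by rewrite om0.
Qed.

(** A homomorphism killing r satisfies sum_i e_i f(x_i) = 0, which expresses f(x_i0) through the
    other values because e_i0 <> 0. *)
Lemma noncommutator_span : ~ der1 F r -> exists (e : 'I_n -> rat) i0,
  [/\ forall (V : lmodType rat) (f : F -> V), (forall g h, f (g * h)%g = f g + f h) ->
        f r = \sum_i e i *: f (x i), e i0 != 0 &
      forall v : gr H 1, lspan [set gcl 1 (proj r (x (fintype.lift i0 l))) | l in [set: 'I_p]] v].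
Proof.
move=> nr2; have [e [eE e0]] := exponents F_free r.
have [i0 ei0] : exists i0, e i0 != 0.
  apply: contrapT => N; apply: nr2; apply: e0 => i; apply/eqP; apply: contrapT => Ni.
  by apply: N; exists i; apply/negP.
have span (V : lmodType rat) (f : F -> V) : (forall g h, f (g * h)%g = f g + f h) -> f r = 0 ->
    forall i, lspan [set f (x (fintype.lift i0 l)) | l in [set: 'I_p]] (f (x i)).
  move=> fM fr i; set T := [set _ | _ in _].
  have Tl l : lspan T (f (x (fintype.lift i0 l))) by apply: lspan_mem; exists l.
  have [l ->|->] := unliftP i0 i; first exact: Tl.
  have := eE V f fM; rewrite fr (bigD1_ord i0) //= => /esym E.
  by apply: lspan_solve ei0 E _; exact: lspan_sum.
exists e, i0; split=> //; apply: (gr1_span F_free (@projM F r) (@proj_surj F r)).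
apply: (span (gr H 1) (fun g => gcl 1 (proj r g))); last by rewrite proj_r gcl_one.
by move=> g h; rewrite projM gclM.
Qed.

End Relator.

Lemma noncommutator_relator (p : nat) (F : groupType) (x : 'I_p.+1 -> F) (r : F) :
  free_on x -> ~ der1 F r -> is_hilbert (gr (quo (der2 (one_relator r)))) (hilb p false).
Proof.
move=> F_free nr2; have [e [i0 [eE ei0]]] := noncommutator_span F_free nr2.
case: p x F_free e i0 eE ei0 => [|p] x F_free e i0 eE ei0 y_span.
  exact: unspanned_hilbert y_span.
pose A := {mpoly rat[p.+1]}; pose R := wser unit A.
(* The form at i0 is forced by sum_i e_i lam_i = 0, which makes bar r = 1. *)
pose lam i : A := if unlift i0 i is Some l then 'X_l
  else - \sum_l (e (fintype.lift i0 l) / e i0) *: 'X_l.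
have lam1 i : lam i \is 1.-homog.
  rewrite /lam; case: unlift => [l|]; first by rewrite dhomogX /= mdeg1.
  by rewrite rpredN; apply: rpred_sum => l _; apply: rpredZ; rewrite dhomogX /= mdeg1.
have lam_r : \sum_i e i *: lam i = 0.
  rewrite (bigD1_ord i0) //= {1}/lam unlift_none scalerN scaler_sumr addrC -sumrB big1 // => l _.
  by rewrite /lam liftK scalerA mulrC divfK // subrr.
have [bar [D [[bar1 barM bar_nil DM bar_h] barx Dx barE]]] := xexp_cocycle F_free lam1.
have [bar_r Dr] := barE r e eE.
have {}bar_r : bar r = 1 by rewrite bar_r lam_r; exact: expser0.
(* The rows of Delta satisfy one linear relation, with the Fox derivatives of r as
   coefficients, so that d r = 0. *)
pose Delta : 'M[R]_(p.+2, p.+1) := \matrix_(i, l)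
  if unlift i0 i is Some j then D r 0 i0 *+ (l == j) else - D r 0 (fintype.lift i0 l).
pose d g := D g *m Delta.
have dM g h : d (g * h)%g = d g + bar g *: d h by rewrite /d DM mulmxDl scalemxAl.
have dr : d r = 0.
  apply/rowP => l; rewrite !mxE (bigD1_ord i0) //= mxE unlift_none (bigD1 l) //= mxE liftK eqxx.
  rewrite big1 => [|j /negPf jl]; last by rewrite mxE liftK eq_sym jl mulr0.
  by rewrite addr0 mulrN mulrC addNr.
have om0 : omega r d = 0 by apply/ffunP => j; rewrite !ffunE dr mxE.
have bar_y l : cf 1 (bar (x (fintype.lift i0 l))) = 'X_l by rewrite barx cf1_exp /lam liftK.
(* The diagonal entries of Delta are the Fox derivative of r at i0, with constant term e i0; this is
   the nonzero scalar a of the general computation. *)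
have d_y l j : cf 0 (d (x (fintype.lift i0 l)) 0 j) = (e i0)%:MP *+ (j == l).
  by rewrite /d Dx -rowE !mxE liftK -Dr; case: (j == l).
have dr0 j : cf 0 (d r 0 j) = 0 by rewrite dr mxE.
have om_c : omega r d = \sum_i \sum_j (0 : rat) *: kap i j 1.
  by rewrite om0 big1 // => i _; rewrite big1 // => j _; rewrite scale0r.
have c_rel : \sum_i \sum_j (0 : rat) *: gcl 2 [~ proj r (x (fintype.lift i0 i)), proj r (x (fintype.lift i0 j))]%g
    = 0 :> gr (quo (der2 (one_relator r))) 2.
  by rewrite big1 // => i _; rewrite big1 // => j _; rewrite scale0r.
have := cocycle_hilbert bar1 barM bar_nil dM bar_h bar_r dr0 (or_intror dr)
  bar_y d_y ei0 y_span om_c c_rel.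
by rewrite om0 eqxx.
Qed.

Theorem proposition8p6 (n : nat) (F : groupType) (x : 'I_n -> F) (r : F)
    (F_free : free_on x) (r_neq1 : r <> 1%g)
    (G_formal : one_formal (one_relator r)) :
  (der1 F r ->
     is_hilbert (gr (quo (der2 (one_relator r))))
       (fun k => (1 + n%:R *: 'X)`_k
          - series_div (1 - n%:R *: 'X + 'X^2) ((1 - 'X) ^+ n) k)) /\
  (~ der1 F r ->
     is_hilbert (gr (quo (der2 (one_relator r))))
       (fun k => (1 + n.-1%:R *: 'X)`_k
          - series_div (1 - n.-1%:R *: 'X) ((1 - 'X) ^+ n.-1) k)).
Proof.
case: n x F_free => [|p] x F_free.
  (* In rank 0 the group F is trivial, so r <> 1 is impossible. *)
  have F1 (g : F) : g = 1%g by elim/(free_ind F_free): g => // -[].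
  by case: r_neq1; exact: F1.
split=> [r2|nr2]; first exact: (commutator_relator F_free r2 r_neq1 G_formal).
move=> k; have [d [dV dE]] := noncommutator_relator F_free nr2 k.
by exists d; split=> //; rewrite -dE /hilb mulr0n addr0.
Qed.
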